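(* For every $(x,t)\in\mathbb{R}^2$ the functional $\rho\mapsto\mathcal E[\rho](x,t)$ attains a minimum on $\mathcal A$; denote $E^{\min}_\infty(x,t):=\min_{\rho\in\mathcal A}\mathcal E[\rho](x,t)$. Moreover $$\lim_{N\to\infty}E^{\min}_N(x,t)=E^{\min}_\infty(x,t)$$ uniformly on compact subsets of $(x,t)\in\mathbb{R}^2$.
   Context: Fix $\delta>0$ and an admissible $u_0$ ($C^1$, positive, $\to0$ at $\pm\infty$, $\int(x^2+1)u_0<\infty$, $u_0'$ vanishing only at $x_{\max}$ where the maximum $u_{\max}$ is attained) with $\int\sqrt{u_0}<\infty$. Lambert $W$: standard branches $W_n$ of the inverse of $w\mapsto we^w$; for real $a\in[-e^{-1},0)$, $W_0(a)\in[-1,0)$, $W_{-1}(a)\le-1$; for real $a<-e^{-1}$, $W_0(a)$ is the solution with $0<\operatorname{Im}w<\pi$, $W_{-1}(a):=\overline{W_0(a)}$. $\zeta(\kappa):=\kappa\cot(2\delta\kappa)+i\kappa$, $\zeta(0):=1/(2\delta)$; $E(\zeta):=-\zeta+\frac1{2\delta}(1+\operatorname{Log}(2\delta\zeta))$; $\kappa_{\max}:=\operatorname{Im}[-\frac1{2\delta}W_{-1}(-e^{2\delta u_{\max}-1})]$; for $\kappa\in(0,\kappa_{\max}]$, $x_-(\kappa)\le x_{\max}\le x_+(\kappa)$ solve $u_0(x)=E(\zeta(\kappa))$, $x_\pm(0)=\pm\infty$; $a(\kappa,u):=-2\delta\zeta(\kappa)e^{-2\delta(\zeta(\kappa)+u)}$.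 $R^{\mathrm{Wyl}}(\kappa):=\frac1{4\delta}\int_{x_-(\kappa)}^{x_+(\kappa)}[W_0-W_{-1}](a(\kappa,u_0(x)))dx$ (strictly decreasing, $R^{\mathrm{Wyl}}(\kappa_{\max})=0$); $\rho^{\mathrm{Wyl}}:=-\frac{d}{d\kappa}R^{\mathrm{Wyl}}$. $\theta_+(\kappa):=\kappa x_+(\kappa)+\int_{x_+(\kappa)}^\infty\operatorname{Im}[\zeta(\kappa)+\frac1{2\delta}W_{-1}(a(\kappa,u_0(x)))]dx$. $\epsilon_N:=R^{\mathrm{Wyl}}(0)/(\pi N)$; $\kappa_n$ defined by $R^{\mathrm{Wyl}}(\kappa_n)=\pi(n-\frac12)\epsilon_N$, $\zeta_n:=\zeta(\kappa_n)$, $1\le n\le N$. $V(\kappa;x,t):=x\kappa+t\operatorname{Im}[(\zeta(\kappa)-\frac1{2\delta})^2]-\theta_+(\kappa)$. $g(\zeta,\lambda):=\log|(\zeta-\bar\lambda)/(\zeta-\lambda)|$ ($\zeta\neq\lambda$), $g(\zeta,\zeta):=\log|\zeta-\bar\zeta|$. For $S\subseteq\{1,\dots,N\}$: $E_{N,S}(x,t):=\pi\epsilon_N\sum_{n\in S}V(\kappa_n;x,t)+\frac{\pi\epsilon_N^2}2\sum_{n,\ell\in S}g(\zeta_n,\zeta_\ell)$, and $E^{\min}_N(x,t):=\min_SE_{N,S}(x,t)$. $\mathcal A$: real measurable $\rho$ on $[0,\kappa_{\max}]$ with $0\le\rho\le\rho^{\mathrm{Wyl}}$ a.e. $\mathcal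 L[\rho](\lambda):=\frac1\pi\int_0^{\kappa_{\max}}\log\big|\frac{\lambda-\overline{\zeta(\eta)}}{\lambda-\zeta(\eta)}\big|\rho(\eta)d\eta$; $\mathcal E[\rho](x,t):=\int_0^{\kappa_{\max}}\big(V(\kappa;x,t)+\frac12\mathcal L[\rho](\zeta(\kappa))\big)\rho(\kappa)\,d\kappa$. *)

(* Defs.v *)
From mathcomp Require Import all_boot all_order all_algebra.
From mathcomp Require Import all_classical all_reals all_analysis.
Set Implicit Arguments.
Unset Strict Implicit.
Unset Printing Implicit Defensive.
Import Order.TTheory GRing.Theory Num.Theory.
Import numFieldNormedType.Exports.
Local Open Scope ring_scope.
Local Open Scope classical_set_scope.

Section Cplx.
Variable R : realType.
Definition cplx := (R * R)%type.
Definition cRe (z : cplx) : R := z.1.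
Definition cIm (z : cplx) : R := z.2.
Definition cofR (r : R) : cplx := (r, 0).
Definition cadd (z w : cplx) : cplx := (z.1 + w.1, z.2 + w.2).
Definition copp (z : cplx) : cplx := (- z.1, - z.2).
Definition csub (z w : cplx) : cplx := cadd z (copp w).
Definition cmul (z w : cplx) : cplx :=
  (z.1 * w.1 - z.2 * w.2, z.1 * w.2 + z.2 * w.1).
Definition cscale (r : R) (z : cplx) : cplx := (r * z.1, r * z.2).
Definition cconj (z : cplx) : cplx := (z.1, - z.2).
Definition cabs (z : cplx) : R := Num.sqrt (z.1 ^+ 2 + z.2 ^+ 2).
Definition cexp (z : cplx) : cplx := (expR z.1 * cos z.2, expR z.1 * sin z.2).
Definition cArg (z : cplx) : R :=
  xget 0 [set th : R | - pi < th <= pi /\ z = (cabs z * cos th, cabs z * sin th)].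
Definition cLog (z : cplx) : cplx := (ln (cabs z), cArg z).

Definition lambertW_eq (w a : cplx) := cmul w (cexp w) = a.
Definition W0 (a : cplx) : cplx :=
  xget (0, 0) [set w | lambertW_eq w a /\
    (cIm a = 0 /\ cRe a < 0 ->
      (- expR (-1) <= cRe a -> cIm w = 0 /\ -1 <= cRe w /\ cRe w < 0) /\
      (cRe a < - expR (-1) -> 0 < cIm w < pi))].
Definition Wm1 (a : cplx) : cplx :=
  if (cIm a == 0) && (cRe a < - expR (-1)) then cconj (W0 a)
  else xget (0, 0) [set w | lambertW_eq w a /\
    (cIm a = 0 /\ cRe a < 0 -> cIm w = 0 /\ cRe w <= -1)].
End Cplx.

Section Model.
Variable R : realType.
Variables (delta : R) (u0 : R -> R) (xmax : R).

Local Notation leb := (@lebesgue_measure R).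

Definition umax : R := u0 xmax.

Definition zeta (k : R) : cplx R :=
  if k == 0 then ((2 * delta)^-1, 0)
  else (k * (cos (2 * delta * k) / sin (2 * delta * k)), k).

Definition Efun (z : cplx R) : cplx R :=
  cadd (copp z) (cscale (2 * delta)^-1 (cadd (1, 0) (cLog (cscale (2 * delta) z)))).

Definition kappa_max : R :=
  cIm (cscale (- (2 * delta)^-1) (Wm1 (cofR (- expR (2 * delta * umax - 1))))).

Definition xplus (k : R) : R :=
  xget 0 [set x | xmax <= x /\ cofR (u0 x) = Efun (zeta k)].
Definition xminus (k : R) : R :=
  xget 0 [set x | x <= xmax /\ cofR (u0 x) = Efun (zeta k)].

(* integration window [x_-(kappa), x_+(kappa)], equal to R when kappa = 0
   (x_+(0) = +oo, x_-(0) = -oo) *)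
Definition window (k : R) : set R :=
  if k == 0 then setT else [set x | xminus k <= x <= xplus k].

Definition aa (k u : R) : cplx R :=
  cmul (cscale (- (2 * delta)) (zeta k))
       (cexp (cscale (- (2 * delta)) (cadd (zeta k) (cofR u)))).

(* R^Wyl(kappa) = (1/(4 delta)) int_{x_-}^{x_+} [W_0 - W_{-1}](a(kappa,u0 x)) dx
   (the integrand is real on the window; we integrate its real part) *)
Definition RWyl (k : R) : R :=
  (4 * delta)^-1 *
  \int[leb]_(x in window k) cRe (csub (W0 (aa k (u0 x))) (Wm1 (aa k (u0 x)))).

Definition rhoWyl (k : R) : R := - (derive1 RWyl k).

Definition theta_plus (k : R) : R :=
  k * xplus k +
  \int[leb]_(x in `]xplus k, +oo[)
     cIm (cadd (zeta k) (cscale (2 * delta)^-1 (Wm1 (aa k (u0 x))))).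

Definition epsN (N : nat) : R := RWyl 0 / (pi * N%:R).

Definition kappa_n (N n : nat) : R :=
  xget 0 [set k | 0 <= k <= kappa_max /\
                  RWyl k = pi * (n%:R - 2^-1) * epsN N].
Definition zeta_n (N n : nat) : cplx R := zeta (kappa_n N n).

Definition Vfun (k x t : R) : R :=
  let z := csub (zeta k) (cofR (2 * delta)^-1) in
  x * k + t * cIm (cmul z z) - theta_plus k.

Definition gfun (z l : cplx R) : R :=
  if z == l then ln (cabs (csub z (cconj z)))
  else ln (cabs (csub z (cconj l)) / cabs (csub z l)).

(* E_{N,S}(x,t); S is a subset of {1,...,N}, encoded as a subset of 'I_N
   via i |-> i+1 *)
Definition ENS (N : nat) (S : {set 'I_N}) (x t : R) : R :=
  pi * epsN N * (\sum_(i in S) Vfun (kappa_n N i.+1) x t) +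
  pi * epsN N ^+ 2 / 2 *
    (\sum_(i in S) \sum_(j in S) gfun (zeta_n N i.+1) (zeta_n N j.+1)).

Definition EminN (N : nat) (x t : R) : R :=
  \big[Num.min/ENS (finset.set0 : {set 'I_N}) x t]_(S : {set 'I_N}) ENS S x t.

Definition admissible (rho : R -> R) : Prop :=
  measurable_fun `[0, kappa_max] rho /\
  {ae leb, forall k, k \in `[0, kappa_max] -> 0 <= rho k <= rhoWyl k}.

Definition Lop (rho : R -> R) (l : cplx R) : R :=
  pi^-1 * \int[leb]_(e in `[0, kappa_max])
     (ln (cabs (csub l (cconj (zeta e))) / cabs (csub l (zeta e))) * rho e).

Definition Efunc (rho : R -> R) (x t : R) : R :=
  \int[leb]_(k in `[0, kappa_max])
     ((Vfun k x t + 2^-1 * Lop rho (zeta k)) * rho k).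

End Model.

Definition admissible_u0 (R : realType) (u0 : R -> R) (xmax : R) : Prop :=
  (forall x, derivable u0 x 1) /\ continuous (derive1 u0) /\
  (forall x, 0 < u0 x) /\
  (u0 x @[x --> +oo] --> 0) /\ (u0 x @[x --> -oo] --> 0) /\
  (@lebesgue_measure R).-integrable setT (fun x => ((x ^+ 2 + 1) * u0 x)%:E) /\
  (forall x, derive1 u0 x = 0 <-> x = xmax) /\
  (forall x, u0 x <= u0 xmax).

(* Main.v *)
Require Import Defs.
From HB Require Import structures.
From mathcomp Require Import all_boot all_order all_algebra.
From mathcomp Require Import ring lra.
From mathcomp Require Import all_classical all_reals all_analysis.
From mathcomp Require Import measurable_realfun.
Import Order.TTheory GRing.Theory Num.Theory.
Import numFieldNormedType.Exports.
Local Open Scope ring_scope.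
Local Open Scope classical_set_scope.
Set Implicit Arguments.
Unset Strict Implicit.
Unset Printing Implicit Defensive.

(** Write [h = 2 delta].  On the curve [zeta] one has [E (zeta k) = phase (h k) / h]
    for an explicit increasing function [phase], and the differences of the Lambert
    branches become a real function [gap], vanishing on the negative half-line, with
    [R^Wyl k = (2h)^-1 int gap (h u0(x) - phase (h k)) dx].  By Tonelli's theorem
    [R^Wyl] is the tail of the integral of a density [r], which is [rho^Wyl] almost
    everywhere by Lebesgue differentiation; interpolating between the moment bound
    and the integrability of [sqrt u0] gives
    [c |R^Wyl k - R^Wyl e|^6 <= |k - e|].

    Because of this Hoelder bound, mollifying the logarithmic kernel changes it by a
    small multiple of [|R^Wyl k - R^Wyl e|^(-1/2)], whose integrals against [r] and
    whose sums over the nodes are bounded.  The mollified energies are weakly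
    continuous.  A set [S] of nodes is weakly close to the density that equals [r] on
    the cells of [S] and [0] elsewhere, and conversely every admissible density is
    weakly close to the set obtained by rounding down its cumulative mass.  As the
    densities [0 <= rho <= r] are weakly compact, the minimum is attained and the
    discrete minima converge to it. *)

(** * Integration and weak compactness *)

(** No pointwise bound on [rho^Wyl] is at hand, so the spacing of the nodes in [kappa] is not
    controlled. In the level variable [R^Wyl], however, the measure [r dk] becomes Lebesgue measure
    on [[0, R^Wyl 0]] and the nodes become equispaced midpoints. Singular integrals and sums are
    therefore estimated in levels, and the Hoelder bound carries the logarithm over to that
    variable. Its exponent comes from [gap], which is only Hoelder of exponent 1/2 where the two
    branches meet: the increment of [gap] in [k] is at most [C |k - e|^(1/2)] uniformly in [x] and
    at most [B sqrt u0], and balancing the two against the second moment costs a cube. The diagonal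
    terms [ln (2 kappa_n)] are [O(sqrt N)] by the same bound at [0], so that after division by [N^2]
    their sum is [O(N^(-1/2))]. Only the potential depends on [(x, t)], and linearly, which gives
    uniformity on compact sets. At [kappa = 0] the point [x_+] is infinite, so [theta_plus] is
    matched with a continuous function for [kappa > 0] only; this suffices, since the nodes are
    positive and a point is null. *)

Section RealIntegrable.
Context d (T : measurableType d) (R : realType).
Variables (mu : {measure set T -> \bar R}) (D : set T).
Hypothesis mD : measurable D.
Implicit Types f g : T -> R.

Lemma integrable_scale k f : mu.-integrable D (EFin \o f) ->
  mu.-integrable D (EFin \o (fun x => k * f x)).
Proof. by move=> fi; have := integrableZl mD k fi. Qed.

Lemma integrable_add f g : mu.-integrable D (EFin \o f) ->
  mu.-integrable D (EFin \o g) -> mu.-integrable D (EFin \o (fun x => f x + g x)).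
Proof.
move=> fi gi; have := integrableD mD fi gi.
by apply: eq_integrable => // x _ /=; rewrite EFinD.
Qed.

Lemma integrable_sub f g : mu.-integrable D (EFin \o f) ->
  mu.-integrable D (EFin \o g) -> mu.-integrable D (EFin \o (fun x => f x - g x)).
Proof.
move=> fi gi; have := integrableB mD fi gi.
by apply: eq_integrable => // x _ /=; rewrite EFinB.
Qed.

Lemma integrable_absr f : mu.-integrable D (EFin \o f) ->
  mu.-integrable D (EFin \o (fun x => `|f x|)).
Proof. by move=> fi; have := integrable_norm fi. Qed.

Lemma integrable_dominated f g : measurable_fun D f ->
  (forall x, D x -> `|f x| <= g x) ->
  mu.-integrable D (EFin \o g) -> mu.-integrable D (EFin \o f).
Proof.
move=> mf fg; apply: le_integrable => //; first exact/measurable_EFinP.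
by move=> x Dx /=; rewrite lee_fin (le_trans (fg _ Dx))// ler_norm.
Qed.

Lemma integrable_bounded_mul (a : R) f g : measurable_fun D f ->
  (forall x, D x -> `|f x| <= a) ->
  mu.-integrable D (EFin \o g) -> mu.-integrable D (EFin \o (fun x => f x * g x)).
Proof.
move=> mf fa gi; have mg : measurable_fun D g.
  by apply/measurable_EFinP; case/integrableP : gi.
apply: (@integrable_dominated _ (fun x => a * `|g x|)).
- exact: measurable_funM.
- by move=> x Dx; rewrite normrM ler_wpM2r// fa.
- exact/integrable_scale/integrable_absr.
Qed.

Lemma integrable_measurable f : mu.-integrable D (EFin \o f) -> measurable_fun D f.
Proof. by case/integrableP => /measurable_EFinP. Qed.

Lemma Rintegral_fineK f : mu.-integrable D (EFin \o f) ->
  (\int[mu]_(x in D) f x)%:E = (\int[mu]_(x in D) (f x)%:E)%E.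
Proof. by move=> fi; rewrite /Rintegral fineK//; exact: integrable_fin_num. Qed.

End RealIntegrable.

Section Partition.
Context {R : realType}.
Local Notation mu := (@lebesgue_measure R).
Implicit Types (f phi sigma : R -> R) (c p : nat -> R).

Lemma Rintegral_partition f c n :
  {homo c : i j / (i <= j)%N >-> j <= i} ->
  mu.-integrable `]c n, c 0%N] (EFin \o f) ->
  \int[mu]_(x in `]c n, c 0%N]) f x =
  \sum_(i < n) \int[mu]_(x in `]c i.+1, c i]) f x.
Proof.
move=> dc; elim: n => [|n IH] fi.
  by rewrite big_ord0 set_itvoc0 Rintegral_set0.
have cn : c n.+1 <= c n by exact: dc.
have c0 : c n <= c 0%N by exact: dc.
rewrite big_ord_recr /= -IH; last first.
  by apply: integrableS fi => //; apply: subset_itvr; rewrite bnd_simp.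
rewrite -(@Rintegral_itvB _ f (BRight (c n.+1)) (BRight (c 0%N)) (c n)) ?bnd_simp//.
by rewrite subrK.
Qed.

(** A Riemann-sum estimate with exact cell masses: only [phi] is frozen, at a sample point for each
    cell. The signed weight [sigma] serves both for differences of densities and for cell densities.
    The partition decreases because cells are counted by level, and level 0 sits at the right
    end. *)
Lemma Rintegral_sampling sigma phi c p n (e : R) :
  {homo c : i j / (i <= j)%N >-> j <= i} ->
  mu.-integrable `]c n, c 0%N] (EFin \o sigma) ->
  mu.-integrable `]c n, c 0%N] (EFin \o (fun x => phi x * sigma x)) ->
  (forall i x, (i < n)%N -> c i.+1 < x <= c i -> `|phi x - phi (p i)| <= e) ->
  `|\int[mu]_(x in `]c n, c 0%N]) (phi x * sigma x)
    - \sum_(i < n) phi (p i) * \int[mu]_(x in `]c i.+1, c i]) sigma x| <=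
  e * \int[mu]_(x in `]c n, c 0%N]) `|sigma x|.
Proof.
move=> dc si psi osc.
have sub (i : 'I_n) : `]c i.+1, c i] `<=` `]c n, c 0%N].
  by apply: subset_itv; rewrite bnd_simp; exact: dc.
have ai : mu.-integrable `]c n, c 0%N] (EFin \o (fun x => `|sigma x|)).
  exact: integrable_absr.
rewrite (Rintegral_partition dc) // -sumrB.
rewrite (Rintegral_partition dc ai) mulr_sumr.
apply: le_trans (ler_norm_sum _ _ _) _; apply: ler_sum => i _.
have si' : mu.-integrable `]c i.+1, c i] (EFin \o sigma) by exact: integrableS si.
have pi' : mu.-integrable `]c i.+1, c i] (EFin \o (fun x => phi x * sigma x)).
  by exact: integrableS psi.
rewrite -RintegralZl// -RintegralB//; last exact: integrable_scale.
rewrite -RintegralZl//; last exact: integrable_absr.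
have di : mu.-integrable `]c i.+1, c i]
    (EFin \o (fun x => phi x * sigma x - phi (p i) * sigma x)).
  by apply: integrable_sub => //; exact: integrable_scale.
apply: le_trans (le_normr_Rintegral _ di) _ => //.
apply: le_Rintegral => //.
- exact: integrable_absr.
- exact/integrable_scale/integrable_absr.
by move=> x; rewrite /= in_itv /= => xi; rewrite -mulrBl normrM ler_wpM2r//; exact: (osc i).
Qed.

End Partition.

(** Compactness gives a cluster point, and an ultrafilter converges to each of its cluster points.
    Limits along one ultrafilter exist for all bounded sequences at once, so the masses of all
    measurable sets converge together, with no diagonal extraction. *)
Lemma ultrafilter_limit (R : realType) (U : set_system nat) (u : nat -> R) (M : R) :
  UltraFilter U -> (forall n, 0 <= u n <= M) -> exists l : R, u @ U --> l.
Proof.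
move=> UU uM.
have uI : (u @ U) `[0, M]%classic.
  apply: (@filterS _ U _ setT); last exact: filterT.
  by move=> n _; rewrite /preimage/= in_itv/= uM.
have PU : ProperFilter U by exact: ultra_proper.
have [l [_ cl]] := @segment_compact R 0 M (u @ U) (fmap_proper_filter u PU) uI.
exists l => V Vl.
have [//|UV] := in_ultra_setVsetC (u @^-1` V) UU.
by have [z []] := cl (~` V) V UV Vl.
Qed.

Section DominatedLimit.
Context d (T : measurableType d) (R : realType).
Variable mu : {sigma_finite_measure set T -> \bar R}.

Lemma Rintegral_bigcup_ge (F : nat -> set T) (f : T -> R) n :
  (forall i, measurable (F i)) -> trivIset setT F ->
  mu.-integrable setT (EFin \o f) -> (forall x, 0 <= f x) ->
  \sum_(i < n) \int[mu]_(x in F i) f x <= \int[mu]_(x in \bigcup_i F i) f x.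
Proof.
move=> mF tF fi f0.
have mU : measurable (\bigcup_i F i) by exact: bigcup_measurable.
have fS A : measurable A -> mu.-integrable A (EFin \o f).
  by move=> mA; apply: integrableS fi.
rewrite -lee_fin -sumEFin Rintegral_fineK//; last exact: fS.
rewrite ge0_integral_bigcup//; last 2 first.
- exact/measurable_EFinP/(@integrable_measurable _ _ _ mu)/fS.
- by move=> x _; rewrite lee_fin.
rewrite (eq_bigr (fun i : 'I_n => (\int[mu]_(x in F i) (f x)%:E)%E)); last first.
  by move=> i _; rewrite Rintegral_fineK//; exact: fS.
rewrite -(big_mkord xpredT (fun i => (\int[mu]_(x in F i) (f x)%:E)%E)).
by apply: nneseries_lim_ge => i _ _; apply: integral_ge0 => x _; rewrite lee_fin.
Qed.

(* The limit of the charges [A |-> int_A rho_n] along an ultrafilter is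
   finitely additive, and countably additive because it is dominated by
   [A |-> int_A r]; the Radon-Nikodym theorem then provides the density. *)
Lemma dominated_weak_cluster (r : T -> R) (rho : nat -> T -> R) :
  mu.-integrable setT (EFin \o r) ->
  (forall n, measurable_fun setT (rho n)) ->
  (forall n x, 0 <= rho n x <= r x) ->
  exists rho0 : T -> R, [/\ measurable_fun setT rho0,
    forall x, 0 <= rho0 x <= r x &
    forall m (A : nat -> set T), (forall i, measurable (A i)) ->
    forall e : R, 0 < e -> forall n0, exists2 n, (n0 <= n)%N &
      forall i, (i < m)%N ->
      `|\int[mu]_(x in A i) rho n x - \int[mu]_(x in A i) rho0 x| < e].
Proof.
move=> ri mrho rho_r.
have r0 x : 0 <= r x by have /andP[/le_trans] := rho_r 0%N x; apply.
(* The ultrafilter refines the cofinite filter, so that [n0 <= n] can be imposed at the end. *)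
have [U [UU subU]] := ultraFilterLemma (@eventually_filter).
have PU : ProperFilter U by exact: ultra_proper.
have rhoi n : mu.-integrable setT (EFin \o rho n).
  apply: integrable_dominated ri => // x _.
  by have /andP[? ?] := rho_r n x; rewrite ger0_norm.
have rS A : measurable A -> mu.-integrable A (EFin \o r).
  by move=> mA; apply: integrableS ri.
have rhoS n A : measurable A -> mu.-integrable A (EFin \o rho n).
  by move=> mA; apply: integrableS (rhoi n).
pose I n A := \int[mu]_(x in A) rho n x.
pose m A := \int[mu]_(x in A) r x.
have IM A n : measurable A -> 0 <= I n A <= m A.
  move=> mA; apply/andP; split.
    by apply: Rintegral_ge0 => x _; have /andP[] := rho_r n x.
  by apply: le_Rintegral; [exact: mA|exact: rhoS|exact: rS|];
     move=> x _; have /andP[] := rho_r n x.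
pose L A : R := xget 0 [set l : R | (fun n => I n A) @ U --> l].
have LP A : measurable A -> (fun n => I n A) @ U --> L A.
  move=> mA; have [l ll] := @ultrafilter_limit R U (fun n => I n A) (m A) UU
    (fun n => IM A n mA).
  by rewrite /L; apply: (@xgetPex _ (0:R) [set l : R | (fun n => I n A) @ U --> l]); exists l.
have LM A : measurable A -> 0 <= L A <= m A.
  move=> mA; apply/andP; split.
    by apply: (cvgr_to_ge (LP A mA)); apply: filterS filterT => n _ /=;
       have /andP[] := IM A n mA.
  by apply: (cvgr_to_le (LP A mA)); apply: filterS filterT => n _ /=;
     have /andP[] := IM A n mA.
pose nu A := if pselect (measurable A) then (L A)%:E else 0%E.
have nuE A : measurable A -> nu A = (L A)%:E by rewrite /nu; case: pselect.
have nu0 : nu set0 = 0%E.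
  rewrite nuE//; congr EFin; apply/eqP; rewrite eq_le andbC.
  by have := LM set0 measurable0; rewrite /m Rintegral_set0.
have nufin A : measurable A -> nu A \is a fin_num by move=> mA; rewrite nuE.
have nus : semi_sigma_additive nu.
  move=> F mF tF mU; rewrite nuE//.
  rewrite (_ : (fun n => _) = EFin \o (fun n => \sum_(i < n) L (F i))); last first.
    apply/funext => n /=; rewrite big_mkord -sumEFin.
    by apply: eq_bigr => i _; rewrite nuE.
  apply: cvg_EFin; first by apply: nearW.
  rewrite -[fine \o _]/(fun n => \sum_(i < n) L (F i)).
  have mcvg : (fun n => \sum_(i < n) m (F i)) @ \oo --> m (\bigcup_n F n).
    have := @semi_sigma_additive_nng_induced _ _ _ mu (EFin \o r) _ _ F mF tF mU.
    move=> /(_ _)/(_ _)-/(_ (measurable_int _ ri)).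
    have rr x : (0 <= (EFin \o r) x)%E by rewrite lee_fin.
    move=> /(_ rr); rewrite -Rintegral_fineK//; last exact: rS.
    rewrite (_ : (fun n => _) = EFin \o (fun n => \sum_(i < n) m (F i))).
      by move=> /fine_cvgP[].
    apply/funext => n /=; rewrite big_mkord -sumEFin.
    by apply: eq_bigr => i _; rewrite Rintegral_fineK//; exact: rS.
  (* The tail of the limit charge lies between 0 and the tail for [r]: [Rintegral_bigcup_ge] applied
     to [rho k] and to [r - rho k] gives this at each index, and both bounds pass to the limit along
     [U]. *)
  have gap n : 0 <= L (\bigcup_n F n) - \sum_(i < n) L (F i)
              <= m (\bigcup_n F n) - \sum_(i < n) m (F i).
    have c : (fun k => I k (\bigcup_n F n) - \sum_(i < n) I k (F i)) @ U -->
             L (\bigcup_n F n) - \sum_(i < n) L (F i).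
      apply: cvgB; first exact: LP.
      elim: n => [|n IH].
        rewrite big_ord0 (_ : (fun _ => _) = cst 0); first exact: cvg_cst.
        by apply/funext => k; rewrite big_ord0.
      rewrite big_ord_recr (_ : (fun _ => _) =
        fun k => \sum_(i < n) I k (F i) + I k (F n)); last first.
        by apply/funext => k; rewrite big_ord_recr.
      by apply: cvgD; [exact: IH|exact: LP].
    apply/andP; split.
      apply: (cvgr_to_ge c); apply: filterS filterT => k _.
      rewrite subr_ge0; apply: Rintegral_bigcup_ge => // x.
      by have /andP[] := rho_r k x.
    apply: (cvgr_to_le c); apply: filterS filterT => k _.
    have di : mu.-integrable setT (EFin \o (fun x => r x - rho k x)).
      exact: integrable_sub.
    have := @Rintegral_bigcup_ge F _ n mF tF di.
    have dd x : 0 <= r x - rho k x.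
      by rewrite subr_ge0; have /andP[] := rho_r k x.
    move=> /(_ dd); rewrite RintegralB//; [|exact: rS|exact: rhoS].
    rewrite (eq_bigr (fun i : 'I_n => m (F i) - I k (F i))); last first.
      by move=> i _; rewrite RintegralB//; [exact: rS|exact: rhoS].
    by rewrite sumrB /I /m; lra.
  apply: (@squeeze_cvgr _ _ _ _ (fun n => L (\bigcup_n F n) - m (\bigcup_n F n)
     + \sum_(i < n) m (F i)) (cst (L (\bigcup_n F n)))); last exact: cvg_cst.
  - by apply: nearW => n; have := gap n; rewrite /cst; lra.
  - rewrite -[X in _ --> X](subrK (m (\bigcup_n F n))).
    by apply: cvgD => //; exact: cvg_cst.
pose nuC : {charge set T -> \bar R} := HB.pack nu (isCharge.Build _ _ _ nu nu0 nufin nus).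
have dom : nuC `<< mu.
  apply/null_content_dominatesP => A mA A0; rewrite /= nuE//; congr EFin.
  apply/eqP; rewrite eq_le andbC.
  have := LM A mA; rewrite /m /Rintegral.
  by rewrite (null_set_integral mA _ A0)//; exact: measurable_int (rS A mA).
pose f := Radon_Nikodym nuC mu.
have ffin x : f x \is a fin_num by exact: Radon_Nikodym_fin_num.
pose g x := fine (f x).
have gE : EFin \o g = f by apply/funext => x; rewrite /= fineK.
have gi : mu.-integrable setT (EFin \o g).
  by rewrite gE; exact: Radon_Nikodym_integrable.
have gS A : measurable A -> mu.-integrable A (EFin \o g).
  by move=> mA; apply: integrableS gi.
have gL A : measurable A -> \int[mu]_(x in A) g x = L A.
  move=> mA; apply: EFin_inj; rewrite Rintegral_fineK//; last exact: gS.
  rewrite -nuE// -[nu A]/(nuC A) (Radon_Nikodym_integral dom mA).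
  by apply: eq_integral => x _; rewrite -[LHS]/((EFin \o g) x) gE.
(* The bounds on the derivative [g] hold only almost everywhere; clipping makes them hold
   everywhere. No mass changes: where [g < 0] the nonnegative charge has a nonpositive density, so
   its mass is 0, and where [g > r] the bound of the charge by the mass of [r] forces equality. *)
pose h (x : T) : R := Num.max 0 (Num.min (g x) (r x)).
have mr := integrable_measurable ri.
have mg := integrable_measurable gi.
have mh : measurable_fun setT h.
  by apply: measurable_maxr => //; exact: measurable_minr.
have h0 x : 0 <= h x <= r x.
  by rewrite /h le_max lexx/= ge_max r0/= ge_min lexx orbT.
have hi : mu.-integrable setT (EFin \o h).
  apply: integrable_dominated ri => // x _.
  by have /andP[? ?] := h0 x; rewrite ger0_norm.
have hS A : measurable A -> mu.-integrable A (EFin \o h).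
  by move=> mA; apply: integrableS hi.
have split2 A B (k : T -> R) : measurable A -> measurable B ->
    mu.-integrable setT (EFin \o k) ->
    \int[mu]_(x in A) k x = \int[mu]_(x in A `&` B) k x + \int[mu]_(x in A `&` ~` B) k x.
  move=> mA mB ki; rewrite -Rintegral_setU.
  - by rewrite -setIUr setUv setIT.
  - exact: measurableI.
  - by apply: measurableI => //; exact: measurableC.
  - rewrite -setIUr setUv setIT; exact: integrableS ki.
  - by apply/disj_setPS => x [[_ ?] []].
have hL A : measurable A -> \int[mu]_(x in A) h x = L A.
  move=> mA.
  pose N := [set x | g x < 0]; pose P := [set x | r x < g x].
  have mlt (u v : T -> R) : measurable_fun setT u -> measurable_fun setT v ->
      measurable [set x | u x < v x].
    move=> mu' mv.
    rewrite [X in measurable X](_ : _ = setT `&` (fun x => u x < v x) @^-1` [set true]).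
      exact: measurable_fun_ltr.
    by rewrite setTI; apply/seteqP; split => x.
  have mN : measurable N by exact: mlt.
  have mP : measurable P by exact: mlt.
  have mAN := measurableI _ _ mA mN.
  have mAN' := measurableI _ _ mA (measurableC mN).
  have mB := measurableI _ _ mAN' mP.
  have mB' := measurableI _ _ mAN' (measurableC mP).
  rewrite -gL// (split2 A N h)// (split2 A N g)//.
  rewrite (split2 (A `&` ~` N) P h)// (split2 (A `&` ~` N) P g)//.
  congr (_ + (_ + _)).
  - transitivity (0 : R).
      rewrite (@eq_Rintegral _ _ _ _ _ (cst 0)); last first.
        move=> x /set_mem[_ /= gx]; rewrite /h; apply/max_idPl.
        by rewrite ge_min ltW.
      by rewrite /Rintegral/= integral0.
    apply/eqP; rewrite eq_le; apply/andP; split.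
      by rewrite gL//; have /andP[] := LM _ mAN.
    rewrite -oppr_ge0 -[X in - X]mul1r -mulNr -RintegralZl//; last exact: gS.
    by apply: Rintegral_ge0 => x [_ /= /ltW]; rewrite mulN1r oppr_ge0.
  - transitivity (m (A `&` ~` N `&` P)).
      apply: eq_Rintegral => x /set_mem[_ /= gx]; rewrite /h min_r ?ltW//.
      exact/max_idPr.
    apply/eqP; rewrite eq_le; apply/andP; split.
      by apply: le_Rintegral; [exact: mB|exact: rS|exact: gS|move=> x [_ /ltW]].
    by rewrite gL//; have /andP[] := LM _ mB.
  - apply: eq_Rintegral => x /set_mem[[_ /= /negP]].
    rewrite -leNgt => gx /negP; rewrite -leNgt => xr.
    by rewrite /h min_l//; apply/max_idPr.
exists h; split => // k A mA e e0 n0.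
suff /filter_ex[n [n0n An]] : U [set n | (n0 <= n)%N /\ forall i, (i < k)%N ->
    `|I n (A i) - L (A i)| < e].
  by exists n => // i ik; rewrite hL//; exact: An.
apply: filterI; first by apply: subU; exists n0.
elim: k => [|k IH]; first by apply: filterS filterT => n _ i.
have := LP (A k) (mA k) => /cvgrPdist_lt/(_ _ e0).
apply: filterS2 IH => n /= H1 H2 i; rewrite ltnS leq_eqVlt => /predU1P[->|/H1//].
by rewrite distrC.
Qed.

End DominatedLimit.

(** * Uniform continuity on a compact interval *)

Section Modulus.
Context {R : realType}.
Variable b : R.
Implicit Types f : R -> R.

Definition osc f (e d : R) := forall x y : R, 0 <= x <= b -> 0 <= y <= b ->
  `|x - y| <= d -> `|f x - f y| <= e.

Definition ucont f := forall e : R, 0 < e -> exists2 d : R, 0 < d & osc f e d.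

Lemma osc_le f (e e' d d' : R) : e <= e' -> d' <= d -> osc f e d -> osc f e' d'.
Proof.
move=> ee dd H x y xb yb xy; apply: (le_trans _ ee); apply: H => //.
exact: le_trans dd.
Qed.

(** Heine's theorem, through the near-covering form of compactness with the filter of small positive
    radii. Continuity is relative to [[0, b]], so that values of [f] outside do not intervene. *)
Lemma continuous_ucont f :
  (forall x : R, 0 <= x <= b -> forall e : R, 0 < e -> exists2 d : R, 0 < d &
     forall y : R, 0 <= y <= b -> `|x - y| < d -> `|f x - f y| <= e) ->
  ucont f.
Proof.
move=> cf e e0; have e20 : 0 < e / 2 by rewrite divr_gt0.
pose P (d x : R) := 0 <= x <= b -> forall y : R, 0 <= y <= b -> `|x - y| <= d -> `|f x - f y| <= e.
have /compact_near_coveringP/(_ _ (0:R)^'+ P) : compact `[0, b]%classic.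
  exact: segment_compact.
move=> /(_ _)[].
  move=> x; rewrite /= in_itv /= => xb.
  have [d d0 dP] := cf _ xb _ e20.
  have d20 : 0 < d / 2 by rewrite divr_gt0.
  exists (ball x (d / 2), [set t : R | 0 < t < d / 2]).
    split; first exact: nbhsx_ballx.
    exists (d / 2) => //= t /=; rewrite sub0r normrN => td t0.
    by rewrite t0 (le_lt_trans (ler_norm t)).
  move=> [y t] [/= xy /andP[t0 td]] yb z zb yz; rewrite /ball/= in xy.
  rewrite (_ : f y - f z = (f x - f z) - (f x - f y)); last by ring.
  rewrite (splitr e) (le_trans (ler_normB _ _))// lerD// dP//.
    rewrite (_ : x - z = (x - y) + (y - z)); last by ring.
    by rewrite (le_lt_trans (ler_normD _ _))//; lra.
  lra.
move=> d /= d0 dP; exists (d / 2); first by rewrite divr_gt0.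
move=> x y xb yb; apply: (dP (d / 2)) => //=; rewrite ?divr_gt0//.
by rewrite sub0r normrN gtr0_norm ?divr_gt0//; lra.
Qed.

(** The retraction of the line onto [[0, b]]: composing with it turns a function controlled on
    [[0, b]] alone into a continuous function on the line, to which measurability and the
    intermediate value theorem apply. *)
Definition clip (x : R) := Num.max 0 (Num.min x b).

Lemma clip_in x : 0 <= b -> 0 <= clip x <= b.
Proof. by move=> b0; rewrite /clip le_max lexx/= ge_max b0/= ge_min lexx orbT. Qed.

Lemma clip_id x : 0 <= x <= b -> clip x = x.
Proof. by move=> /andP[x0 xb]; rewrite /clip (min_idPl xb); apply/max_idPr. Qed.

Lemma clip_lip x y : 0 <= b -> `|clip x - clip y| <= `|x - y|.
Proof.
move=> b0.
have cl z : [\/ z <= 0 /\ clip z = 0, 0 <= z <= b /\ clip z = z | b <= z /\ clip z = b].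
  have [z0|z0] := leP z 0.
    by constructor 1; rewrite /clip (min_idPl (le_trans z0 b0)); split => //; apply/max_idPl.
  have [zb|zb] := leP z b; first by constructor 2; rewrite clip_id// ltW.
  by constructor 3; rewrite /clip (min_idPr (ltW zb)) ltW//; split => //; apply/max_idPr.
have h1 := ler_norm (x - y); have h2 := ler_norm (y - x); rewrite distrC in h2.
rewrite ler_norml.
by case: (cl x) => -[? ->]; case: (cl y) => -[? ->]; apply/andP; split; lra.
Qed.

Lemma ucont_clip_continuous f : 0 <= b -> ucont f -> continuous (f \o clip).
Proof.
move=> b0 uf x; apply/cvgrPdist_le => e e0; have [d d0 dP] := uf _ e0.
near=> y; apply: dP; rewrite ?clip_in//.
apply: (le_trans (clip_lip _ _ b0)); near: y.
by apply: cvgr_dist_le => //; exact: cvg_id.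
Unshelve. all: by end_near. Qed.

Lemma ucont_measurable f : 0 <= b -> ucont f -> measurable_fun `[0, b] f.
Proof.
move=> b0 uf; apply: (@eq_measurable_fun _ _ _ _ _ (f \o clip)).
  by move=> x /set_mem; rewrite /= in_itv/= => xb; rewrite clip_id.
apply: measurable_funTS; apply: continuous_measurable_fun.
exact: ucont_clip_continuous.
Qed.

Lemma ucont_bounded f : 0 <= b -> ucont f ->
  exists2 M : R, 0 < M & forall x : R, 0 <= x <= b -> `|f x| <= M.
Proof.
move=> b0 uf; have [d d0 dP] := uf 1 ltr01.
have step (m : nat) : forall x : R, 0 <= x <= b -> x <= m%:R * d ->
    `|f x - f 0| <= m%:R.
  elim: m => [|m IH] x /andP[x0 xb].
    rewrite mul0r => x0'; have -> : x = 0 by apply/eqP; rewrite eq_le x0 x0'.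
    by rewrite subrr normr0.
  rewrite -natr1 mulrDl mul1r => xm.
  have [xm'|xm'] := leP x (m%:R * d).
    by rewrite (le_trans (IH _ _ xm'))// ?x0// lerDl.
  have md0 : 0 <= m%:R * d by rewrite mulr_ge0// ltW.
  rewrite (_ : f x - f 0 = (f x - f (m%:R * d)) + (f (m%:R * d) - f 0)); last by ring.
  rewrite addrC (le_trans (ler_normD _ _))// addrC addrC lerD//.
    by apply: IH; rewrite ?md0//= (le_trans (ltW xm')).
  apply: dP; rewrite ?x0 ?xb// ?md0/= ?(le_trans (ltW xm'))//.
  by rewrite ger0_norm; lra.
pose m := (Num.truncn (b / d)).+1.
have bm : b <= m%:R * d.
  by rewrite -ler_pdivrMr// ltW// truncnS_gt.
exists (m%:R + `|f 0| + 1); first by rewrite ltr_wpDl// addr_ge0.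
move=> x xb; rewrite -[f x](subrK (f 0)) (le_trans (ler_normD _ _))//.
rewrite -addrA lerD// ?lerDl//; apply: step => //.
by rewrite (le_trans _ bm)//; case/andP: xb.
Qed.

End Modulus.

(** * The logarithmic kernel against a density profile *)

(** What the energy argument takes from the soliton problem: a density [r], its tail [Rf], the
    Hoelder bound and strict monotonicity. The limit theorem is proved for any such profile, without
    Lambert functions. *)
Record density_profile (R : realType) (b : R) (r Rf : R -> R) (c0 : R) : Prop := {
  profile_gt0 : 0 < b;
  profile_holder_gt0 : 0 < c0;
  profile_integrable : (@lebesgue_measure R).-integrable setT (EFin \o r);
  profile_ge0 : forall x, 0 <= r x;
  profileE : forall k : R, 0 <= k <= b ->
    Rf k = \int[@lebesgue_measure R]_(x in `]k, b]) r x;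
  profile_holder : forall k e : R, 0 <= k <= b -> 0 <= e <= b ->
    c0 * `|Rf k - Rf e| ^+ 6 <= `|k - e|;
  profile_lt : forall k e : R, 0 <= k <= b -> 0 <= e <= b -> k < e -> Rf e < Rf k }.

Section Profile.
Context {R : realType}.
Variables (b : R) (r Rf : R -> R) (c0 : R).
Hypothesis H : density_profile b r Rf c0.
Local Notation mu := (@lebesgue_measure R).

Let b0 : 0 <= b. Proof. exact: ltW (profile_gt0 H). Qed.
Let in0 : 0 <= (0:R) <= b. Proof. by rewrite lexx b0. Qed.
Let inb : 0 <= b <= b. Proof. by rewrite lexx b0. Qed.

Lemma profile_integrableS (A : set R) : measurable A -> mu.-integrable A (EFin \o r).
Proof. by move=> mA; apply: integrableS (profile_integrable H). Qed.

Lemma profile_end : Rf b = 0.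
Proof. by rewrite (profileE H inb) set_itvoc0 Rintegral_set0. Qed.

Lemma profile_le (k e : R) : 0 <= k <= b -> 0 <= e <= b -> k <= e -> Rf e <= Rf k.
Proof. by move=> kb eb; rewrite le_eqVlt => /predU1P[->//|/(profile_lt H kb eb)/ltW]. Qed.

Lemma profile_range (k : R) : 0 <= k <= b -> 0 <= Rf k <= Rf 0.
Proof.
move=> /[dup] kb /andP[k0 kb'].
by rewrite -[X in X <= _]profile_end !profile_le.
Qed.

Lemma profile0_gt0 : 0 < Rf 0.
Proof. by rewrite -[X in X < _]profile_end (profile_lt H)// (profile_gt0 H). Qed.

Lemma profile_le_inv (k e : R) : 0 <= k <= b -> 0 <= e <= b -> Rf k <= Rf e -> e <= k.
Proof. by move=> kb eb; apply: contraTT; rewrite -!ltNge; exact: (profile_lt H). Qed.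

Lemma profile_diff (k e : R) : 0 <= k <= b -> 0 <= e <= b -> k <= e ->
  \int[mu]_(x in `]k, e]) r x = Rf k - Rf e.
Proof.
move=> kb eb ke; rewrite (profileE H kb) (profileE H eb).
rewrite -(@Rintegral_itvB _ r (BRight k) (BRight b) e) ?bnd_simp//.
- by ring.
- exact: profile_integrableS.
- by case/andP: eb.
Qed.

Lemma profile_ucont : ucont b Rf.
Proof.
move=> e e0; exists (c0 * e ^+ 6).
  by rewrite mulr_gt0 ?exprn_gt0// (profile_holder_gt0 H).
move=> x y xb yb xy; have := le_trans (profile_holder H xb yb) xy.
by rewrite ler_pM2l ?(profile_holder_gt0 H)// ler_pXn2r// nnegrE// ltW.
Qed.

Lemma profile_surj (y : R) : 0 <= y <= Rf 0 -> exists2 k, 0 <= k <= b & Rf k = y.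
Proof.
move=> /andP[y0 yL].
have cf : {within `[0, b], continuous (Rf \o clip b)}.
  by apply: continuous_subspaceT; exact: ucont_clip_continuous b0 profile_ucont.
have [|k] := IVT b0 cf (v := y).
  by rewrite /= !clip_id// profile_end ge_min le_max y0 yL !orbT.
by rewrite in_itv/= => kb <-; exists k => //; rewrite clip_id.
Qed.

(** The inverse of [Rf] is uniformly continuous: the drop [Rf k - Rf (k + d)] is continuous and
    positive on [[0, b - d]], hence has a positive minimum there, and points more than [d] apart
    differ in level by at least that minimum. It makes cells of small mass short. *)
Lemma profile_inv_modulus (d : R) : 0 < d -> exists2 s : R, 0 < s &
  forall k e : R, 0 <= k <= b -> 0 <= e <= b -> `|Rf k - Rf e| <= s -> `|k - e| <= d.
Proof.
move=> d0; have [bd|db] := ltP b d.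
  exists 1 => // k e /andP[? ?] /andP[? ?] _.
  by rewrite ler_norml; apply/andP; split; lra.
have bd0 : 0 <= b - d by rewrite subr_ge0.
pose phi k := (Rf \o clip b) k - (Rf \o clip b) (k + d).
have cf := ucont_clip_continuous b0 profile_ucont.
have cphi : {within `[0, b - d], continuous phi}.
  apply: continuous_subspaceT => x; apply: cvgB; first exact: cf.
  apply: (@continuous_comp _ _ _ (fun k => k + d) (Rf \o clip b)); last exact: cf.
  by apply: cvgD; [exact: cvg_id|exact: cvg_cst].
have phiE k : 0 <= k <= b - d -> phi k = Rf k - Rf (k + d).
  by move=> /andP[? ?]; rewrite /phi/= !clip_id//; apply/andP; split; lra.
have [c] := EVT_min bd0 cphi; rewrite in_itv/= => cb minc.
have phic : 0 < phi c.
  rewrite phiE// subr_gt0; move/andP: cb => [? ?].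
  by apply: (profile_lt H); [apply/andP; split; lra|apply/andP; split; lra|lra].
exists (phi c / 2); first by rewrite divr_gt0.
suff main (k e : R) : 0 <= k <= b -> 0 <= e <= b -> k <= e ->
    `|Rf k - Rf e| <= phi c / 2 -> `|k - e| <= d.
  move=> k e kb eb; have [ke|/ltW ek] := leP k e; first exact: main.
  by rewrite distrC (distrC k); exact: main.
move=> kb eb ke; apply: contraTT; rewrite -!ltNge => kd.
have ked : k + d < e by rewrite distrC ger0_norm ?subr_ge0// in kd; lra.
move/andP: (kb) => [? ?]; move/andP: (eb) => [? ?].
have hk : 0 <= k <= b - d by apply/andP; split; lra.
have h : phi c <= Rf k - Rf (k + d) by rewrite -phiE//; apply: minc; rewrite in_itv.
have : Rf e <= Rf (k + d) by apply: profile_le => //; [apply/andP; split; lra|exact: ltW].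
have := profile_le kb eb ke => ? ?.
by rewrite ger0_norm ?subr_ge0//; lra.
Qed.

Definition near_level (k s : R) := `]0, b] `&` [set x | `|Rf k - Rf x| <= s].

Lemma profile_measurable : measurable_fun `]0, b] Rf.
Proof.
apply: measurable_funS (ucont_measurable b0 profile_ucont) => //.
by apply: subset_itvr; rewrite bnd_simp.
Qed.

Lemma measurable_near_level (k s : R) : measurable (near_level k s).
Proof.
rewrite [X in measurable X](_ : _ = `]0, b] `&` Rf @^-1` `[Rf k - s, Rf k + s]).
  by apply: profile_measurable => //; exact: measurable_itv.
by apply/seteqP; split => x [xb]; rewrite /= ?in_itv/= ?ler_norml => /andP[? ?];
  split => //=; rewrite ?in_itv/= ?ler_norml; apply/andP; split; lra.
Qed.

(** In the level variable [r x dx] is Lebesgue measure, and a window of half-width [s] has length at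
    most [2 * s]. The window is enclosed between the points whose levels are its ends, cut off to
    [[0, Rf 0]]. *)
Lemma mass_near_level (k s : R) : 0 <= k <= b -> 0 <= s ->
  \int[mu]_(x in near_level k s) r x <= 2 * s.
Proof.
move=> kb s0; have /andP[R0 RL] := profile_range kb.
have [|a ab Ra] := @profile_surj (Num.min (Rf k + s) (Rf 0)).
  by rewrite le_min ge_min lexx orbT addr_ge0//= (le_trans R0).
have [|c cb Rc] := @profile_surj (Num.max (Rf k - s) 0).
  by rewrite ge_max le_max lexx orbT/= (le_trans R0)// andbT; lra.
have ac : a <= c.
  apply: profile_le_inv => //; rewrite Ra Rc ge_max !le_min.
  by apply/andP; split; apply/andP; split; lra.
apply: (@le_trans _ _ (\int[mu]_(x in `[a, c]) r x)).
  have mS := measurable_near_level k s.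
  rewrite -lee_fin !Rintegral_fineK//; [|exact: profile_integrableS..].
  apply: ge0_subset_integral => //.
  - by apply: measurable_int; exact: profile_integrableS.
  - by move=> x _; rewrite lee_fin (profile_ge0 H).
  move=> x [/=]; rewrite !in_itv/= => /andP[x0 xb].
  have xb' : 0 <= x <= b by rewrite xb ltW.
  have := profile_range xb' => /andP[? ?].
  rewrite ler_norml => /andP[? ?]; apply/andP; split.
    by apply: profile_le_inv => //; rewrite Ra le_min; apply/andP; split; lra.
  by apply: profile_le_inv => //; rewrite Rc ge_max; apply/andP; split; lra.
rewrite -Rintegral_itv_obnd_cbnd; last exact: profile_integrableS.
rewrite profile_diff// Ra Rc.
have : Num.min (Rf k + s) (Rf 0) <= Rf k + s by rewrite ge_min lexx.
have : Rf k - s <= Num.max (Rf k - s) 0 by rewrite le_max lexx.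
lra.
Qed.
End Profile.

Lemma measurable_sqrt (R : realType) : measurable_fun [set: R] (@Num.sqrt R).
Proof. by apply: continuous_measurable_fun; exact: sqrt_continuous. Qed.

(** Inversion is not continuous at 0; measurability is borrowed from the real power of exponent -1,
    with which it agrees on nonnegative reals, the value at 0 included. *)
Lemma measurable_inv_ge0 d (T : measurableType d) (R : realType) (D : set T)
    (f : T -> R) : measurable D -> measurable_fun D f -> (forall x, D x -> 0 <= f x) ->
  measurable_fun D (fun x => (f x)^-1).
Proof.
move=> mD mf f0; apply: (@eq_measurable_fun _ _ _ _ _ (fun x => f x `^ (-1))).
  by move=> x /set_mem Dx; rewrite powR_inv1// f0.
exact: measurableT_comp (measurable_powR _) mf.
Qed.

Lemma Rintegral_eq_off_point (R : realType) (D : set R) (f g : R -> R) (a : R) :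
  measurable D -> measurable_fun D f -> measurable_fun D g ->
  (forall x, D x -> x != a -> f x = g x) ->
  \int[@lebesgue_measure R]_(x in D) f x = \int[@lebesgue_measure R]_(x in D) g x.
Proof.
move=> mD mf mg fg; rewrite /Rintegral; congr fine; apply: ae_eq_integral => //.
- exact/measurable_EFinP.
- exact/measurable_EFinP.
exists [set a]; split => //; first exact: lebesgue_measure_set1.
move=> x /=; apply: contra_notP => /eqP xa Dx; by rewrite fg.
Qed.

Section Singular.
Context {R : realType}.
Variables (b : R) (r Rf : R -> R) (c0 : R).
Hypothesis H : density_profile b r Rf c0.
Local Notation mu := (@lebesgue_measure R).

(** At [x = k] the value is 0, since the inverse of 0 is 0. *)
Definition level_sing (k x : R) : R := (Num.sqrt `|Rf k - Rf x|)^-1.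

Lemma level_sing_ge0 k x : 0 <= level_sing k x.
Proof. by rewrite invr_ge0 sqrtr_ge0. Qed.

Lemma measurable_level_sing (k : R) : measurable_fun `]0, b] (level_sing k).
Proof.
apply: measurable_inv_ge0 => //.
apply: measurableT_comp; first exact: measurable_sqrt.
apply: measurableT_comp => //.
by apply: measurable_funB => //; exact: profile_measurable H.
Qed.

Let c (j : nat) : R := 2 ^+ j.+1 / Num.sqrt (Rf 0).
Let A (k : R) (j : nat) := near_level b Rf k (Rf 0 / 4 ^+ j).

Let L0 : 0 < Rf 0. Proof. exact: profile0_gt0 H. Qed.

Let sq4 j : Num.sqrt (Rf 0 / 4 ^+ j) = Num.sqrt (Rf 0) / 2 ^+ j.
Proof.
rewrite (_ : 4 = 2 ^+ 2); last by rewrite -natrX.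
by rewrite -exprM mulnC exprM -exprVn sqrtrM ?ltW// sqrtr_sqr ger0_norm ?invr_ge0 ?exprn_ge0// exprVn.
Qed.

(* Dyadic layer decomposition: on the layer [L/4^(j+1) < |Rf k - Rf x| <= L/4^j]
   the singularity is at most [c j]. *)
Let layer (k x : R) : 0 <= k <= b -> 0 < x <= b -> exists j,
  level_sing k x <= c j * \1_(A k j) x.
Proof.
move=> kb /andP[x0 xb]; have xb' : 0 <= x <= b by rewrite xb ltW.
have /andP[? ?] := profile_range H kb; have /andP[? ?] := profile_range H xb'.
have yL : `|Rf k - Rf x| <= Rf 0 by rewrite ler_norml; apply/andP; split; lra.
have [y0|y0] := eqVneq (`|Rf k - Rf x|) 0.
  by exists 0%N; rewrite /level_sing y0 sqrtr0 invr0 mulr_ge0// divr_ge0// sqrtr_ge0.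
have {}y0 : 0 < `|Rf k - Rf x| by rewrite lt_neqAle eq_sym y0 normr_ge0.
have ex : exists j, Rf 0 / 4 ^+ j < `|Rf k - Rf x|.
  exists (Num.truncn (Rf 0 / `|Rf k - Rf x|)).+1.
  rewrite ltr_pdivrMr ?exprn_gt0// mulrC -ltr_pdivrMr//.
  apply: (lt_le_trans (truncnS_gt _)).
  rewrite -natrX ler_nat; apply: ltnW; exact: ltn_expl.
case: (ex_minnP ex) => -[|j] jP jmin.
  by move: jP; rewrite expr0 divr1 ltNge yL.
exists j; rewrite indicE mem_set ?mulr1; last first.
  split => /=; first by rewrite in_itv/= x0 xb.
  rewrite leNgt; apply/negP => /jmin; by rewrite ltnn.
rewrite /level_sing /c -[leRHS]invrK lef_pV2 ?posrE ?sqrtr_gt0//; last first.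
  by rewrite invr_gt0 divr_gt0 ?exprn_gt0 ?sqrtr_gt0.
by rewrite invf_div -sq4 ler_sqrt// ltW.
Qed.

(** Layer [j] is enlarged to the full window [A k j], of mass at most [2 * Rf 0 / 4 ^+ j]; times
    [c j] this is [4 * sqrt (Rf 0) / 2 ^+ j], and the geometric series sums to [8 * sqrt (Rf 0)]. *)
Lemma singular_integral (k : R) : 0 <= k <= b ->
  (\int[mu]_(x in `]0%R, b]) (level_sing k x * r x)%:E <= (8 * Num.sqrt (Rf 0))%:E)%E.
Proof.
move=> kb.
pose T j x := (c j * (r x * \1_(A k j) x))%:E.
have mA j : measurable (A k j) by exact: measurable_near_level H _ _.
have cge j : 0 <= c j by rewrite divr_ge0 ?sqrtr_ge0 ?exprn_ge0.
have T0 j x : (0 <= T j x)%E.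
  by rewrite lee_fin mulr_ge0// mulr_ge0 ?(profile_ge0 H).
have mr : measurable_fun `]0, b] r.
  exact: integrable_measurable (profile_integrableS H _).
have mrA j : measurable_fun `]0, b] (fun x => r x * \1_(A k j) x).
  by apply: measurable_funM => //; exact: measurable_indic.
have mT j : measurable_fun `]0, b] (T j).
  by apply/measurable_EFinP; apply: measurable_funM.
apply: (@le_trans _ _ (\int[mu]_(x in `]0%R, b]) \sum_(j <oo) T j x)%E).
  apply: ge0_le_integral => //.
  - by move=> x _; rewrite lee_fin mulr_ge0 ?level_sing_ge0 ?(profile_ge0 H).
  - apply/measurable_EFinP; apply: measurable_funM => //.
    exact: measurable_level_sing.
  - exact: (@ge0_emeasurable_sum _ _ _ _ T xpredT (fun j x _ _ => T0 j x) (fun j _ => mT j)).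
  move=> x; rewrite /= in_itv/= => xb; have [j jP] := layer kb xb.
  apply: (@le_trans _ _ (T j x)).
    rewrite lee_fin [r x * _]mulrC mulrA; apply: ler_wpM2r => //.
    exact: (profile_ge0 H).
  apply: le_trans (nneseries_lim_ge j.+1 _) => //.
  by rewrite big_nat_recr//= leeDr// sume_ge0.
rewrite integral_nneseries//.
have TE j : (\int[mu]_(x in `]0%R, b]) T j x <=
    (geometric (4 * Num.sqrt (Rf 0)) (2^-1) j)%:E)%E.
  rewrite /T; under eq_integral do rewrite EFinM.
  rewrite ge0_integralZl//; last 3 first.
  - by apply/measurable_EFinP; exact: mrA.
  - by move=> x _; rewrite lee_fin mulr_ge0 ?(profile_ge0 H).
  - by rewrite lee_fin.
  have AE : `]0, b] `&` A k j = A k j by rewrite /A /near_level setIA setIid.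
  have -> : (\int[mu]_(x in `]0%R, b]) (r x * \1_(A k j) x)%:E =
      \int[mu]_(x in A k j) (r x)%:E)%E.
    rewrite -[in RHS]AE integral_mkcondr; apply: eq_integral => x _.
    by rewrite patchE indicE; case: ifP => _; rewrite ?mulr1 ?mulr0.
  rewrite -Rintegral_fineK//; last exact: (profile_integrableS H (mA j)).
  rewrite -EFinM lee_fin.
  apply: (@le_trans _ _ (c j * (2 * (Rf 0 / 4 ^+ j)))).
    rewrite ler_wpM2l//; apply: mass_near_level H _ _ kb _.
    by rewrite divr_ge0 ?exprn_ge0// ltW.
  rewrite /geometric/= /c exprS -[in X in X / 4 ^+ j](sqr_sqrtr (ltW L0)).
  rewrite (_ : 4 ^+ j = 2 ^+ j * 2 ^+ j); last by rewrite -exprMn -natrM.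
  rewrite exprVn le_eqVlt; apply/orP; left; apply/eqP.
  by field; rewrite sqrtr_eq0 -ltNge L0 expf_neq0.
  exact: mA.
apply: (@le_trans _ _ (\sum_(j <oo) (geometric (4 * Num.sqrt (Rf 0)) (2^-1) j)%:E)%E).
  apply: lee_nneseries => // j _ _; apply: integral_ge0 => x _; exact: T0.
apply: lime_le.
  apply: is_cvg_nneseries => j _ _; rewrite lee_fin /geometric/=.
  by rewrite mulr_ge0 ?mulr_ge0 ?sqrtr_ge0 ?exprn_ge0 ?invr_ge0.
apply: nearW => n; rewrite sumEFin lee_fin.
apply: le_trans (geometric_le_lim n _ _ _) _ => //.
- by rewrite ger0_norm ?invr_ge0// invf_lt1// ltr1n.
by rewrite le_eqVlt; apply/orP; left; apply/eqP; field.
Qed.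

Lemma level_sing_integrable (k : R) : 0 <= k <= b ->
  mu.-integrable `]0, b] (EFin \o (fun x => level_sing k x * r x)).
Proof.
move=> kb; apply/integrableP; split.
  apply/measurable_EFinP/measurable_funM; first exact: measurable_level_sing.
  exact: integrable_measurable (profile_integrableS H _).
apply: le_lt_trans (ltry (8 * Num.sqrt (Rf 0))).
apply: le_trans (singular_integral kb).
rewrite le_eqVlt; apply/orP; left; apply/eqP; apply: eq_integral => x _ /=.
by rewrite ger0_norm// mulr_ge0 ?level_sing_ge0 ?(profile_ge0 H).
Qed.

Lemma level_sing_integral_le (k : R) : 0 <= k <= b ->
  \int[mu]_(x in `]0, b]) (level_sing k x * r x) <= 8 * Num.sqrt (Rf 0).
Proof.
move=> kb; rewrite -lee_fin Rintegral_fineK//; first exact: singular_integral.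
exact: level_sing_integrable.
Qed.

End Singular.

(** * The mollified logarithmic kernel *)

Section LogKernel.
Context {R : realType}.
Variables (b : R) (xi : R -> R).
Implicit Types (k e eta : R).

(** For a curve with real part [xi k] and imaginary part [k], this is the squared distance from the
    point at [k] to the conjugate of the point at [e]; [near_sqr] is the squared distance to that
    point itself. *)
Definition far_sqr k e : R := (xi k - xi e) ^+ 2 + (k + e) ^+ 2.
Definition near_sqr k e : R := (xi k - xi e) ^+ 2 + (k - e) ^+ 2.
(** At [eta = 0] this is the kernel [g] off the diagonal, and 0 on it by the conventions for
    division and [ln]. A positive [eta] removes the singularity on the diagonal and the one at the
    corner [k = e = 0], where the numerator vanishes too. *)
Definition log_kernel eta k e : R :=
  2^-1 * ln ((far_sqr k e + eta ^+ 2) / (near_sqr k e + eta ^+ 2)).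

Lemma near_sqr_ge0 k e : 0 <= near_sqr k e.
Proof. by rewrite addr_ge0// sqr_ge0. Qed.

Lemma near_le_far k e : 0 <= k -> 0 <= e -> near_sqr k e <= far_sqr k e.
Proof.
move=> k0 e0; rewrite lerD2l -subr_ge0.
rewrite (_ : _ - _ = 4 * (k * e)); last by ring.
by rewrite mulr_ge0// mulr_ge0.
Qed.

(** Since [near_sqr <= far_sqr], adding the same amount to both lowers the quotient, whence the
    sign. The change of the numerator only reduces the defect, which leaves the contribution of the
    denominator as upper bound. *)
Lemma log_kernel_gap eta k e : 0 <= k -> 0 <= e -> 0 < near_sqr k e ->
  0 <= log_kernel 0 k e - log_kernel eta k e <=
  2^-1 * ln (1 + eta ^+ 2 / near_sqr k e).
Proof.
move=> k0 e0; rewrite /log_kernel expr0n/= !addr0.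
have := near_le_far k0 e0.
move: (far_sqr k e) (near_sqr k e) => A B AB B0.
have A0 : 0 < A by exact: lt_le_trans AB.
have h0 : 0 <= eta ^+ 2 by exact: sqr_ge0.
move: (eta ^+ 2) h0 => h h0.
have Bh : 0 < B + h by rewrite ltr_pwDl.
have Ah : 0 < A + h by rewrite ltr_pwDl.
rewrite -mulrBr -ln_div ?posrE ?divr_gt0//.
apply/andP; split.
  rewrite mulr_ge0// ln_ge0// ler_pdivlMr ?divr_gt0// mul1r.
  rewrite ler_pdivrMr// mulrAC ler_pdivlMr// -subr_ge0.
  rewrite (_ : _ - _ = h * (A - B)); last by ring.
  by rewrite mulr_ge0// subr_ge0.
rewrite ler_pM2l ?invr_gt0// ler_ln ?posrE ?divr_gt0//; last first.
  by rewrite ltr_pwDl// divr_ge0// ltW.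
rewrite -subr_ge0.
have -> : 1 + h / B - A / B / ((A + h) / (B + h)) = (B + h) / B * (h / (A + h)).
  by field; rewrite !gt_eqF.
by rewrite !mulr_ge0// ?invr_ge0// ltW.
Qed.

(** From [1 + z ^+ 12 <= (1 + z) ^+ 12] and [1 + z <= (1 + sqrt z) ^+ 2]. The power 12 is twice the
    Hoelder exponent 6, because the kernel involves the squared distance. *)
Lemma ln1D_expn12 (z : R) : 0 <= z -> 2^-1 * ln (1 + z ^+ 12) <= 12 * Num.sqrt z.
Proof.
move=> z0.
have h1 : ln (1 + z ^+ 12) <= 12 * ln (1 + z).
  rewrite mulr_natl -lnXn; last by rewrite ltr_pwDl.
  rewrite ler_ln ?posrE ?exprn_gt0 ?ltr_pwDl ?exprn_ge0//.
  have := z0; move: (11%N) => n; elim: n => [|n IH] zz; first by rewrite !expr1.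
  rewrite [in leRHS]exprS (le_trans _ (ler_wpM2l _ (IH zz)))//; last first.
    by rewrite addr_ge0.
  rewrite [in leLHS]exprS; have := exprn_ge0 n.+1 zz.
  by move: (z ^+ n.+1) => y y0; rewrite mulrDl mul1r mulrDr mulr1; lra.
have h2 : ln (1 + z) <= 2 * Num.sqrt z.
  apply: (@le_trans _ _ (ln ((1 + Num.sqrt z) ^+ 2))).
    rewrite ler_ln ?posrE ?exprn_gt0 ?ltr_pwDl ?sqrtr_ge0//.
    by rewrite sqrrD expr1n sqr_sqrtr// mul1r; have := sqrtr_ge0 z; lra.
  rewrite lnXn ?ltr_pwDl ?sqrtr_ge0// mulr_natl ler_pMn2r//.
  by apply: le_ln1Dx; apply: (lt_le_trans _ (sqrtr_ge0 z)); rewrite ltrN10.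
by lra.
Qed.

(** Once shifted by [eta ^+ 2], the logarithm is Lipschitz with constant [eta ^- 2] on the
    nonnegative reals, and the two squared distances are bounded and uniformly continuous. *)
Lemma log_kernel_ucont eta : 0 <= b -> ucont b xi -> 0 < eta ->
  (exists2 M : R, 0 < M & forall k e, 0 <= k <= b -> 0 <= e <= b ->
     `|log_kernel eta k e| <= M) /\
  forall d : R, 0 < d -> exists2 s : R, 0 < s & forall k k' e e',
    0 <= k <= b -> 0 <= k' <= b -> 0 <= e <= b -> 0 <= e' <= b ->
    `|k - k'| <= s -> `|e - e'| <= s ->
    `|log_kernel eta k e - log_kernel eta k' e'| <= d.
Proof.
move=> b0 xiu eta0; have [X X0 XP] := ucont_bounded b0 xiu.
have h0 : 0 < eta ^+ 2 by rewrite exprn_gt0.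
pose Q : R := 4 * X ^+ 2 + 4 * b ^+ 2.
have Q0 : 0 <= Q by rewrite addr_ge0// mulr_ge0// sqr_ge0.
have farQ k e : 0 <= k <= b -> 0 <= e <= b -> 0 <= far_sqr k e <= Q.
  move=> kb eb; rewrite addr_ge0 ?sqr_ge0//=.
  have := XP _ kb; have := XP _ eb; rewrite !ler_norml => /andP[? ?] /andP[? ?].
  move/andP: kb => [? ?]; move/andP: eb => [? ?].
  by apply: lerD; nra.
have nearQ k e : 0 <= k <= b -> 0 <= e <= b -> 0 <= near_sqr k e <= Q.
  move=> kb eb; rewrite near_sqr_ge0/=.
  move: (farQ _ _ kb eb) => /andP[_]; apply: le_trans; apply: near_le_far.
    by case/andP: kb.
  by case/andP: eb.
have lip (u v : R) : 0 <= u -> 0 <= v ->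
    `|ln (u + eta ^+ 2) - ln (v + eta ^+ 2)| <= `|u - v| / eta ^+ 2.
  have one (p q : R) : 0 <= p -> 0 <= q -> ln (p + eta ^+ 2) - ln (q + eta ^+ 2) <=
      `|p - q| / eta ^+ 2.
    move=> p0 q0; have ph : 0 < p + eta ^+ 2 by rewrite ltr_wpDl.
    have qh : 0 < q + eta ^+ 2 by rewrite ltr_wpDl.
    rewrite -ln_div ?posrE//.
    rewrite (_ : _ / _ = 1 + (p - q) / (q + eta ^+ 2)); last by field; rewrite gt_eqF.
    apply: le_trans (le_ln1Dx _) _.
      rewrite -subr_gt0 (_ : _ - _ = (p + eta ^+ 2) / (q + eta ^+ 2)).
        by rewrite divr_gt0.
      by field; rewrite gt_eqF.
    apply: (@le_trans _ _ (`|p - q| / (q + eta ^+ 2))).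
      by rewrite ler_pM2r ?invr_gt0// ler_norm.
    by rewrite ler_wpM2l// lef_pV2 ?posrE// lerDr.
  move=> u0 v0; rewrite ler_norml one// andbT lerNl opprB distrC; exact: one.
have kE k e : 0 <= k <= b -> 0 <= e <= b -> log_kernel eta k e =
    2^-1 * (ln (far_sqr k e + eta ^+ 2) - ln (near_sqr k e + eta ^+ 2)).
  move=> kb eb; have /andP[? _] := farQ _ _ kb eb; have /andP[? _] := nearQ _ _ kb eb.
  by rewrite -ln_div// posrE ltr_wpDl.
split.
  exists (Q / eta ^+ 2 + 1); first by rewrite ltr_wpDl// divr_ge0// ltW.
  move=> k e kb eb; rewrite kE// normrM ger0_norm ?invr_ge0//.
  have /andP[f0 fQ] := farQ _ _ kb eb; have /andP[n0 nQ] := nearQ _ _ kb eb.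
  have := lip _ _ f0 n0.
  have : `|far_sqr k e - near_sqr k e| / eta ^+ 2 <= Q / eta ^+ 2.
    rewrite ler_pM2r ?invr_gt0// ler_norml; apply/andP; split; lra.
  by have : 0 <= Q / eta ^+ 2 by [rewrite divr_ge0// ltW]; lra.
move=> d d0.
(* A square of a difference whose entries are bounded by [B] moves by at most [8 * B * w] when the
   entries move by at most [w]. With [B = X] and [B = b] the sum stays below [d * eta ^+ 2]. *)
pose w := d * eta ^+ 2 / (8 * (X + b + 1)).
have Xb : 0 < X + b + 1 by rewrite ltr_wpDl// addr_ge0// ltW.
have w0 : 0 < w by rewrite divr_gt0// mulr_gt0.
have [s s0 sP] := xiu _ w0.
exists (Num.min s w); first by rewrite lt_min s0 w0.
move=> k k' e e' kb k'b eb e'b; rewrite !le_min => /andP[ks kw] /andP[es ew].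
have /andP[f0 _] := farQ _ _ kb eb; have /andP[n0 _] := nearQ _ _ kb eb.
have /andP[f0' _] := farQ _ _ k'b e'b; have /andP[n0' _] := nearQ _ _ k'b e'b.
have xk := sP _ _ kb k'b ks; have xe := sP _ _ eb e'b es.
have wE : w * (X + b + 1) * 8 = d * eta ^+ 2 by rewrite /w; field; rewrite gt_eqF.
have diff (p q p' q' B : R) : 0 <= B -> `|p| <= B -> `|q| <= B -> `|p'| <= B -> `|q'| <= B ->
    `|p - p'| <= w -> `|q - q'| <= w ->
    `|(p - q) ^+ 2 - (p' - q') ^+ 2| <= 8 * B * w.
  move=> B0 pB qB pB' qB' pw qw.
  rewrite subr_sqr normrM (_ : 8 * B * w = (2 * w) * (4 * B)); last by ring.
  apply: ler_pM => //.
    rewrite (_ : p - q - (p' - q') = (p - p') - (q - q')); last by ring.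
    by rewrite (le_trans (ler_normB _ _))//; lra.
  have := ler_normD (p - q) (p' - q'); have := ler_normB p q; have := ler_normB p' q'.
  lra.
have ab (z : R) : 0 <= z <= b -> `|z| <= b by move=> /andP[? ?]; rewrite ger0_norm.
have dx := diff _ _ _ _ X (ltW X0) (XP _ kb) (XP _ eb) (XP _ k'b) (XP _ e'b) xk xe.
have dn := diff _ _ _ _ b b0 (ab _ kb) (ab _ eb) (ab _ k'b) (ab _ e'b) kw ew.
have df : `|(k + e) ^+ 2 - (k' + e') ^+ 2| <= 8 * b * w.
  have := diff k (- e) k' (- e') b b0; rewrite !opprK !normrN; apply; rewrite ?ab//.
  by rewrite addrC distrC.
have dF : `|far_sqr k e - far_sqr k' e'| <= d * eta ^+ 2.
  rewrite /far_sqr (_ : _ - _ = ((xi k - xi e) ^+ 2 - (xi k' - xi e') ^+ 2) +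
    ((k + e) ^+ 2 - (k' + e') ^+ 2)); last by ring.
  by rewrite (le_trans (ler_normD _ _))//; nra.
have dN : `|near_sqr k e - near_sqr k' e'| <= d * eta ^+ 2.
  rewrite /near_sqr (_ : _ - _ = ((xi k - xi e) ^+ 2 - (xi k' - xi e') ^+ 2) +
    ((k - e) ^+ 2 - (k' - e') ^+ 2)); last by ring.
  by rewrite (le_trans (ler_normD _ _))//; nra.
rewrite !kE// -mulrBr normrM ger0_norm ?invr_ge0//.
have lF := lip _ _ f0 f0'; have lN := lip _ _ n0 n0'.
have dF' : `|far_sqr k e - far_sqr k' e'| / eta ^+ 2 <= d by rewrite ler_pdivrMr.
have dN' : `|near_sqr k e - near_sqr k' e'| / eta ^+ 2 <= d by rewrite ler_pdivrMr.
set a := ln _ in lF *; set a' := ln _ in lF *.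
set n := ln _ in lN *; set n' := ln _ in lN *.
have := ler_normB (a - a') (n - n').
rewrite (_ : a - n - (a' - n') = a - a' - (n - n')); last by ring.
by lra.
Qed.

End LogKernel.

(** * Weak continuity of the mollified energies *)

Section Functional.
Context {R : realType}.
Variables (b L : R).
Hypotheses (b0 : 0 <= b) (L0 : 0 < L).
Implicit Types (phi psi : R -> R) (J : (R -> R) -> R).

(** The common features of integration against a density and of summation over nodes. A single
    estimate on such functionals then compares two densities, or a density with a set of nodes. *)
Definition mass_functional J :=
  (forall phi psi, ucont b phi -> ucont b psi ->
     J (fun k => phi k - psi k) = J phi - J psi) /\
  (forall phi (a : R), ucont b phi -> (forall k, 0 <= k <= b -> `|phi k| <= a) ->
     `|J phi| <= a * L).

(** Closeness is uniform over test functions with a common bound and a common oscillation at one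
    scale. This is needed because the test functions include fields that themselves depend on
    [J]. *)
Definition close_functionals J J' (e1 s M e : R) := forall phi, ucont b phi ->
  (forall k, 0 <= k <= b -> `|phi k| <= M) -> osc b phi e1 s -> `|J phi - J' phi| <= e.

Lemma ucont_sub phi psi : ucont b phi -> ucont b psi -> ucont b (fun k => phi k - psi k).
Proof.
move=> u v e e0; have e2 : 0 < e / 2 by rewrite divr_gt0.
have [d d0 dP] := u _ e2; have [d' d'0 d'P] := v _ e2.
exists (Num.min d d'); first by rewrite lt_min d0.
move=> x y xb yb; rewrite le_min => /andP[h h'].
rewrite (_ : _ - _ = (phi x - phi y) - (psi x - psi y)); last by ring.
have := dP _ _ xb yb h; have := d'P _ _ xb yb h'.
by have := ler_normB (phi x - phi y) (psi x - psi y); lra.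
Qed.

Variables (xi q th : R -> R).
Hypotheses (uxi : ucont b xi) (uq : ucont b q) (uth : ucont b th).

Definition potential (x t k : R) : R := x * k + t * q k - th k.

Definition reg_field eta J (k : R) : R := J (log_kernel xi eta k).

(** The factor [(2 * pi)^-1] joins the [2^-1] of the energy with the [pi^-1] of the logarithmic
    operator. *)
Definition reg_energy eta x t J : R :=
  J (potential x t) + (2 * pi)^-1 * J (reg_field eta J).

Lemma potential_modulus (B e1 : R) : 0 < B -> 0 < e1 ->
  exists2 s : R, 0 < s & exists2 M : R, 0 < M & forall x t : R, `|x| <= B -> `|t| <= B ->
    osc b (potential x t) e1 s /\ forall k, 0 <= k <= b -> `|potential x t k| <= M.
Proof.
move=> B0 e10.
have [Mq Mq0 MqP] := ucont_bounded b0 uq; have [Mt Mt0 MtP] := ucont_bounded b0 uth.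
pose e := e1 / (2 * B + 1).
have B1 : 0 < 2 * B + 1 by lra.
have e0 : 0 < e by rewrite divr_gt0.
have eE : e * (2 * B + 1) = e1 by rewrite /e; field; rewrite gt_eqF.
have [d d0 dP] := uq e0; have [d' d'0 d'P] := uth e0.
exists (Num.min e (Num.min d d')); first by rewrite !lt_min e0 d0.
exists (B * b + B * Mq + Mt).
  by rewrite ltr_wpDl// addr_ge0 ?mulr_ge0// ltW.
move=> x t xB tB; split.
  move=> k k' kb k'b; rewrite !le_min => /andP[h1 /andP[h2 h3]].
  have := dP _ _ kb k'b h2; have := d'P _ _ kb k'b h3 => h3' h2'.
  rewrite /potential (_ : _ - _ = x * (k - k') + t * (q k - q k') - (th k - th k')); last by ring.
  have m1 : `|x * (k - k')| <= B * e by rewrite normrM ler_pM.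
  have m2 : `|t * (q k - q k')| <= B * e by rewrite normrM ler_pM.
  have := ler_normB (x * (k - k') + t * (q k - q k')) (th k - th k').
  have := ler_normD (x * (k - k')) (t * (q k - q k')).
  by lra.
move=> k kb; rewrite /potential.
have kb' : `|k| <= b by move/andP: kb => [? ?]; rewrite ger0_norm.
have m1 : `|x * k| <= B * b by rewrite normrM ler_pM.
have m2 : `|t * q k| <= B * Mq by rewrite normrM ler_pM// MqP.
have := ler_normB (x * k + t * q k) (th k).
have := ler_normD (x * k) (t * q k); have := MtP _ kb.
by lra.
Qed.

Lemma potential_ucont x t : ucont b (potential x t).
Proof.
move=> e e0; have B0 : 0 < `|x| + `|t| + 1 by rewrite ltr_wpDl// addr_ge0.
have [s s0 [M M0 /(_ x t)[|| h _]]] := potential_modulus B0 e0.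
- by have := normr_ge0 t; lra.
- by have := normr_ge0 x; lra.
by exists s.
Qed.

Lemma log_kernel_ucont1 eta k : 0 < eta -> 0 <= k <= b -> ucont b (log_kernel xi eta k).
Proof.
move=> eta0 kb; have [_ kc] := log_kernel_ucont b0 uxi eta0.
move=> e e0; have [s s0 sP] := kc _ e0; exists s => // x y xb yb xy.
by apply: sP => //; rewrite subrr normr0 ltW.
Qed.

Lemma reg_field_osc eta J d s : 0 < eta -> mass_functional J ->
  (forall k k' e e', 0 <= k <= b -> 0 <= k' <= b -> 0 <= e <= b -> 0 <= e' <= b ->
    `|k - k'| <= s -> `|e - e'| <= s ->
    `|log_kernel xi eta k e - log_kernel xi eta k' e'| <= d) ->
  0 <= s -> osc b (reg_field eta J) (d * L) s.
Proof.
move=> eta0 [J1 J2] h s0 x y xb yb xy; rewrite /reg_field.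
have ux := log_kernel_ucont1 eta0 xb; have uy := log_kernel_ucont1 eta0 yb.
rewrite -J1//; apply: J2; first exact: ucont_sub.
by move=> k kb; apply: h => //; rewrite subrr normr0.
Qed.

Lemma reg_field_ucont eta J : 0 < eta -> mass_functional J -> ucont b (reg_field eta J).
Proof.
move=> eta0 mJ e e0; have [_ kc] := log_kernel_ucont b0 uxi eta0.
have eL : 0 < e / L by rewrite divr_gt0.
have [s s0 sP] := kc _ eL; exists s => //.
by rewrite -[e](divfK (lt0r_neq0 L0)); apply: reg_field_osc => //; exact: ltW.
Qed.

(** With [F] and [F'] the fields of [J] and [J'], the quadratic part changes by
    [(J - J') F + J' (F - F')]. The fields of all mass functionals share one bound and one modulus,
    so [F] is a legitimate test function; and [F - F'] is small pointwise because the slices of the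
    kernel are test functions as well. The denominator [2 + L] counts the potential, the first term
    and the second. *)
Lemma reg_energy_close (eta B ep : R) : 0 < eta -> 0 < B -> 0 < ep ->
  exists2 e : R, 0 < e & forall e1 : R, 0 < e1 ->
  exists2 s : R, 0 < s & exists2 M : R, 0 < M &
    forall J J', mass_functional J -> mass_functional J' ->
    close_functionals J J' e1 s M e ->
    forall x t, `|x| <= B -> `|t| <= B ->
    `|reg_energy eta x t J - reg_energy eta x t J'| <= ep.
Proof.
move=> eta0 B0 ep0; exists (ep / (2 + L)); first by rewrite divr_gt0// addr_gt0.
set e := ep / (2 + L).
have e0 : 0 < e by rewrite divr_gt0// addr_gt0.
have eE : e * (2 + L) = ep by rewrite /e; field; rewrite gt_eqF// addr_gt0.
move=> e1 e10.
have [sV sV0 [MV MV0 VP]] := potential_modulus B0 e10.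
have [[MK MK0 KM] kc] := log_kernel_ucont b0 uxi eta0.
pose d := e1 / (1 + L).
have L1 : 0 < 1 + L by rewrite addr_gt0.
have d0 : 0 < d by rewrite divr_gt0.
have dE : d * (1 + L) = e1 by rewrite /d; field; rewrite gt_eqF.
have dL0 : 0 < d * L by rewrite mulr_gt0.
have [sK sK0 KP] := kc _ d0.
pose s := Num.min sV sK.
have s0 : 0 < s by rewrite lt_min sV0.
have sle : s <= sV /\ s <= sK by rewrite /s !ge_min !lexx orbT.
exists s => //; exists (MV + MK * (1 + L)).
  by rewrite addr_gt0// mulr_gt0.
have MKL : 0 < MK * L by rewrite mulr_gt0.
move=> J J' mJ mJ' cJ x t xB tB.
have [oV bV] := VP _ _ xB tB.
have hV : `|J (potential x t) - J' (potential x t)| <= e.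
  apply: cJ; first exact: potential_ucont.
  - by move=> k kb; have := bV _ kb; lra.
  - by apply: osc_le oV => //; case: sle.
have uF := reg_field_ucont eta0 mJ; have uF' := reg_field_ucont eta0 mJ'.
have hF : `|J (reg_field eta J) - J' (reg_field eta J)| <= e.
  apply: cJ => //.
  - move=> k kb; have : `|reg_field eta J k| <= MK * L.
      by apply: mJ.2; [exact: log_kernel_ucont1|move=> ? ?; exact: KM].
    by lra.
  - apply: osc_le (reg_field_osc eta0 mJ KP (ltW sK0)); first by lra.
    by case: sle.
have hK k : 0 <= k <= b -> `|reg_field eta J k - reg_field eta J' k| <= e.
  move=> kb; apply: cJ; first exact: log_kernel_ucont1.
  - by move=> k' k'b; have := KM _ _ kb k'b; lra.
  - move=> y z yb zb yz; have : `|log_kernel xi eta k y - log_kernel xi eta k z| <= d.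
      apply: KP => //; first by rewrite subrr normr0 ltW.
      by apply: (le_trans yz); case: sle.
    by lra.
have hF' : `|J' (reg_field eta J) - J' (reg_field eta J')| <= e * L.
  by rewrite -mJ'.1//; apply: mJ'.2 => //; exact: ucont_sub.
have pi0 : 0 <= (2 * pi : R)^-1 <= 1.
  rewrite invr_ge0 mulr_ge0 ?pi_ge0//= invf_le1 ?mulr_gt0 ?pi_gt0//.
  by have := pi_ge2 R; lra.
rewrite /reg_energy.
set p := (2 * pi)^-1 in pi0 *.
set a := J _ in hV *; set a' := J' _ in hV *.
set f := J _ in hF *; set f' := J' _ in hF hF' *; set f'' := J' _ in hF' *.
have : `|p * f - p * f''| <= e * (1 + L).
  rewrite -mulrBr normrM ger0_norm; last by case/andP: pi0.
  have : `|f - f''| <= e * (1 + L).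
    rewrite (_ : f - f'' = (f - f') + (f' - f'')); last by ring.
    by rewrite (le_trans (ler_normD _ _))//; lra.
  move: pi0 => /andP[p0 p1]; have := normr_ge0 (f - f''); nra.
rewrite (_ : a + p * f - (a' + p * f'') = (a - a') + (p * f - p * f'')); last by ring.
move=> ?.
by have := ler_normD (a - a') (p * f - p * f''); lra.
Qed.

End Functional.

(** * Densities as functionals *)

Section Densities.
Context {R : realType}.
Variables (b : R) (r Rf : R -> R) (c0 : R).
Hypothesis H : density_profile b r Rf c0.
Local Notation mu := (@lebesgue_measure R).
Implicit Types (rho phi : R -> R).

Let b0 : 0 <= b. Proof. exact: ltW (profile_gt0 H). Qed.
Let L0 : 0 < Rf 0. Proof. exact: profile0_gt0 H. Qed.

(** The bounds hold everywhere on the line, in contrast to [admissible], where they hold almost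
    everywhere on an interval; clipping mediates between the two. *)
Definition subdensity rho := measurable_fun setT rho /\ forall x, 0 <= rho x <= r x.

Definition density_functional rho phi : R := \int[mu]_(x in `]0, b]) (phi x * rho x).

Definition cumulative rho (k : R) : R := \int[mu]_(x in `]k, b]) rho x.

Lemma subdensity_integrable rho (A : set R) : measurable A -> subdensity rho ->
  mu.-integrable A (EFin \o rho).
Proof.
move=> mA [mr rr]; apply: (integrableS measurableT) => //.
apply: integrable_dominated (profile_integrable H) => // x _.
by have /andP[? ?] := rr x; rewrite ger0_norm.
Qed.

Lemma subset_oc_cc : `]0, b] `<=` `[0, b].
Proof. by apply: subset_itvr; rewrite bnd_simp. Qed.

Lemma ucont_measurable_oc phi : ucont b phi -> measurable_fun `]0, b] phi.
Proof. by move=> u; apply: measurable_funS subset_oc_cc (ucont_measurable b0 u). Qed.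

Lemma subdensity_mul_integrable rho phi : subdensity rho -> ucont b phi ->
  mu.-integrable `]0, b] (EFin \o (fun x => phi x * rho x)).
Proof.
move=> ar u; have [M M0 MP] := ucont_bounded b0 u.
apply: (integrable_bounded_mul _ (a := M)) => //.
- exact: ucont_measurable_oc.
- by move=> x /subset_oc_cc; rewrite /= in_itv/=; exact: MP.
- exact: subdensity_integrable.
Qed.

Lemma cumulative_le rho : subdensity rho -> cumulative rho 0 <= Rf 0.
Proof.
move=> ar; rewrite (profileE H) ?lexx//; apply: le_Rintegral => //.
- exact: subdensity_integrable.
- exact: (profile_integrableS H).
- by move=> x _; case/andP: (ar.2 x).
Qed.

Lemma density_mass_functional rho : subdensity rho ->
  mass_functional b (Rf 0) (density_functional rho).
Proof.
move=> ar; split.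
  move=> phi psi u v; rewrite /density_functional -RintegralB//; last 2 first.
  - exact: subdensity_mul_integrable.
  - exact: subdensity_mul_integrable.
  by apply: eq_Rintegral => x _; rewrite mulrBl.
move=> phi a u ha.
have [a0|a0] := leP 0 a; last first.
  have : `|phi 0| <= a by apply: ha; rewrite lexx.
  by have := normr_ge0 (phi 0); lra.
apply: le_trans (le_normr_Rintegral _ _) _ => //.
  exact: subdensity_mul_integrable.
apply: (@le_trans _ _ (\int[mu]_(x in `]0, b]) (a * rho x))).
  apply: le_Rintegral => //.
  - exact/integrable_absr/subdensity_mul_integrable.
  - exact/integrable_scale/subdensity_integrable.
  move=> x /subset_oc_cc; rewrite /= in_itv/= => xb; have /andP[r0 _] := ar.2 x.
  by rewrite normrM (ger0_norm r0) ler_wpM2r// ha.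
rewrite RintegralZl//; last exact: subdensity_integrable.
by rewrite ler_wpM2l//; exact: cumulative_le.
Qed.

Definition grid (n i : nat) : R := b - b * (i%:R / n%:R).

(** On a grid of step at most [s] a test function oscillates by at most [e1] per cell, which costs
    [e1 * Rf 0 = e / 2]. The mass of [rho - rho'] in a cell is a difference of two cumulative
    discrepancies, hence at most [2 * d], and [n] cells weighted by [M] cost the other half. *)
Lemma density_close (e : R) : 0 < e -> exists2 e1 : R, 0 < e1 & forall s M : R,
  0 < s -> 0 < M -> exists n, exists2 d : R, 0 < d &
  forall rho rho', subdensity rho -> subdensity rho' ->
  (forall i, (i < n.+1)%N ->
    `|cumulative rho (grid n i) - cumulative rho' (grid n i)| <= d) ->
  close_functionals b (density_functional rho) (density_functional rho') e1 s M e.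
Proof.
move=> e0; exists (e / (2 * Rf 0)); first by rewrite divr_gt0// mulr_gt0.
set e1 := e / _; have e1E : e1 * Rf 0 = e / 2 by rewrite /e1; field; rewrite gt_eqF.
move=> s M s0 M0; pose n := (Num.truncn (b / s)).+1; exists n.
have bn : b / n%:R <= s.
  by rewrite ler_pdivrMr// mulrC -ler_pdivrMr// ltW// truncnS_gt.
have nM : 0 < 4 * (n%:R * M) by rewrite mulr_gt0// mulr_gt0.
exists (e / (4 * (n%:R * M))); first by rewrite divr_gt0.
set d := e / _; have dE : d * (n%:R * M) = e / 4.
  by rewrite /d; field; rewrite gt_eqF//= gt_eqF.
move=> rho rho' ar ar' gd phi u phiM phio.
have sr : mu.-integrable setT (EFin \o (fun x => rho x - rho' x)).
  by apply: integrable_sub => //; exact: subdensity_integrable.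
have srS (A : set R) : measurable A -> mu.-integrable A (EFin \o (fun x => rho x - rho' x)).
  by move=> mA; apply: integrableS sr.
have g0 : grid n 0 = b by rewrite /grid mul0r mulr0 subr0.
have gn : grid n n = 0 by rewrite /grid divff ?pnatr_eq0// mulr1 subrr.
have dg : {homo grid n : i j / (i <= j)%N >-> j <= i}.
  move=> i j ij; rewrite lerD2l lerN2 ler_wpM2l// ler_wpM2r// ler_nat.
  exact: ij.
have step i : grid n i - grid n i.+1 = b / n%:R.
  by rewrite /grid -natr1; field; rewrite pnatr_eq0.
have pi' : mu.-integrable `]0, b] (EFin \o (fun x => phi x * (rho x - rho' x))).
  rewrite (_ : (fun x => _) = fun x => phi x * rho x - phi x * rho' x); last first.
    by apply/funext => x; rewrite mulrBr.
  by apply: integrable_sub => //; exact: subdensity_mul_integrable.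
have E : density_functional rho phi - density_functional rho' phi =
    \int[mu]_(x in `]0, b]) (phi x * (rho x - rho' x)).
  rewrite /density_functional -RintegralB//; [|exact: subdensity_mul_integrable..].
  by apply: eq_Rintegral => x _; rewrite mulrBr.
have samp := @Rintegral_sampling R (fun x => rho x - rho' x) phi (grid n) (grid n) n e1 dg.
rewrite g0 gn in samp.
have s1 : mu.-integrable `]0, b] (EFin \o (fun x => rho x - rho' x)) by exact: srS.
have {}samp := samp s1 pi'.
have gb i : (i <= n)%N -> 0 <= grid n i <= b.
  by move=> iln; have := dg _ _ iln; have := dg _ _ (leq0n i); rewrite g0 gn => -> ->.
have {}samp : `|\int[mu]_(x in `]0, b]) (phi x * (rho x - rho' x)) -
   \sum_(i < n) phi (grid n i) * \int[mu]_(x in `]grid n i.+1, grid n i]) (rho x - rho' x)|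
   <= e1 * \int[mu]_(x in `]0, b]) `|rho x - rho' x|.
  apply: samp => i x ilt /andP[x1 x2].
  have /andP[? _] := gb i.+1 ilt; have /andP[_ ?] := gb i (ltnW ilt).
  have st := step i.
  apply: phio; rewrite ?(gb _ (ltnW ilt))//; first by apply/andP; split; lra.
  by rewrite ler_norml; apply/andP; split; lra.
have absL : \int[mu]_(x in `]0, b]) `|rho x - rho' x| <= Rf 0.
  rewrite (profileE H) ?lexx//; apply: le_Rintegral => //.
  - exact/integrable_absr/srS.
  - exact: (profile_integrableS H).
  move=> x _; have /andP[? ?] := ar.2 x; have /andP[? ?] := ar'.2 x.
  by rewrite ler_norml; apply/andP; split; lra.
have cell i : (i < n)%N ->
   `|\int[mu]_(x in `]grid n i.+1, grid n i]) (rho x - rho' x)| <= 2 * d.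
  move=> ilt.
  have st := step i; have bn0 : 0 <= b / n%:R by rewrite divr_ge0.
  have /andP[? ?] := gb i (ltnW ilt).
  have cumE : \int[mu]_(x in `]grid n i.+1, grid n i]) (rho x - rho' x) =
     (cumulative rho (grid n i.+1) - cumulative rho' (grid n i.+1)) -
     (cumulative rho (grid n i) - cumulative rho' (grid n i)).
    rewrite /cumulative -!RintegralB//; [|exact: subdensity_integrable..].
    rewrite -(@Rintegral_itvB _ _ (BRight (grid n i.+1)) (BRight b) (grid n i)) ?bnd_simp//.
    - by ring.
    - exact: srS.
    - by lra.
  rewrite cumE (le_trans (ler_normB _ _))//.
  have := gd i (ltnW ilt); have := gd i.+1 ilt; lra.
have sumb : `|\sum_(i < n) phi (grid n i) *
    \int[mu]_(x in `]grid n i.+1, grid n i]) (rho x - rho' x)| <= e / 2.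
  apply: le_trans (ler_norm_sum _ _ _) _.
  apply: (@le_trans _ _ (\sum_(i < n) M * (2 * d))).
    apply: ler_sum => i _; rewrite normrM ler_pM//; last exact: cell.
    by apply: phiM; apply: gb; exact: ltnW.
  rewrite sumr_const card_ord -[X in X <= _]mulr_natl.
  have -> : n%:R * (M * (2 * d)) = 2 * (d * (n%:R * M)) by ring.
  by rewrite dE; lra.
have e10 : 0 < e1 by rewrite divr_gt0// mulr_gt0.
rewrite E; set X := \int[mu]_(x in _) _ in samp *; set Y := \sum_(i < n) _ in samp sumb.
have := ler_normD (X - Y) Y; rewrite subrK.
have : e1 * \int[mu]_(x in `]0, b]) `|rho x - rho' x| <= e / 2.
  by rewrite -e1E ler_wpM2l// ltW.
by lra.
Qed.

End Densities.

(** * Cells of equal mass, nodes and rounding *)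

Section Cells.
Context {R : realType}.
Variables (b : R) (r Rf : R -> R) (c0 : R).
Hypothesis H : density_profile b r Rf c0.
Local Notation mu := (@lebesgue_measure R).
Implicit Types (rho phi : R -> R) (c kn : nat -> R).

Let b0 : 0 <= b. Proof. exact: ltW (profile_gt0 H). Qed.
Let L0 : 0 < Rf 0. Proof. exact: profile0_gt0 H. Qed.

Lemma cumulative_diff rho (k e : R) : subdensity r rho -> 0 <= k <= b -> 0 <= e <= b -> k <= e ->
  \int[mu]_(x in `]k, e]) rho x = cumulative b rho k - cumulative b rho e.
Proof.
move=> ar kb /andP[_ eb] ke; rewrite /cumulative.
rewrite -(@Rintegral_itvB _ rho (BRight k) (BRight b) e) ?bnd_simp//.
- by ring.
- exact: (subdensity_integrable H).
Qed.

Lemma cumulative_diff_le rho (k e : R) : subdensity r rho -> 0 <= k <= b -> 0 <= e <= b -> k <= e ->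
  0 <= cumulative b rho k - cumulative b rho e <= Rf k - Rf e.
Proof.
move=> ar kb eb ke; rewrite -cumulative_diff// -(profile_diff H)//; apply/andP; split.
  by apply: Rintegral_ge0 => x _; case/andP: (ar.2 x).
apply: le_Rintegral => //.
- exact: (subdensity_integrable H).
- exact: (profile_integrableS H).
- by move=> x _; case/andP: (ar.2 x).
Qed.

(** The cell []c i.+1, c i]] carries the mass [Rf 0 / N], from [c 0 = b] down to [c N = 0]. The
    nodes below sit at the middle levels, [i + 1/2] being [n - 1/2] for [n = i.+1]. *)
Definition cell_ends N c := {homo c : i j / (i <= j)%N >-> j <= i} /\
  forall i, (i <= N)%N -> 0 <= c i <= b /\ Rf (c i) = Rf 0 * (i%:R / N%:R).

Definition cell_nodes N kn := forall i, (i < N)%N ->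
  0 <= kn i <= b /\ Rf (kn i) = Rf 0 * ((i%:R + 2^-1) / N%:R).

Lemma cell_ends_exist N : (0 < N)%N -> exists c, cell_ends N c.
Proof.
move=> N0; have N0' : 0 < N%:R :> R by rewrite ltr0n.
(* Cutting the index at [N] keeps the sequence monotone for all indices, as [cell_ends] demands. *)
have /choice[c cP] : forall i : nat, exists k : R,
    0 <= k <= b /\ Rf k = Rf 0 * ((minn i N)%:R / N%:R).
  move=> i; have [|k kb kE] := @profile_surj _ _ _ _ _ H (Rf 0 * ((minn i N)%:R / N%:R)).
    rewrite mulr_ge0 ?divr_ge0 ?(ltW L0)//= ger_pMr// ler_pdivrMr// mul1r.
    by rewrite ler_nat geq_minr.
  by exists k.
exists c; split => [i j ij|i iN]; last by have := cP i; rewrite (minn_idPl iN).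
have [ib iE] := cP i; have [jb jE] := cP j.
apply: (profile_le_inv H) => //; rewrite iE jE ler_pM2l// ler_pM2r ?invr_gt0//.
by rewrite ler_nat leq_min geq_minr andbT; apply: leq_trans ij; exact: geq_minl.
Qed.

Definition cell_density N c (S : {set 'I_N}) (x : R) : R :=
  r x * \1_(\big[setU/set0]_(i in S) `]c i.+1, c i]) x.

(** The weight is the mass of one cell, that is [pi * epsN N] in the soliton problem. *)
Definition node_functional N kn (S : {set 'I_N}) phi : R :=
  Rf 0 / N%:R * \sum_(i in S) phi (kn i).

Lemma subdensity_cell N c (S : {set 'I_N}) : measurable_fun setT r ->
  subdensity r (cell_density c S).
Proof.
move=> mr; split.
  apply: measurable_funM => //; apply: measurable_indic.
  by apply: bigsetU_measurable => i _; exact: measurable_itv.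
move=> x; rewrite /cell_density indicE; have r0 := profile_ge0 H x.
by case: (_ \in _); rewrite ?mulr1 ?mulr0 ?lexx r0.
Qed.

Lemma cell_densityE N c (S : {set 'I_N}) (j : 'I_N) (x : R) :
  {homo c : i j / (i <= j)%N >-> j <= i} -> c j.+1 < x <= c j ->
  cell_density c S x = if j \in S then r x else 0.
Proof.
move=> hc /andP[x1 x2]; rewrite /cell_density indicE.
have -> : (x \in \big[setU/set0]_(i in S) `]c i.+1, c i]) = (j \in S).
  apply/idP/idP.
    move=> /set_mem; rewrite -bigcup_seq_cond => -[i /= /andP[_ iS]].
    rewrite in_itv/= => /andP[y1 y2].
    suff -> : j = i by [].
    apply/val_inj/eqP; rewrite /= eqn_leq; apply/andP; split; rewrite leqNgt; apply/negP.
      by move=> /hc h; move: (le_lt_trans x2 (le_lt_trans h y1)); rewrite ltxx.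
    by move=> /hc h; move: (le_lt_trans y2 (le_lt_trans h x1)); rewrite ltxx.
  move=> jS; apply/mem_set; rewrite -bigcup_seq_cond; exists j => /=.
    by rewrite mem_index_enum.
  by rewrite in_itv/= x1.
by case: ifP; rewrite ?mulr1 ?mulr0.
Qed.

Lemma cell_mass N c (S : {set 'I_N}) (j : 'I_N) : cell_ends N c ->
  \int[mu]_(x in `]c j.+1, c j]) cell_density c S x =
  if j \in S then Rf 0 / N%:R else 0.
Proof.
move=> [hc cP]; have N0 : (0 < N)%N by case: N j {S cP} => [[]|].
have N0' : N%:R != 0 :> R by rewrite pnatr_eq0 -lt0n.
transitivity (\int[mu]_(x in `]c j.+1, c j]) (if j \in S then r x else 0)).
  by apply: eq_Rintegral => x /set_mem; rewrite /= in_itv/=; exact: cell_densityE.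
case: ifP => _; last by rewrite /Rintegral/= integral0.
have [jb jE] := cP j (ltnW (ltn_ord j)); have [j1b j1E] := cP j.+1 (ltn_ord j).
rewrite (profile_diff H)//; last exact: hc.
by rewrite jE j1E -natr1; field.
Qed.

Lemma cell_ends0 N c : cell_ends N c -> c 0%N = b.
Proof.
move=> [_ cP]; have [cb cE] := cP 0%N (leq0n _).
apply/eqP; rewrite eq_le; case/andP: (cb) => _ -> /=.
apply: (profile_le_inv H) => //; first by rewrite b0 lexx.
by rewrite cE mul0r mulr0 (profile_end H).
Qed.

Lemma cell_endsN N c : (0 < N)%N -> cell_ends N c -> c N = 0.
Proof.
move=> N0 [_ cP]; have [cb cE] := cP N (leqnn _).
apply/eqP; rewrite eq_le; case/andP: (cb) => -> _; rewrite andbT.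
apply: (profile_le_inv H) => //; first by rewrite b0 lexx.
by rewrite cE divff ?mulr1// pnatr_eq0 -lt0n.
Qed.

Lemma node_mass_functional N kn (S : {set 'I_N}) : (0 < N)%N -> cell_nodes N kn ->
  mass_functional b (Rf 0) (node_functional kn S).
Proof.
move=> N0 knP; split.
  by move=> phi psi _ _; rewrite /node_functional sumrB mulrBr.
move=> phi a _ ha.
have a0 : 0 <= a by apply: le_trans (ha 0 _); rewrite ?lexx.
have N0' : 0 < N%:R :> R by rewrite ltr0n.
rewrite /node_functional normrM ger0_norm; last by rewrite divr_ge0 ?ltW.
apply: (@le_trans _ _ (Rf 0 / N%:R * (N%:R * a))); last first.
  by rewrite mulrA divfK ?gt_eqF// mulrC.
rewrite ler_wpM2l//; first by rewrite divr_ge0 ?ltW.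
apply: le_trans (ler_norm_sum _ _ _) _.
apply: (@le_trans _ _ (\sum_(i in S) a)).
  by apply: ler_sum => i _; apply: ha; have [] := knP i (ltn_ord i).
rewrite sumr_const -[leLHS]mulr_natl ler_wpM2r// ler_nat.
by apply: leq_trans (max_card _) _; rewrite card_ord.
Qed.

(** A selected cell and its node carry the same mass. Each point of the cell is within [Rf 0 / N] of
    the node in level, hence within [s] of it in position for large [N] by [profile_inv_modulus],
    whatever the set [S]. *)
Lemma node_close (e : R) : 0 < e -> exists2 e1 : R, 0 < e1 & forall s M : R, 0 < s ->
  exists N0 : nat, forall N c kn (S : {set 'I_N}), (N0 < N)%N ->
  cell_ends N c -> cell_nodes N kn ->
  close_functionals b (density_functional b (cell_density c S)) (node_functional kn S) e1 s M e.
Proof.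
move=> e0; exists (e / Rf 0); first by rewrite divr_gt0.
set e1 := e / Rf 0; have e1E : e1 * Rf 0 = e by rewrite /e1 divfK// gt_eqF.
have e10 : 0 < e1 by rewrite divr_gt0.
move=> s M s0; have [w w0 wP] := profile_inv_modulus H s0.
exists (Num.truncn (Rf 0 / w)).+1 => N c kn S NN cc knP phi u _ phio.
have N0 : (0 < N)%N by apply: leq_trans NN.
have N0' : 0 < N%:R :> R by rewrite ltr0n.
have LN : Rf 0 / N%:R <= w.
  rewrite ler_pdivrMr// mulrC -ler_pdivrMr//; apply: ltW.
  by apply: (lt_trans (truncnS_gt _)); rewrite ltr_nat.
have mr : measurable_fun setT r by exact: integrable_measurable (profile_integrable H).
have ad := @subdensity_cell N c S mr.
have [hc cP] := cc.
have samp := @Rintegral_sampling R (cell_density c S) phi c kn N e1 hc.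
rewrite (cell_ends0 cc) (cell_endsN N0 cc) in samp.
have {}samp := samp (subdensity_integrable H _ ad) (subdensity_mul_integrable H ad u).
have {}samp : `|density_functional b (cell_density c S) phi - node_functional kn S phi| <=
    e1 * \int[mu]_(x in `]0, b]) `|cell_density c S x|.
  have E : node_functional kn S phi = \sum_(i < N) phi (kn i) *
      \int[mu]_(x in `]c i.+1, c i]) cell_density c S x.
    rewrite /node_functional big_mkcond/= mulr_sumr; apply: eq_bigr => i _.
    by rewrite cell_mass//; case: ifP => _; rewrite ?mulr0// mulrC.
  rewrite E; apply: samp => // i x iN /andP[x1 x2].
  have [ib iE] := cP i (ltnW iN); have [i1b i1E] := cP i.+1 iN.
  have [kb kE] := knP i iN.
  have xb : 0 <= x <= b.
    by move/andP: ib => [? ?]; move/andP: i1b => [? ?]; apply/andP; split; lra.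
  apply: phio => //; apply: wP => //.
  have h1 := profile_le H i1b xb (ltW x1); have h2 := profile_le H xb ib x2.
  rewrite kE; rewrite iE i1E -natr1 in h1 h2.
  set u0 := Rf 0 / N%:R in LN.
  have u00 : 0 < u0 by rewrite divr_gt0.
  have f1 : Rf 0 * ((i%:R + 2^-1) / N%:R) = u0 * i%:R + u0 * 2^-1 by rewrite /u0; field; rewrite gt_eqF.
  have f2 : Rf 0 * ((i%:R + 1) / N%:R) = u0 * i%:R + u0 by rewrite /u0; field; rewrite gt_eqF.
  have f3 : Rf 0 * (i%:R / N%:R) = u0 * i%:R by rewrite /u0; field; rewrite gt_eqF.
  rewrite f1; rewrite f2 in h1; rewrite f3 in h2.
  by rewrite ler_norml; apply/andP; split; lra.
apply: (le_trans samp); rewrite -e1E ler_wpM2l ?(ltW e10)//.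
rewrite (_ : (fun x => _) = cell_density c S).
  exact: (cumulative_le H ad).
by apply/funext => x; rewrite ger0_norm//; case/andP: (ad.2 x).
Qed.

(** A cell carries at most [w = Rf 0 / N] of [rho], so the integer part [u] of the cumulative mass
    in units of [w] rises by at most one per cell, and [S] collects the cells where it rises. At the
    cell ends the cumulative mass of the cell density is then exactly [w * u], within [w] of that of
    [rho]; inside a cell both grow by at most [w], which gives the bound [2 * w]. *)
Lemma rounding N c rho : (0 < N)%N -> cell_ends N c -> subdensity r rho ->
  exists S : {set 'I_N}, forall k : R, 0 <= k <= b ->
  `|cumulative b rho k - cumulative b (cell_density c S) k| <= 2 * (Rf 0 / N%:R).
Proof.
move=> N0 cc ar; have N0' : 0 < N%:R :> R by rewrite ltr0n.
have mr : measurable_fun setT r by exact: integrable_measurable (profile_integrable H).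
have [hc cP] := cc.
pose w := Rf 0 / N%:R; have w0 : 0 < w by rewrite divr_gt0.
pose F j := cumulative b rho (c j).
pose u j := Num.truncn (F j / w).
pose S : {set 'I_N} := finset.finset (fun i : 'I_N => u i.+1 != u i); exists S.
have ad := @subdensity_cell N c S mr.
pose G j := cumulative b (cell_density c S) (c j).
have Rstep j : (j < N)%N -> Rf (c j.+1) - Rf (c j) = w.
  move=> jN; have [_ ->] := cP j (ltnW jN); have [_ ->] := cP j.+1 jN.
  by rewrite /w -natr1; field; rewrite gt_eqF.
have cstep rho' j : subdensity r rho' -> (j < N)%N -> forall k, c j.+1 <= k <= c j ->
    0 <= cumulative b rho' k - cumulative b rho' (c j) <= w /\
    0 <= cumulative b rho' (c j.+1) - cumulative b rho' k <= w.
  move=> ar' jN k /andP[k1 k2]; have [jb _] := cP j (ltnW jN); have [j1b _] := cP j.+1 jN.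
  have kb : 0 <= k <= b.
    by move/andP: jb => [? ?]; move/andP: j1b => [? ?]; apply/andP; split; lra.
  have st := Rstep j jN.
  have := profile_le H kb jb k2; have := profile_le H j1b kb k1 => h1 h2.
  have /andP[a1 a2] := cumulative_diff_le ar' kb jb k2.
  have /andP[a3 a4] := cumulative_diff_le ar' j1b kb k1.
  by split; apply/andP; split; lra.
have Fstep j : (j < N)%N -> 0 <= F j.+1 - F j <= w.
  by move=> jN; have [] := cstep rho j ar jN (c j.+1); rewrite ?lexx ?hc.
have F0 : F 0%N = 0 by rewrite /F (cell_ends0 cc) /cumulative set_itvoc0 Rintegral_set0.
have G0 : G 0%N = 0 by rewrite /G (cell_ends0 cc) /cumulative set_itvoc0 Rintegral_set0.
have Fge j : (j <= N)%N -> 0 <= F j.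
  elim: j => [|j IH] jN; first by rewrite F0.
  by have /andP[? _] := Fstep j jN; have := IH (ltnW jN); lra.
have u_b j : (j <= N)%N -> (u j)%:R * w <= F j < (u j)%:R * w + w.
  move=> jN; have /andP[h1 h2] := truncn_itv (divr_ge0 (Fge j jN) (ltW w0)).
  have h1' : (u j)%:R * w <= F j by rewrite -ler_pdivlMr.
  have h2' : F j < (u j).+1%:R * w by rewrite -ltr_pdivrMr.
  by rewrite h1'/=; rewrite -natr1 mulrDl mul1r in h2'.
have ustep j : (j < N)%N -> (u j <= u j.+1 <= (u j).+1)%N.
  move=> jN; have /andP[f1 f2] := Fstep j jN.
  have /andP[a1 a2] := u_b j (ltnW jN); have /andP[a3 a4] := u_b j.+1 jN.
  apply/andP; split; rewrite -ltnS -(ltr_nat R) -(ltr_pM2r w0) -?natr1 !mulrDl !mul1r; lra.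
have GE j : (j <= N)%N -> G j = w * (u j)%:R.
  elim: j => [|j IH] jN.
    by rewrite G0 /u F0 mul0r truncn0 mulr0.
  have [jb _] := cP j (ltnW jN); have [j1b _] := cP j.+1 jN.
  have := cumulative_diff ad j1b jb (hc _ _ (leqnSn j)).
  rewrite (@cell_mass N c S (Ordinal jN) cc) inE/= -/(G j) -/(G j.+1) IH ?(ltnW jN)// -/w.
  have := ustep j jN; case: eqVneq => [-> _|ne /andP[h1 h2]] /=; first by lra.
  have -> : u j.+1 = (u j).+1 by apply/eqP; rewrite eqn_leq h2 ltn_neqAle eq_sym ne.
  by rewrite -natr1; lra.
move=> k kb.
have ex : exists j, (j <= N)%N && (c j <= k).
  by exists N; rewrite leqnn (cell_endsN N0 cc); case/andP: kb.
rewrite -/w; case: (ex_minnP ex) => -[|j] /andP[jN cj] jmin.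
  have -> : k = b.
    by apply/eqP; rewrite eq_le; case/andP: kb => _ -> /=; rewrite -(cell_ends0 cc).
  by rewrite /cumulative set_itvoc0 !Rintegral_set0 subrr normr0 mulr_ge0// ltW.
have kcj : k <= c j.
  rewrite leNgt; apply/negP => /ltW ck; have := jmin j; rewrite (ltnW jN) ck => /(_ isT).
  by rewrite ltnn.
have kj : c j.+1 <= k <= c j by rewrite cj.
have [/andP[a1 a2] _] := cstep rho j ar jN k kj.
have [/andP[a3 a4] _] := cstep _ j ad jN k kj.
have /andP[a5 a6] := u_b j (ltnW jN); have := GE j (ltnW jN).
rewrite /G /F in a5 a6 * => a7; rewrite ler_norml; apply/andP; split; lra.
Qed.

End Cells.

(** * Energies and their limit *)

Section Energy.
Context {R : realType}.
Variables (b : R) (r Rf : R -> R) (c0 : R).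
Hypothesis H : density_profile b r Rf c0.
Variables (xi q th : R -> R).
Hypotheses (uxi : ucont b xi) (uq : ucont b q) (uth : ucont b th).
Local Notation mu := (@lebesgue_measure R).
Implicit Types (rho phi : R -> R).

Let b0 : 0 <= b. Proof. exact: ltW (profile_gt0 H). Qed.
Let L0 : 0 < Rf 0. Proof. exact: profile0_gt0 H. Qed.

(* The mollification scale [c0 tau^12] is the one for which the Hoelder bound
   turns the kernel defect into an inverse square root of the level difference. *)
Lemma log_kernel_level (tau k e : R) : 0 < tau -> 0 <= k <= b -> 0 <= e <= b -> k != e ->
  `|log_kernel xi 0 k e - log_kernel xi (c0 * tau ^+ 12) k e| <= 12 * tau * level_sing Rf k e.
Proof.
move=> tau0 kb eb ke; have c00 := profile_holder_gt0 H.
have ke0 : 0 < `|k - e| by rewrite normr_gt0 subr_eq0.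
have B0 : 0 < near_sqr xi k e.
  by rewrite ltr_wpDl ?sqr_ge0// -real_normK ?num_real// exprn_gt0.
have [/andP[k0 _] /andP[e0 _]] := (kb, eb).
have /andP[g0 g1] := log_kernel_gap (c0 * tau ^+ 12) k0 e0 B0.
rewrite ger0_norm//; apply: (le_trans g1).
pose y := `|Rf k - Rf e|.
have y0 : 0 < y.
  rewrite normr_gt0 subr_eq0; case: (ltgtP k e) ke => // h _.
    by have := profile_lt H kb eb h; case: ltgtP.
  by have := profile_lt H eb kb h; case: ltgtP.
have hold : c0 * y ^+ 6 <= `|k - e| by exact: (profile_holder H).
have B1 : c0 ^+ 2 * y ^+ 12 <= near_sqr xi k e.
  apply: (@le_trans _ _ ((k - e) ^+ 2)); last by rewrite lerDr sqr_ge0.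
  rewrite -(real_normK (num_real (k - e))) (_ : c0 ^+ 2 * y ^+ 12 = (c0 * y ^+ 6) ^+ 2).
    by rewrite ler_pXn2r// nnegrE ?normr_ge0// mulr_ge0 ?exprn_ge0// ltW.
  by rewrite exprMn -exprM.
have z0 : 0 <= tau ^+ 2 / y by rewrite divr_ge0 ?exprn_ge0// ltW.
(* The squared scale [c0 ^+ 2 * tau ^+ 24] over the lower bound [c0 ^+ 2 * y ^+ 12] of [near_sqr] is
   [(tau ^+ 2 / y) ^+ 12], and the square root of [tau ^+ 2 / y] is [tau] times the level
   singularity. *)
apply: (@le_trans _ _ (2^-1 * ln (1 + (tau ^+ 2 / y) ^+ 12))).
  rewrite ler_pM2l ?invr_gt0// ler_ln ?posrE; last 2 first.
  - by rewrite ltr_pwDl// divr_ge0 ?sqr_ge0// ltW.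
  - by rewrite ltr_pwDl// exprn_ge0.
  rewrite lerD2l ler_pdivrMr//.
  apply: (@le_trans _ _ ((tau ^+ 2 / y) ^+ 12 * (c0 ^+ 2 * y ^+ 12))).
    rewrite le_eqVlt; apply/orP; left; apply/eqP.
    by field; rewrite gt_eqF.
  by rewrite ler_wpM2l// exprn_ge0.
apply: le_trans (ln1D_expn12 z0) _.
rewrite sqrtrM ?sqr_ge0// sqrtr_sqr ger0_norm ?(ltW tau0)// sqrtrV ?(ltW y0)//.
by rewrite mulrA.
Qed.

Lemma measurable_log_kernel (eta k : R) : measurable_fun `]0, b] (log_kernel xi eta k).
Proof.
have mxi : measurable_fun `]0, b] xi by exact: ucont_measurable_oc H _ uxi.
apply: measurable_funM => //; apply: measurableT_comp => //.
apply: measurable_funM.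
  apply: measurable_funD => //; apply: measurable_funD.
    by apply: measurable_funX; exact: measurable_funB.
  by apply: measurable_funX; exact: measurable_funD.
apply: measurable_inv_ge0 => //.
  apply: measurable_funD => //; apply: measurable_funD.
    by apply: measurable_funX; exact: measurable_funB.
  by apply: measurable_funX; exact: measurable_funB.
by move=> x _; rewrite addr_ge0 ?near_sqr_ge0// sqr_ge0.
Qed.

Definition field rho (k : R) : R := density_functional b rho (log_kernel xi 0 k).

(** The pointwise defect [12 * tau * level_sing] integrates against [r] to at most
    [12 * 8 * tau * sqrt (Rf 0)], uniformly in [k] and [rho]. *)
Lemma field_gap rho (tau k : R) : subdensity r rho -> 0 < tau -> 0 <= k <= b ->
  `|field rho k - reg_field xi (c0 * tau ^+ 12) (density_functional b rho) k| <=
  tau * (96 * Num.sqrt (Rf 0)).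
Proof.
move=> ar tau0 kb; have c00 := profile_holder_gt0 H.
set eta := c0 * tau ^+ 12.
have eta0 : 0 < eta by rewrite mulr_gt0// exprn_gt0.
(* The point [e = k] is removed: the unmollified kernel has the conventional value 0 there, which
   [log_kernel_level] does not cover. *)
pose d e := (log_kernel xi 0 k e - log_kernel xi eta k e) * \1_(~` [set k]) e * rho e.
have mrho : measurable_fun `]0, b] rho.
  by have := ar.1; exact: measurable_funTS.
have md : measurable_fun `]0, b] d.
  apply: measurable_funM => //; apply: measurable_funM.
    by apply: measurable_funB; exact: measurable_log_kernel.
  by apply: measurable_indic; apply: measurableC.
have dle e : `]0, b] e -> `|d e| <= 12 * tau * (level_sing Rf k e * r e).
  rewrite /= in_itv/= => /andP[e0 eb]; rewrite /d.
  have /andP[h1 h2] := ar.2 e.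
  rewrite normrM (ger0_norm h1) mulrA ler_pM ?normr_ge0//.
  rewrite indicE; have [->|ke] := eqVneq e k.
    rewrite memNset; last by move=> /=; apply.
    by rewrite mulr0 normr0 !mulr_ge0// ?level_sing_ge0// ltW.
  rewrite mem_set ?mulr1; last by move=> /= /eqP; exact/negP.
  by apply: log_kernel_level => //; rewrite ?(ltW e0)// eq_sym.
have li := level_sing_integrable H kb.
have di : mu.-integrable `]0, b] (EFin \o d).
  have gi : mu.-integrable `]0, b]
      (EFin \o (fun e => 12 * tau * (level_sing Rf k e * r e))).
    exact: integrable_scale.
  by apply: integrable_dominated gi.
have ki : mu.-integrable `]0, b] (EFin \o (fun e => log_kernel xi eta k e * rho e)).
  by apply: (subdensity_mul_integrable H) => //; exact: log_kernel_ucont1.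
have E : field rho k = reg_field xi eta (density_functional b rho) k + \int[mu]_(e in `]0, b]) d e.
  rewrite /field /reg_field /density_functional -RintegralD//.
  apply: (@Rintegral_eq_off_point _ _ _ _ k) => //.
  - by apply: measurable_funM => //; exact: measurable_log_kernel.
  - by apply: measurable_funD => //; apply: measurable_funM => //; exact: measurable_log_kernel.
  move=> e _ ek; rewrite /d indicE mem_set ?mulr1; last by move=> /= /eqP; exact/negP.
  by ring.
rewrite E addrAC subrr add0r.
apply: le_trans (le_normr_Rintegral _ di) _ => //.
apply: (@le_trans _ _ (\int[mu]_(e in `]0, b]) (12 * tau * (level_sing Rf k e * r e)))).
  apply: le_Rintegral => //; first exact: integrable_absr.
  exact: integrable_scale.
rewrite RintegralZl//; have := level_sing_integral_le H kb.
move: (\int[mu]_(_ in _) _) (Num.sqrt _) => I s Is.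
by rewrite (_ : tau * (96 * s) = 12 * tau * (8 * s)); [rewrite ler_wpM2l// mulr_ge0// ltW|ring].
Qed.

Let C : R := 96 * Num.sqrt (Rf 0).
Let C0 : 0 < C. Proof. by rewrite mulr_gt0// sqrtr_gt0. Qed.

(** The field is the uniform limit of its mollifications as [tau] tends to 0. *)
Lemma field_ucont rho : subdensity r rho -> ucont b (field rho).
Proof.
move=> ar e e0; pose tau := e / (4 * C).
have tau0 : 0 < tau by rewrite divr_gt0// mulr_gt0.
have tauE : tau * C = e / 4 by rewrite /tau; field; rewrite gt_eqF.
have eta0 : 0 < c0 * tau ^+ 12 by rewrite mulr_gt0 ?exprn_gt0// (profile_holder_gt0 H).
have e2 : 0 < e / 2 by rewrite divr_gt0.
have [s s0 sP] := reg_field_ucont b0 L0 uxi eta0 (density_mass_functional H ar) e2.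
exists s => // x y xb yb xy; have := sP _ _ xb yb xy.
have := field_gap ar tau0 xb; have := field_gap ar tau0 yb.
rewrite -/C tauE; set f := field rho; set g := reg_field _ _ _.
rewrite !ler_norml => /andP[? ?] /andP[? ?] /andP[? ?]; apply/andP; split; lra.
Qed.

Definition energy rho (x t : R) : R :=
  \int[mu]_(k in `]0, b]) ((potential q th x t k + (2 * pi)^-1 * field rho k) * rho k).

Lemma energyE rho x t : subdensity r rho -> energy rho x t =
  density_functional b rho (potential q th x t) +
  (2 * pi)^-1 * density_functional b rho (field rho).
Proof.
move=> ar; have uP := potential_ucont b0 uq uth x t; have uF := field_ucont ar.
have iF := subdensity_mul_integrable H ar uF.
rewrite /energy /density_functional -RintegralZl// -RintegralD//.
- by apply: eq_Rintegral => k _; rewrite mulrDl mulrA.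
- exact: (subdensity_mul_integrable H).
- exact: integrable_scale.
Qed.

Lemma pi2_inv : 0 <= (2 * pi : R)^-1 <= 1.
Proof.
rewrite invr_ge0 mulr_ge0 ?pi_ge0//= invf_le1 ?mulr_gt0 ?pi_gt0//.
by have := pi_ge2 R; lra.
Qed.

Lemma energy_reg rho (tau x t : R) : subdensity r rho -> 0 < tau ->
  `|energy rho x t - reg_energy xi q th (c0 * tau ^+ 12) x t (density_functional b rho)| <=
  tau * (C * Rf 0).
Proof.
move=> ar tau0; rewrite energyE// /reg_energy.
have eta0 : 0 < c0 * tau ^+ 12 by rewrite mulr_gt0 ?exprn_gt0// (profile_holder_gt0 H).
have mJ := density_mass_functional H ar.
have uF := field_ucont ar.
have uG := reg_field_ucont b0 L0 uxi eta0 mJ.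
have h : `|density_functional b rho (field rho) - density_functional b rho
    (reg_field xi (c0 * tau ^+ 12) (density_functional b rho))| <= tau * C * Rf 0.
  rewrite -mJ.1//; apply: mJ.2; first exact: ucont_sub.
  by move=> k kb; exact: field_gap.
rewrite (_ : forall a p f g : R, a + p * f - (a + p * g) = p * (f - g)); last first.
  by move=> a p f g; ring.
have /andP[p0 p1] := pi2_inv.
rewrite normrM ger0_norm// mulrA; apply: le_trans h.
exact: ler_piMl.
Qed.

(** The scale [tau] is fixed first, making each of the two mollification errors [ep / 4]; the grid
    and the tolerance are then chosen for that scale. *)
Lemma energy_close (B ep : R) : 0 < B -> 0 < ep -> exists n, exists2 d : R, 0 < d &
  forall rho rho', subdensity r rho -> subdensity r rho' ->
  (forall i, (i < n.+1)%N ->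
    `|cumulative b rho (grid b n i) - cumulative b rho' (grid b n i)| <= d) ->
  forall x t, `|x| <= B -> `|t| <= B -> `|energy rho x t - energy rho' x t| <= ep.
Proof.
move=> B0 ep0; pose tau := ep / (4 * (C * Rf 0)).
have CL : 0 < C * Rf 0 by rewrite mulr_gt0.
have tau0 : 0 < tau by rewrite divr_gt0// mulr_gt0.
have tauE : tau * (C * Rf 0) = ep / 4.
  by rewrite /tau; field; rewrite !gt_eqF.
have eta0 : 0 < c0 * tau ^+ 12 by rewrite mulr_gt0 ?exprn_gt0// (profile_holder_gt0 H).
have ep2 : 0 < ep / 2 by rewrite divr_gt0.
have [e e0 eP] := reg_energy_close b0 L0 uxi uq uth eta0 B0 ep2.
have [e1 e10 e1P] := density_close H e0.
have [s s0 [M M0 sP]] := eP _ e10.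
have [n [d d0 dP]] := e1P _ _ s0 M0.
exists n, d => // rho rho' ar ar' cl x t xB tB.
have := sP _ _ (density_mass_functional H ar) (density_mass_functional H ar')
  (dP _ _ ar ar' cl) _ _ xB tB.
have := energy_reg x t ar tau0; have := energy_reg x t ar' tau0; rewrite tauE.
rewrite !ler_norml => /andP[? ?] /andP[? ?] /andP[? ?]; apply/andP; split; lra.
Qed.

End Energy.

(** Telescoping on both sides of [i] at once: [(m + 1)^(-1/2) <= 2 (sqrt (m + 1) - sqrt m)], and by
    truncated subtraction at most one of the two roots in [T j] is nonzero. The term [j = i] is 0 by
    the convention for the inverse. *)
Lemma sum_inv_sqrt_dist (R : realType) (N i : nat) : (i < N)%N ->
  \sum_(j < N) (Num.sqrt `|i%:R - j%:R : R|)^-1 <= 4 * Num.sqrt N%:R.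
Proof.
move=> iN.
pose T j : R := Num.sqrt (j - i.+1)%:R - Num.sqrt (i - j)%:R.
have one (m : nat) : (Num.sqrt m.+1%:R)^-1 <= 2 * (Num.sqrt m.+1%:R - Num.sqrt m%:R) :> R.
  have s0 : 0 < Num.sqrt (m.+1%:R : R) by rewrite sqrtr_gt0.
  have s1 : 0 <= Num.sqrt (m%:R : R) by rewrite sqrtr_ge0.
  have e1 : Num.sqrt (m.+1%:R : R) ^+ 2 = m%:R + 1 by rewrite sqr_sqrtr// natr1.
  have e2 : Num.sqrt (m%:R : R) ^+ 2 = m%:R by rewrite sqr_sqrtr.
  rewrite -(ler_pM2r s0) mulVf ?gt_eqF//.
  set s := Num.sqrt _ in s0 e1 *; set u := Num.sqrt _ in s1 e2 *.
  have : s ^+ 2 - u ^+ 2 = 1 by lra.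
  have : 0 <= (s - u) ^+ 2 by exact: sqr_ge0.
  by nra.
have step j : (Num.sqrt `|i%:R - j%:R : R|)^-1 <= 2 * (T j.+1 - T j).
  rewrite /T; have [ij|ji|->] := ltngtP i j.
  - have -> : (j - i.+1 = (j - i).-1)%N by rewrite subnS.
    have -> : (j.+1 - i.+1 = (j - i).-1.+1)%N by rewrite subSS prednK// subn_gt0.
    have -> : (i - j.+1 = 0)%N by apply/eqP; rewrite subn_eq0 ltnW// ltnW.
    have -> : (i - j = 0)%N by apply/eqP; rewrite subn_eq0 ltnW.
    rewrite sqrtr0 !subr0 -opprB normrN -natrB 1?ltnW// ger0_norm//.
    by rewrite -[in leLHS](prednK (n := j - i)) ?subn_gt0//; exact: one.
  - have -> : (j - i.+1 = 0)%N by apply/eqP; rewrite subn_eq0 ltnW// ltnW.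
    have -> : (j.+1 - i.+1 = 0)%N by apply/eqP; rewrite subn_eq0 ltnS ltnW.
    have -> : (i - j.+1 = (i - j).-1)%N by rewrite subnS.
    rewrite sqrtr0 !sub0r opprK -natrB 1?ltnW// ger0_norm//.
    by have := one (i - j).-1; rewrite prednK ?subn_gt0// [X in 2 * X]addrC.
  - have -> : (j - j.+1 = 0)%N by apply/eqP; rewrite subn_eq0.
    by rewrite subrr normr0 !subnn sqrtr0 invr0 !subr0 mulr0.
apply: (@le_trans _ _ (\sum_(j < N) 2 * (T j.+1 - T j))).
  by apply: ler_sum => j _; exact: step.
rewrite -mulr_sumr -(big_mkord xpredT (fun j => T j.+1 - T j)) telescope_sumr//.
rewrite /T sub0n subn0.
have -> : (i - N = 0)%N by apply/eqP; rewrite subn_eq0 ltnW.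
have h1 : Num.sqrt (N - i.+1)%:R <= Num.sqrt N%:R :> R.
  by rewrite ler_wsqrtr// ler_nat leq_subr.
have h2 : Num.sqrt i%:R <= Num.sqrt N%:R :> R.
  by rewrite ler_wsqrtr// ler_nat ltnW.
by rewrite sqrtr0; lra.
Qed.

Lemma ln_sqrt_le (R : realType) (z : R) : 0 < z -> ln z <= 2 * Num.sqrt z.
Proof.
move=> z0; have s0 : 0 < Num.sqrt z by rewrite sqrtr_gt0.
rewrite -[in leLHS](sqr_sqrtr (ltW z0)) lnXn// mulr_natl ler_pMn2r//.
exact/ltW/ln_sublinear.
Qed.

(** * Energies of finite sets of nodes *)

Section DiscreteEnergy.
Context {R : realType}.
Variables (b : R) (r Rf : R -> R) (c0 : R).
Hypothesis H : density_profile b r Rf c0.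
Variables (xi q th : R -> R).
Hypotheses (uxi : ucont b xi) (uq : ucont b q) (uth : ucont b th).
Implicit Types (kn : nat -> R).

Let b0 : 0 <= b. Proof. exact: ltW (profile_gt0 H). Qed.
Let L0 : 0 < Rf 0. Proof. exact: profile0_gt0 H. Qed.

Definition node_kernel kn (i j : nat) : R :=
  if i == j then ln (2 * kn i) else log_kernel xi 0 (kn i) (kn j).

Definition node_energy N kn (S : {set 'I_N}) (x t : R) : R :=
  Rf 0 / N%:R * \sum_(i in S) potential q th x t (kn i) +
  (2 * pi)^-1 * (Rf 0 / N%:R) ^+ 2 *
    \sum_(i in S) \sum_(j in S) node_kernel kn i j.

Lemma node_level N kn i j : cell_nodes b Rf N kn -> (i < N)%N -> (j < N)%N ->
  level_sing Rf (kn i) (kn j) =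
  (Num.sqrt `|i%:R - j%:R|)^-1 * (Num.sqrt (Rf 0 / N%:R))^-1.
Proof.
move=> knP iN jN; rewrite /level_sing; have [_ ->] := knP i iN; have [_ ->] := knP j jN.
have N0 : 0 < N%:R :> R by rewrite ltr0n (leq_ltn_trans _ iN).
have -> : Rf 0 * ((i%:R + 2^-1) / N%:R) - Rf 0 * ((j%:R + 2^-1) / N%:R) =
   (i%:R - j%:R) * (Rf 0 / N%:R) by field; rewrite gt_eqF.
rewrite normrM (ger0_norm (ltW (divr_gt0 L0 N0))) sqrtrM// invfM//.
Qed.

Lemma node_neq N kn i j : cell_nodes b Rf N kn -> (i < N)%N -> (j < N)%N -> i != j ->
  kn i != kn j.
Proof.
move=> knP iN jN; apply: contra => /eqP ij.
have N0 : N%:R != 0 :> R by rewrite pnatr_eq0 -lt0n (leq_ltn_trans _ iN).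
have [_ h1] := knP i iN; have [_ h2] := knP j jN.
move: h1; rewrite ij h2 => /(mulfI (lt0r_neq0 L0))/(mulIf (invr_neq0 N0))/addIr/eqP.
by rewrite eqr_nat eq_sym.
Qed.

(** The level of a node differs from that of 0 by at least [Rf 0 / (2 N)], so the Hoelder bound
    keeps the node above a multiple of [N^(-6)]. Its logarithm is then [O(ln N)], majorized by
    [O(sqrt N)] for convenience. *)
Lemma node_ln N kn i : cell_nodes b Rf N kn -> (i < N)%N ->
  `|ln (2 * kn i)| <= 2 * b + (2 * c0 * (Rf 0 / 2) ^+ 6)^-1 + 12 * Num.sqrt N%:R.
Proof.
move=> knP iN; have c00 := profile_holder_gt0 H.
have [kb kE] := knP i iN; have N0 : 0 < N%:R :> R by rewrite ltr0n (leq_ltn_trans _ iN).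
have zb : 0 <= (0:R) <= b by rewrite lexx.
have iN1 : i%:R + 1 <= N%:R :> R by rewrite natr1 ler_nat.
set a := 2 * c0 * (Rf 0 / 2) ^+ 6.
have a0 : 0 < a by rewrite mulr_gt0 ?exprn_gt0 ?divr_gt0// mulr_gt0.
have k_ge : a / N%:R ^+ 6 <= 2 * kn i.
  have kk : `|0 - kn i| = kn i by rewrite sub0r normrN ger0_norm//; case/andP: kb.
  have := profile_holder H zb kb; rewrite kk.
  have d_ge : Rf 0 / 2 / N%:R <= `|Rf 0 - Rf (kn i)|.
    rewrite kE ger0_norm.
      rewrite ler_pdivrMr// mulrBl mulrA divfK ?gt_eqF//.
      have h : 0 <= Rf 0 * (N%:R - (i%:R + 1)) by rewrite mulr_ge0 ?(ltW L0)// subr_ge0.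
      by lra.
    rewrite subr_ge0 ger_pMr// ler_pdivrMr// mul1r; lra.
  have : (Rf 0 / 2 / N%:R) ^+ 6 <= `|Rf 0 - Rf (kn i)| ^+ 6.
    by rewrite ler_pXn2r// nnegrE ?normr_ge0// !divr_ge0// ltW.
  rewrite expr_div_n => h h'.
  have -> : a / N%:R ^+ 6 = 2 * (c0 * ((Rf 0 / 2) ^+ 6 / N%:R ^+ 6)).
    by rewrite /a; ring.
  by rewrite ler_pM2l//; apply: le_trans h'; rewrite ler_pM2l.
have k0 : 0 < 2 * kn i by apply: lt_le_trans k_ge; rewrite divr_gt0// exprn_gt0.
have s0 := sqrtr_ge0 (N%:R : R).
have ia : 0 < a^-1 by rewrite invr_gt0.
have up : ln (2 * kn i) <= 2 * b.
  apply: (le_trans (ltW (ln_sublinear k0))); case/andP: kb => ? ?; lra.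
have lo : - ln (2 * kn i) <= a^-1 + 12 * Num.sqrt N%:R.
  rewrite -lnV ?posrE//.
  apply: (@le_trans _ _ (ln (a^-1 * N%:R ^+ 6))).
    have kp : 0 < kn i by lra.
    have aN : 0 < a / N%:R ^+ 6 by rewrite divr_gt0// exprn_gt0.
    have -> : a^-1 * N%:R ^+ 6 = (a / N%:R ^+ 6)^-1 by rewrite invf_div mulrC.
    by rewrite ler_ln ?posrE ?invr_gt0// lef_pV2 ?posrE.
  rewrite lnM ?posrE ?exprn_gt0// lnXn// lerD//.
    exact/ltW/ln_sublinear.
  by have := ln_sqrt_le N0; rewrite -mulr_natl; lra.
by rewrite ler_norml; apply/andP; split; lra.
Qed.

(** Nodes [i] and [j] differ in level by [|i - j| * w] with [w = Rf 0 / N], so the off-diagonal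
    defects of a row sum to at most [48 * tau * sqrt N / sqrt w]. Over [N] rows with weight [w ^+ 2]
    this is a bound independent of [N]. The diagonal defect is [O(sqrt N)] per row and vanishes in
    the limit. *)
Lemma node_energy_reg (tau ep : R) : 0 < tau -> 0 < ep ->
  exists N0 : nat, forall N kn (S : {set 'I_N}), (N0 < N)%N -> cell_nodes b Rf N kn ->
  forall x t, `|node_energy kn S x t -
     reg_energy xi q th (c0 * tau ^+ 12) x t (node_functional Rf kn S)| <=
  tau * (48 * (Rf 0 * Num.sqrt (Rf 0))) + ep.
Proof.
move=> tau0 ep0; have c00 := profile_holder_gt0 H.
set eta := c0 * tau ^+ 12; have eta0 : 0 < eta by rewrite mulr_gt0// exprn_gt0.
have [[M M0 MP] _] := log_kernel_ucont b0 uxi eta0.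
set a := (2 * c0 * (Rf 0 / 2) ^+ 6)^-1.
have a0 : 0 < a by rewrite invr_gt0 mulr_gt0 ?exprn_gt0 ?divr_gt0// mulr_gt0.
(* [K / sqrt N] bounds the diagonal part: [M] comes from the mollified kernel, the other terms from
   [node_ln], and [sqrt N >= 1] absorbs the constants. *)
pose K := Rf 0 ^+ 2 * (M + 2 * b + a + 12).
have K0 : 0 < K.
  by apply: mulr_gt0; [exact: exprn_gt0|have bb := b0; lra].
exists (Num.truncn ((K / ep) ^+ 2)).+1 => N kn S NN knP x t.
have N0 : (0 < N)%N by apply: leq_trans NN.
have N0' : 0 < N%:R :> R by rewrite ltr0n.
have N1 : 1 <= N%:R :> R by rewrite ler1n.
pose s := Num.sqrt (N%:R : R).
have s2 : s ^+ 2 = N%:R by rewrite sqr_sqrtr.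
have s1 : 1 <= s by rewrite -(@sqrtr1 R) ler_wsqrtr.
have Ks : K <= ep * s.
  rewrite mulrC -ler_pdivrMr// -(@ler_pXn2r _ 2)// ?nnegrE ?divr_ge0 ?(ltW K0) ?(ltW ep0)//; last first.
    by rewrite sqrtr_ge0.
  rewrite s2; apply: ltW; apply: (lt_trans (truncnS_gt _)); by rewrite ltr_nat.
set w := Rf 0 / N%:R; have w0 : 0 < w by rewrite divr_gt0.
pose G i j := node_kernel kn i j - log_kernel xi eta (kn i) (kn j).
have E : node_energy kn S x t - reg_energy xi q th eta x t (node_functional Rf kn S) =
    (2 * pi)^-1 * (w ^+ 2 * \sum_(i in S) \sum_(j in S) G i j).
  rewrite /node_energy /reg_energy /reg_field /node_functional -/w.
  rewrite -mulr_sumr.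
  under [X in _ = _ * (_ * X)]eq_bigr do rewrite sumrB.
  by rewrite [in RHS]sumrB; ring.
rewrite E; have /andP[p0 p1] := @pi2_inv R.
rewrite normrM ger0_norm//.
set Q := w ^+ 2 * _.
suff QP : `|Q| <= tau * (48 * (Rf 0 * Num.sqrt (Rf 0))) + ep.
  by apply: le_trans QP; exact: ler_piMl.
have row (i : 'I_N) : i \in S -> `|\sum_(j in S) G i j| <=
    (M + (2 * b + a + 12 * s)) + 12 * tau / Num.sqrt w * (4 * s).
  move=> iS; apply: le_trans (ler_norm_sum _ _ _) _.
  have [ib _] := knP i (ltn_ord i).
  rewrite (bigD1 i)//=; apply: lerD.
    rewrite /G /node_kernel eqxx (le_trans (ler_normB _ _))// addrC lerD//; first exact: MP.
    exact: node_ln knP (ltn_ord i).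
  apply: (@le_trans _ _ (\sum_(j < N) 12 * tau / Num.sqrt w * (Num.sqrt `|i%:R - j%:R|)^-1)).
    rewrite [leRHS](bigID (fun j : 'I_N => (j \in S) && (j != i)))/= ler_wpDr//.
      apply: sumr_ge0 => j _; rewrite mulr_ge0 ?invr_ge0 ?sqrtr_ge0//.
      by rewrite divr_ge0 ?sqrtr_ge0// mulr_ge0// ltW.
    apply: ler_sum => j /andP[jS ji]; have [jb _] := knP j (ltn_ord j).
    rewrite /G /node_kernel (negPf (_ : (i : nat) != j)); last by rewrite eq_sym.
    have ne : kn i != kn j by apply: node_neq knP _ _ _ => //; rewrite eq_sym.
    apply: le_trans (log_kernel_level H xi tau0 ib jb ne) _.
    by rewrite (node_level knP)//; rewrite le_eqVlt; apply/orP; left; apply/eqP; rewrite -/w; ring.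
  rewrite -mulr_sumr ler_wpM2l//; last exact: sum_inv_sqrt_dist.
  by rewrite divr_ge0 ?sqrtr_ge0// mulr_ge0// ltW.
set Z := (M + _ + _) in row.
have Z0 : 0 <= Z.
  have bb := b0; rewrite /Z addr_ge0//; first by lra.
  by rewrite mulr_ge0 ?divr_ge0 ?sqrtr_ge0 ?mulr_ge0 ?(ltW tau0)//; lra.
have QZ : `|Q| <= w ^+ 2 * (N%:R * Z).
  rewrite /Q normrM ger0_norm ?sqr_ge0// ler_wpM2l ?sqr_ge0//.
  apply: le_trans (ler_norm_sum _ _ _) _.
  apply: (@le_trans _ _ (\sum_(i in S) Z)); first by apply: ler_sum => i; exact: row.
  rewrite sumr_const -[leLHS]mulr_natl ler_wpM2r// ler_nat.
  by apply: leq_trans (max_card _) _; rewrite card_ord.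
apply: (le_trans QZ).
have sw : Num.sqrt w = Num.sqrt (Rf 0) / s.
  by rewrite /w sqrtrM ?(ltW L0)// sqrtrV// ler0n.
have sL0 : 0 < Num.sqrt (Rf 0) by rewrite sqrtr_gt0.
have sL2 : Num.sqrt (Rf 0) ^+ 2 = Rf 0 by rewrite sqr_sqrtr// ltW.
have s0 : 0 < s by lra.
have -> : w ^+ 2 * (N%:R * Z) = Rf 0 ^+ 2 / s ^+ 2 * (M + (2 * b + a + 12 * s)) +
    tau * (48 * (Rf 0 * Num.sqrt (Rf 0))).
  rewrite /Z sw /w -s2; set l := Num.sqrt _ in sL0 sL2 *; rewrite -sL2.
  by field; rewrite !gt_eqF.
rewrite addrC lerD2l.
apply: (@le_trans _ _ (K / s)); last by rewrite ler_pdivrMr.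
have -> : K / s = Rf 0 ^+ 2 / s ^+ 2 * ((M + 2 * b + a + 12) * s).
  by rewrite /K; field; rewrite gt_eqF.
rewrite ler_wpM2l//; first by rewrite divr_ge0// sqr_ge0.
have bb := b0.
have : 0 <= (M + 2 * b + a) * (s - 1) by rewrite mulr_ge0//; lra.
by rewrite mulrDl; lra.
Qed.

End DiscreteEnergy.

(** * Minimizers and the limit for a density profile *)

Section GasLimit.
Context {R : realType}.
Variables (b : R) (r Rf : R -> R) (c0 : R).
Hypothesis H : density_profile b r Rf c0.
Variables (xi q th : R -> R).
Hypotheses (uxi : ucont b xi) (uq : ucont b q) (uth : ucont b th).
Local Notation mu := (@lebesgue_measure R).
Local Notation energy := (energy b xi q th).
Local Notation node_energy := (node_energy Rf xi q th).
Implicit Types (rho : R -> R) (kn : nat -> R).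

Let b0 : 0 <= b. Proof. exact: ltW (profile_gt0 H). Qed.
Let L0 : 0 < Rf 0. Proof. exact: profile0_gt0 H. Qed.

Lemma discrete_energy_close (B ep : R) : 0 < B -> 0 < ep -> exists N0 : nat,
  forall N c kn (S : {set 'I_N}), (N0 < N)%N -> cell_ends b Rf N c -> cell_nodes b Rf N kn ->
  forall x t : R, `|x| <= B -> `|t| <= B ->
  `|energy (cell_density r c S) x t - node_energy kn S x t| <= ep.
Proof.
move=> B0 ep0.
pose C1 := 96 * Num.sqrt (Rf 0) * Rf 0; pose C2 := 48 * (Rf 0 * Num.sqrt (Rf 0)).
have C10 : 0 < C1 by rewrite mulr_gt0// mulr_gt0// sqrtr_gt0.
have C20 : 0 < C2 by rewrite mulr_gt0// mulr_gt0// sqrtr_gt0.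
pose tau := ep / (4 * (C1 + C2)).
have C120 : 0 < C1 + C2 by rewrite addr_gt0.
have tau0 : 0 < tau by rewrite divr_gt0// mulr_gt0.
have tauE : tau * C1 + tau * C2 = ep / 4.
  by rewrite -mulrDr /tau; field; rewrite gt_eqF.
have eta0 : 0 < c0 * tau ^+ 12 by rewrite mulr_gt0 ?exprn_gt0// (profile_holder_gt0 H).
have ep4 : 0 < ep / 4 by rewrite divr_gt0.
have [e e0 eP] := reg_energy_close b0 L0 uxi uq uth eta0 B0 ep4.
have [e1 e10 e1P] := node_close H e0.
have [s s0 [M M0 sP]] := eP _ e10.
have [N1 N1P] := e1P s M s0.
have [N2 N2P] := @node_energy_reg _ _ _ _ _ H xi q th uxi _ _ tau0 ep4.
have mr : measurable_fun setT r by exact: integrable_measurable (profile_integrable H).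
exists (maxn N1 N2) => N c kn S; rewrite gtn_max => /andP[NN1 NN2] cc knP x t xB tB.
have N0 : (0 < N)%N by apply: leq_trans NN1.
have ad := subdensity_cell H c S mr.
have h1 := sP _ _ (density_mass_functional H ad) (node_mass_functional H S N0 knP)
  (N1P _ _ _ _ NN1 cc knP) _ _ xB tB.
have h2 := energy_reg H uxi uq uth x t ad tau0.
have h3 := N2P _ _ S NN2 knP x t.
rewrite -/C1 -/C2 in h2 h3.
move: h1 h2 h3; rewrite !ler_norml => /andP[? ?] /andP[? ?] /andP[? ?].
by apply/andP; split; lra.
Qed.

Lemma rounding_energy (B ep : R) : 0 < B -> 0 < ep -> exists N0 : nat,
  forall N c rho, (N0 < N)%N -> cell_ends b Rf N c -> subdensity r rho ->
  exists S : {set 'I_N}, forall x t : R, `|x| <= B -> `|t| <= B ->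
  `|energy rho x t - energy (cell_density r c S) x t| <= ep.
Proof.
move=> B0 ep0; have [n [d d0 dP]] := energy_close H uxi uq uth B0 ep0.
have mr : measurable_fun setT r by exact: integrable_measurable (profile_integrable H).
exists (Num.truncn (2 * Rf 0 / d)) => N c rho NN cc ar.
have N0 : (0 < N)%N by apply: leq_trans NN.
have [S SP] := rounding H N0 cc ar.
exists S => x t xB tB; apply: dP => //; first exact: (subdensity_cell H).
move=> i ilt; apply: le_trans (SP _ _) _.
  rewrite /grid; case: n ilt => [|n] ilt.
    by rewrite invr0 mulr0 mulr0 subr0 b0 lexx.
  have f0 : 0 <= i%:R / n.+1%:R :> R by rewrite divr_ge0.
  have f1 : i%:R / n.+1%:R <= 1 :> R.
    by rewrite ler_pdivrMr// mul1r ler_nat.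
  have h1 := mulr_ge0 b0 f0; have h2 := ler_piMr b0 f1.
  by rewrite subr_ge0 h2/= lerBlDr lerDl.
have h : 2 * Rf 0 / d <= N%:R.
  by apply: ltW; apply: (lt_le_trans (truncnS_gt _)); rewrite ler_nat.
by rewrite mulrA ler_pdivrMr ?ltr0n// [d * _]mulrC -ler_pdivrMr.
Qed.

(** Mollifying at the fixed scale [tau = 1] makes the kernel bounded at a bounded cost. *)
Lemma energy_bounded (x t : R) : exists M : R, forall rho, subdensity r rho ->
  - M <= energy rho x t.
Proof.
have az : subdensity r (fun=> 0).
  by split => // y; rewrite lexx (profile_ge0 H).
have tau0 : 0 < (1 : R) by [].
have eta0 : 0 < c0 * 1 ^+ 12 by rewrite expr1n mulr1 (profile_holder_gt0 H).
have [[K K0 KP] _] := log_kernel_ucont b0 uxi eta0.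
have uP := potential_ucont b0 uq uth x t.
have [P P0 PP] := ucont_bounded b0 uP.
exists (P * Rf 0 + K * Rf 0 * Rf 0 + 1 * (96 * Num.sqrt (Rf 0) * Rf 0)) => rho ar.
have mJ := density_mass_functional H ar.
have h1 := energy_reg H uxi uq uth x t ar tau0.
have h2 := mJ.2 _ _ uP PP.
have h3 : `|density_functional b rho (reg_field xi (c0 * 1 ^+ 12) (density_functional b rho))|
   <= K * Rf 0 * Rf 0.
  apply: mJ.2; first exact: (reg_field_ucont b0 L0 uxi eta0 mJ).
  move=> k kb; apply: mJ.2; first exact: (log_kernel_ucont1 b0 uxi eta0 kb).
  by move=> e eb; exact: KP.
have /andP[p0 p1] := @pi2_inv R.
have h4 : `|(2 * pi)^-1 * density_functional b rho (reg_field xi (c0 * 1 ^+ 12) (density_functional b rho))|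
   <= K * Rf 0 * Rf 0.
  by rewrite normrM ger0_norm//; apply: le_trans h3; exact: ler_piMl.
rewrite /reg_energy in h1; move: h1 h2 h4; rewrite !ler_norml.
by move=> /andP[? ?] /andP[? ?] /andP[? ?]; lra.
Qed.

(** The direct method: [rho] is a weak cluster point of a minimizing sequence. [energy_close] asks
    for the masses of finitely many intervals []grid b n i, b]] only, which is what the cluster
    property delivers along arbitrarily late indices. *)
Lemma energy_minimizer (x t : R) : exists2 rho, subdensity r rho &
  forall rho', subdensity r rho' -> energy rho x t <= energy rho' x t.
Proof.
have [M MP] := energy_bounded x t.
have az : subdensity r (fun=> 0).
  by split => // y; rewrite lexx (profile_ge0 H).
pose V := [set e : R | exists2 rho, subdensity r rho & e = energy rho x t].
have hV : has_inf V.
  split; first by exists (energy (fun=> 0) x t), (fun=> 0).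
  by exists (- M) => _ [rho ar ->]; exact: MP.
have /choice[rho_ rhoP] : forall n : nat, exists rho, subdensity r rho /\
    energy rho x t < inf V + n.+1%:R^-1.
  move=> n; have n0 : 0 < n.+1%:R^-1 :> R by rewrite invr_gt0.
  by have [_ [rho ar ->] lt] := inf_adherent n0 hV; exists rho.
have [rho [mrho rr cl]] := dominated_weak_cluster (profile_integrable H)
  (fun n => (rhoP n).1.1) (fun n => (rhoP n).1.2).
have ar : subdensity r rho by [].
exists rho => // rho' ar'.
apply: (@le_trans _ _ (inf V)); last first.
  by apply: ge_inf; [exact: hV.2|exists rho'].
apply/ler_addgt0Pr => ep ep0; have ep2 : 0 < ep / 2 by rewrite divr_gt0.
pose B := `|x| + `|t| + 1; have B0 : 0 < B by rewrite ltr_wpDl// addr_ge0.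
have [n [d d0 dP]] := energy_close H uxi uq uth B0 ep2.
have [m mn mP] := cl n.+1 (fun i => `]grid b n i, b]%classic)
  (fun i => measurable_itv _) d d0 (Num.truncn (2 / ep)).
have [arm lm] := rhoP m.
have hm : m.+1%:R^-1 <= ep / 2.
  have h : 2 / ep <= m.+1%:R.
    by apply: ltW; apply: (lt_le_trans (truncnS_gt _)); rewrite ler_nat.
  by rewrite -[leRHS]invrK lef_pV2 ?posrE ?invr_gt0// invf_div.
have l2 : energy (rho_ m) x t <= inf V + ep / 2.
  by apply: ltW; apply: (lt_le_trans lm); rewrite lerD2l.
have xB : `|x| <= B by rewrite /B; have := normr_ge0 t; lra.
have tB : `|t| <= B by rewrite /B; have := normr_ge0 x; lra.
have := dP _ _ arm ar (fun i ilt => ltW (mP i ilt)) x t xB tB.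
rewrite ler_norml => /andP[? ?]; lra.
Qed.

(** The lower bound holds because the cell density of any [S] competes in the continuous problem;
    the upper bound uses the rounding of a continuous minimizer. Both thresholds depend on [(x, t)]
    through the bound [B] alone. *)
Theorem gas_limit (kn : nat -> nat -> R) :
  (forall N, (0 < N)%N -> cell_nodes b Rf N (kn N)) ->
  exists Emin : R -> R -> R,
   (forall x t, (exists2 rho, subdensity r rho & Emin x t = energy rho x t) /\
      forall rho, subdensity r rho -> Emin x t <= energy rho x t) /\
   forall B ep : R, 0 < B -> 0 < ep -> exists N0 : nat, forall N, (N0 < N)%N ->
     forall x t, `|x| <= B -> `|t| <= B ->
     (forall S : {set 'I_N}, Emin x t - ep <= node_energy (kn N) S x t) /\
     exists S : {set 'I_N}, node_energy (kn N) S x t <= Emin x t + ep.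
Proof.
move=> knP.
have /choice[f fP] : forall p : R * R, exists rho, subdensity r rho /\
    forall rho', subdensity r rho' -> energy rho p.1 p.2 <= energy rho' p.1 p.2.
  by move=> p; have [rho ar h] := energy_minimizer p.1 p.2; exists rho.
exists (fun x t => energy (f (x, t)) x t); split.
  move=> x t; split; first by exists (f (x, t)) => //; exact: (fP (x, t)).1.
  exact: (fP (x, t)).2.
move=> B ep B0 ep0; have ep2 : 0 < ep / 2 by rewrite divr_gt0.
have [N1 N1P] := discrete_energy_close B0 ep2.
have [N2 N2P] := rounding_energy B0 ep2.
have mr : measurable_fun setT r by exact: integrable_measurable (profile_integrable H).
exists (maxn N1 N2) => N; rewrite gtn_max => /andP[NN1 NN2] x t xB tB.
have N0 : (0 < N)%N by apply: leq_trans NN1.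
have [c cc] := cell_ends_exist H N0.
have nc S := N1P N c (kn N) S NN1 cc (knP N N0) x t xB tB.
split.
  move=> S; have := nc S; have := (fP (x, t)).2 _ (subdensity_cell H c S mr).
  by rewrite ler_norml /= => ? /andP[? ?]; lra.
have [S SP] := N2P N c _ NN2 cc (fP (x, t)).1; exists S.
have := SP x t xB tB; have := nc S.
by rewrite !ler_norml => /andP[? ?] /andP[? ?]; lra.
Qed.

End GasLimit.

(** * The phase and the Lambert branches *)

Section Phase.
Context {R : realType}.
Implicit Types (x y s : R).

(* [phase (h k)] is [h] times [E (zeta k)], where [h = 2 delta]; the value at [0]
   is the limit, which the formula does not give because [0 / 0 = 0] and [ln 0 = 0]. *)
Definition phase x : R :=
  if x == 0 then 0 else 1 - x * (cos x / sin x) + ln (x / sin x).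

(** The derivative of [phase] arranged as a nonnegative term plus [x], which displays the lower
    bound behind all monotonicity and Hoelder estimates for [phase]. *)
Definition phase' x : R := (sin x - x * cos x) ^+ 2 / (x * sin x ^+ 2) + x.

Lemma phase0 : phase 0 = 0. Proof. by rewrite /phase eqxx. Qed.

Lemma phaseE x : 0 < x -> phase x = 1 - x * (cos x / sin x) + ln (x / sin x).
Proof. by move=> x0; rewrite /phase gt_eqF. Qed.

Lemma phase'_ge x : 0 < x -> x <= phase' x.
Proof.
by move=> x0; rewrite /phase' lerDr divr_ge0 ?sqr_ge0// mulr_ge0 ?sqr_ge0// ltW.
Qed.

Lemma is_derive_phase x : 0 < x < pi -> is_derive x 1 phase (phase' x).
Proof.
move=> xpi; have s0 := sin_gt0_pi xpi; case/andP: xpi => x0 xpi.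
have sx : sin x != 0 by rewrite gt_eqF.
have dV : is_derive x 1 (fun t : R => (sin t)^-1) (- (sin x) ^- 2 * cos x).
  exact: (is_deriveV (f := @sin R) sx).
have dcs : is_derive x 1 (fun t : R => cos t / sin t)
    (cos x * (- (sin x) ^- 2 * cos x) + (sin x)^-1 * - sin x).
  exact: (@is_deriveM _ _ (@cos R) (fun t : R => (sin t)^-1)).
have dxc : is_derive x 1 (fun t : R => t * (cos t / sin t))
    (x * (cos x * (- (sin x) ^- 2 * cos x) + (sin x)^-1 * - sin x) + (cos x / sin x) * 1).
  exact: (@is_deriveM _ _ (@id R) (fun t : R => cos t / sin t)).
have dxs : is_derive x 1 (fun t : R => t / sin t) (x * (- (sin x) ^- 2 * cos x) + (sin x)^-1 * 1).
  exact: (@is_deriveM _ _ (@id R) (fun t : R => (sin t)^-1)).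
have xs0 : 0 < x / sin x by rewrite divr_gt0.
have dl := is_derive1_ln xs0.
have dln : is_derive x 1 (fun t : R => ln (t / sin t))
   ((x / sin x)^-1 * (x * (- (sin x) ^- 2 * cos x) + (sin x)^-1 * 1)).
  exact: (@is_derive1_comp _ (@ln R) (fun t : R => t / sin t)).
have d1 : is_derive x 1 (cst (1:R)) 0 by exact: is_derive_cst.
have dB := @is_deriveB _ _ _ _ _ _ _ _ _ d1 dxc.
have dD := @is_deriveD _ _ _ _ _ _ _ _ _ dB dln.
apply: (@near_eq_is_derive _ _ _ ((cst 1 - (fun t : R => t * (cos t / sin t)))
   + (fun t : R => ln (t / sin t)))).
  near=> t; rewrite phaseE//; near: t.
  exact: lt_nbhsr.
apply: is_derive_eq dD _.
rewrite /phase'; move: (cos x) (sin x) s0 sx => c s s0 sx.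
by field; rewrite sx gt_eqF.
Unshelve. all: by end_near. Qed.

Lemma sin_le_id x : 0 <= x -> sin x <= x.
Proof.
rewrite le_eqVlt => /predU1P[<-|x0]; first by rewrite sin0.
have cs : {within `[0, x], continuous (@sin R)}.
  by apply: continuous_subspaceT; exact: continuous_sin.
have [c _] := MVT x0 (fun y _ => is_derive_sin y) cs.
rewrite sin0 !subr0 => ->; rewrite ler_piMl ?(ltW x0)//; exact: cos_le1.
Qed.

Lemma cos_mul_le_sin x : 0 <= x -> x <= pi -> x * cos x <= sin x.
Proof.
move=> x0 xp; pose f (t : R) := sin t - t * cos t.
have df (t : R) : is_derive t 1 f (t * sin t).
  have d2 := @is_deriveM _ _ (@id R) (@cos R) t 1 1 (- sin t) (is_derive_id _ _) (is_derive_cos t).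
  have := @is_deriveB _ _ _ _ _ _ _ _ _ (is_derive_sin t) d2.
  move=> h; apply: is_derive_eq h _; rewrite /GRing.scale/=; ring.
have [x00|x00] := eqVneq x 0; first by rewrite x00 mul0r sin0.
have {}x0 : 0 < x by rewrite lt_neqAle eq_sym x00.
have cf : {within `[0, x], continuous f}.
  by apply: derivable_within_continuous => t _; have [] := df t.
have [c] := MVT x0 (fun y _ => df y) cf.
rewrite in_itv/= => /andP[c0 cx].
rewrite /f sin0 mul0r !subr0 => h; rewrite -subr_ge0 h.
rewrite mulr_ge0 ?(ltW x0)// mulr_ge0 ?(ltW c0)//.
by apply: sin_ge0_pi; rewrite (ltW c0) (le_trans (ltW cx)).
Qed.

(** By [x cos x <= sin x <= x], the quotient [x / sin x] lies between 1 and [1 / cos x], and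
    [x cot x] between [cos x] and 1. This gives continuity at 0, where the formula degenerates. *)
Lemma phase_near0 x : 0 < x < pi / 2 -> 0 <= phase x <= 1 - cos x - ln (cos x).
Proof.
move=> /andP[x0 xp]; have pp := @pi_gt0 R.
have xpi : x < pi by lra.
have s0 : 0 < sin x by apply: sin_gt0_pi; rewrite x0.
have c0 : 0 < cos x by apply: cos_gt0_pihalf; apply/andP; split; lra.
have h1 := sin_le_id (ltW x0); have h2 := cos_mul_le_sin (ltW x0) (ltW xpi).
rewrite phaseE//; have l1 : 1 <= x / sin x by rewrite ler_pdivlMr// mul1r.
have l2 : x / sin x <= (cos x)^-1 by rewrite ler_pdivrMr// mulrC ler_pdivlMr.
have e : x * (cos x / sin x) = cos x * (x / sin x) by ring.
have l3 : x * (cos x / sin x) <= 1 by rewrite mulrA ler_pdivrMr// mul1r.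
have l4 : cos x <= x * (cos x / sin x) by rewrite e ler_peMr// ltW.
have l5 : ln (x / sin x) <= - ln (cos x).
  by rewrite -lnV ?posrE// ler_ln ?posrE ?invr_gt0// divr_gt0.
by have := ln_ge0 l1; move=> ?; apply/andP; split; lra.
Qed.

Lemma phase_continuous0 e : 0 < e -> exists2 d, 0 < d & forall x, 0 <= x < d -> `|phase x| <= e.
Proof.
move=> e0.
have : (1 - cos x - ln (cos x)) @[x --> (0:R)] --> 1 - cos 0 - ln (cos (0:R)).
  apply: cvgB; first by apply: cvgB; [exact: cvg_cst|exact: continuous_cos].
  apply: (@continuous_comp _ _ _ (@cos R) (@ln R)); first exact: continuous_cos.
  by apply: continuous_ln; rewrite cos0.
rewrite cos0 ln1 subr0 subrr => /cvgrPdist_le/(_ _ e0)[d/= d0 dP].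
exists (Num.min d (pi / 2)); first by rewrite lt_min d0 divr_gt0// pi_gt0.
move=> x; rewrite lt_min => /andP[x0 /andP[xd xp]].
have [->|x00] := eqVneq x 0; first by rewrite phase0 normr0 ltW.
have {}x0 : 0 < x by rewrite lt_neqAle eq_sym x00.
have /andP[h1 h2] := @phase_near0 x (introT andP (conj x0 xp)).
rewrite ger0_norm// (le_trans h2)//; have := dP x.
rewrite /= !sub0r !normrN gtr0_norm// => /(_ xd); exact: le_trans (ler_norm _).
Qed.

Lemma phase_cvg x e : 0 <= x < pi -> 0 < e -> exists2 d, 0 < d &
  forall y, 0 <= y -> `|x - y| < d -> `|phase x - phase y| <= e.
Proof.
move=> /andP[x0 xpi] e0; have [->|x00] := eqVneq x 0.
  have [d d0 dP] := phase_continuous0 e0; exists d => // y y0.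
  rewrite sub0r normrN ger0_norm// phase0 sub0r normrN => yd.
  by apply: dP; rewrite y0.
have {}x0 : 0 < x by rewrite lt_neqAle eq_sym x00.
have [dx _] := @is_derive_phase x (introT andP (conj x0 xpi)).
have : {for x, continuous phase} by exact/differentiable_continuous/derivable1_diffP.
by move=> /cvgrPdist_le/(_ _ e0)[d/= d0 dP]; exists d => // y _; exact: dP.
Qed.

Lemma phase_within a x : 0 <= a -> x < pi -> {within `[a, x], continuous phase}.
Proof.
move=> a0 xpi; have [ax|xa] := leP a x; last first.
  by rewrite set_itv_ge ?bnd_simp -?ltNge//; exact: continuous_subspace0.
have [->|ane] := eqVneq a x; first by rewrite set_itv1; exact: continuous_subspace1.
have {}ax : a < x by rewrite lt_neqAle ane.
apply/continuous_within_itvP => //; split.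
- move=> t; rewrite in_itv/= => /andP[ta tx].
  have [dx _] := @is_derive_phase t (introT andP (conj (le_lt_trans a0 ta) (lt_trans tx xpi))).
  exact/differentiable_continuous/derivable1_diffP.
- apply/cvgrPdist_le => e e0.
  have [d d0 dP] := @phase_cvg a e (introT andP (conj a0 (lt_trans ax xpi))) e0.
  near=> t; apply: dP.
    by rewrite (le_trans a0)//; near: t; exact: nbhs_right_ge.
  rewrite ler0_norm; last by rewrite subr_le0; near: t; exact: nbhs_right_ge.
  by rewrite opprB ltrBlDl; near: t; apply: nbhs_right_lt; rewrite ltrDl.
- apply/cvgrPdist_le => e e0.
  have [d d0 dP] := @phase_cvg x e (introT andP (conj (le_trans a0 (ltW ax)) xpi)) e0.
  near=> t; apply: dP.
    by rewrite (le_trans a0)//; near: t; exact: nbhs_left_ge.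
  rewrite ger0_norm; last by rewrite subr_ge0; near: t; exact: nbhs_left_le.
  by rewrite ltrBlDl -ltrBlDr; near: t; apply: nbhs_left_gt; rewrite ltrBlDl ltrDr.
Unshelve. all: by end_near. Qed.

(** The function [phase t - t ^+ 2 / 2] is nondecreasing, and [x ^+ 2 - y ^+ 2 >= (x - y) ^+ 2]. The
    bound makes the inverse of [phase] Hoelder of exponent 1/2. *)
Lemma phase_diff_ge x y : 0 <= y <= x -> x < pi -> (x - y) ^+ 2 / 2 <= phase x - phase y.
Proof.
move=> /andP[y0]; rewrite le_eqVlt => /predU1P[->|yx] xpi.
  by rewrite !subrr expr0n mul0r.
pose f (t : R) := phase t - t ^+ 2 / 2.
have df (t : R) : t \in `]y, x[%R -> is_derive t 1 f (phase' t - t).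
  rewrite in_itv/= => /andP[yt tx].
  have dt := @is_derive_phase t (introT andP (conj (le_lt_trans y0 yt) (lt_trans tx xpi))).
  have d2 : is_derive t 1 (fun t : R => t ^+ 2 / 2) t.
    have h := @is_deriveM _ _ (fun t : R => t ^+ 2) (cst 2^-1) t 1 _ _
      (@is_deriveX _ _ (@id R) 2 t 1 1 (is_derive_id _ _)) (is_derive_cst _ _ _).
    by apply: is_derive_eq h _; rewrite /GRing.scale/=; field.
  exact: (@is_deriveB _ _ _ _ _ _ _ _ _ dt d2).
have cf : {within `[y, x], continuous f}.
  have c1 := @phase_within y x y0 xpi.
  move=> t; apply: cvgB; first exact: c1.
  apply: cvgMl; apply: (@continuous_subspaceT _ _ _ (fun t : R => t ^+ 2)) => z.
  exact: exprn_continuous.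
have [c] := MVT yx df cf; rewrite in_itv/= => /andP[yc cx] fE.
have c0 : 0 < c by exact: le_lt_trans yc.
have : 0 <= f x - f y.
  by rewrite fE mulr_ge0// subr_ge0 ?(ltW yx)//; exact: phase'_ge.
rewrite /f => h; have : 0 <= y * (x - y) by rewrite mulr_ge0// subr_ge0 ltW.
by rewrite expr2 in h *; nra.
Qed.

Lemma phase_le x y : 0 <= y <= x -> x < pi -> phase y <= phase x.
Proof.
move=> xy xpi; rewrite -subr_ge0; apply: le_trans (phase_diff_ge xy xpi).
by rewrite divr_ge0// sqr_ge0.
Qed.

Lemma phase_lt x y : 0 <= y < x -> x < pi -> phase y < phase x.
Proof.
move=> /andP[y0 yx] xpi; rewrite -subr_gt0.
apply: lt_le_trans (phase_diff_ge _ xpi); last by rewrite y0 ltW.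
by rewrite divr_gt0// exprn_gt0// subr_gt0.
Qed.

Lemma phase_ge0 x : 0 <= x < pi -> 0 <= phase x.
Proof. by move=> /andP[x0 xpi]; rewrite -phase0 phase_le// lexx. Qed.

Lemma phase_surj s : 0 <= s -> exists2 x, 0 <= x < pi & phase x = s.
Proof.
(* At [z = pi - y] the term [- z cot z] is nonnegative, [z >= 1], and [sin z = sin y <= exp (- s)],
   so the logarithm in [phase z] is at least [s]. *)
move=> s0; pose y : R := Num.min (pi / 2) (expR (- s)).
have pp := @pi_gt0 R; have p2 := @pi_ge2 R.
have y0 : 0 < y by rewrite lt_min divr_gt0// expR_gt0.
have yp : y <= pi / 2 by rewrite ge_min lexx.
have ye : y <= expR (- s) by rewrite ge_min lexx orbT.
pose z := pi - y; have z0 : 0 < z by rewrite /z; lra.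
have zpi : z < pi by rewrite /z; lra.
have sz : sin z = sin y by rewrite /z sinB sinpi cospi; ring.
have cz : cos z = - cos y by rewrite /z cosB sinpi cospi; ring.
have sy : 0 < sin y by apply: sin_gt0_pi; apply/andP; split; lra.
have cy : 0 <= cos y by apply: cos_ge0_pihalf; apply/andP; split; lra.
have big : s <= phase z.
  rewrite phaseE// sz cz.
  have h1 : 0 <= z * (cos y / sin y) by rewrite mulr_ge0 ?(ltW z0)// divr_ge0 ?(ltW sy).
  have h2 : s <= ln (z / sin y).
    rewrite -[s]expRK ler_ln ?posrE ?expR_gt0 ?divr_gt0//.
    rewrite ler_pdivlMr// -[leRHS]mul1r.
    apply: (@le_trans _ _ (expR s * expR (- s))).
      by rewrite ler_pM2l ?expR_gt0// (le_trans (sin_le_id (ltW y0))).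
    by rewrite -expRD subrr expR0 mul1r /z; lra.
  by rewrite mulNr mulrN opprK; lra.
have [|x] := IVT (ltW z0) (@phase_within 0 z (lexx 0) zpi) (v := s).
  by rewrite phase0 ge_min le_max s0 big orbT.
rewrite in_itv/= => /andP[x0 xz] <-; exists x => //.
by rewrite x0 (le_lt_trans xz).
Qed.

(** Up to [pi / 2] the numerator is at most [(y sin^2 y)^2], because [1 - cos y <= sin^2 y] there,
    and [phase' y <= 2 y]. Beyond, [sin y >= sin x], [y >= 1], and the numerator is at most
    [(1 + pi) ^+ 2]. *)
Lemma phase'_bound x : 0 < x < pi -> exists2 C, 0 < C &
  forall y, 0 < y <= x -> phase' y <= C.
Proof.
move=> /andP[x0 xpi]; have pp := @pi_gt0 R; have p2 := @pi_ge2 R.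
have sx : 0 < sin x by apply: sin_gt0_pi; rewrite x0.
pose C : R := (1 + pi) ^+ 2 / sin x ^+ 2 + 2 * pi.
have C0 : 0 < C.
  by apply: addr_gt0; [apply: divr_gt0; apply: exprn_gt0; lra|lra].
exists C => // y /andP[y0 yx]; rewrite /phase'.
have ypi : y < pi by exact: le_lt_trans xpi.
have sy : 0 < sin y by apply: sin_gt0_pi; rewrite y0.
have h1 := sin_le_id (ltW y0); have h2 := cos_mul_le_sin (ltW y0) (ltW ypi).
have cs := cos2Dsin2 y; have c1 := cos_le1 y; have c2 := cos_geN1 y; have s1 := sin_le1 y.
have [yp|py] := leP y (pi / 2).
  have cy : 0 <= cos y by apply: cos_ge0_pihalf; apply/andP; split; lra.
  have h3 : sin y - y * cos y <= y * sin y ^+ 2.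
    have : y * (1 - cos y) <= y * sin y ^+ 2.
      by rewrite ler_pM2l//; nra.
    lra.
  have h4 : (sin y - y * cos y) ^+ 2 <= (y * sin y ^+ 2) ^+ 2.
    by rewrite ler_pXn2r// nnegrE ?subr_ge0// mulr_ge0 ?sqr_ge0// ltW.
  have h5 : (sin y - y * cos y) ^+ 2 / (y * sin y ^+ 2) <= y.
    rewrite ler_pdivrMr ?mulr_gt0 ?exprn_gt0//; apply: (le_trans h4).
    rewrite exprMn expr2 -mulrA ler_pM2l// ler_pM2l// [leLHS]expr2 ler_piMl ?sqr_ge0//.
  have : 0 < (1 + pi) ^+ 2 / sin x ^+ 2 by rewrite divr_gt0 ?exprn_gt0//; lra.
  rewrite /C; lra.
have sxy : sin x <= sin y.
  rewrite -(cosBpihalf x) -(cosBpihalf y) leNgt ltr_cos ?in_itv/= -?leNgt; lra.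
have h6 : (sin y - y * cos y) ^+ 2 <= (1 + pi) ^+ 2.
  by rewrite ler_pXn2r// ?nnegrE ?subr_ge0//; nra.
have h7 : (sin y - y * cos y) ^+ 2 / (y * sin y ^+ 2) <= (1 + pi) ^+ 2 / sin x ^+ 2.
  have yi : 0 < y * sin y ^+ 2 by rewrite mulr_gt0// exprn_gt0.
  apply: ler_pM => //; [exact: sqr_ge0|by rewrite invr_ge0 ltW|].
  rewrite lef_pV2 ?posrE ?exprn_gt0//.
  have e1 : sin x ^+ 2 <= sin y ^+ 2 by rewrite ler_pXn2r// nnegrE ltW.
  apply: (le_trans e1); rewrite ler_peMl ?sqr_ge0//; lra.
rewrite /C; lra.
Qed.

Lemma phase_diff_le x C y z : 0 < x < pi -> (forall y, 0 < y <= x -> phase' y <= C) ->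
  0 <= y <= z -> z <= x -> phase z - phase y <= C * (z - y).
Proof.
move=> /andP[x0 xpi] hC /andP[y0]; rewrite le_eqVlt => /predU1P[->|yz] zx.
  by rewrite !subrr mulr0.
have zpi : z < pi by exact: le_lt_trans xpi.
have df (t : R) : t \in `]y, z[%R -> is_derive t 1 phase (phase' t).
  rewrite in_itv/= => /andP[yt tx]; apply: is_derive_phase.
  by rewrite (le_lt_trans y0 yt) (lt_trans tx zpi).
have [c] := MVT yz df (@phase_within y z y0 zpi); rewrite in_itv/= => /andP[yc cz] ->.
rewrite ler_wpM2r ?subr_ge0 ?(ltW yz)//; apply: hC.
by rewrite (le_lt_trans y0 yc) (le_trans (ltW cz)).
Qed.

End Phase.

Section Branches.
Context {R : realType}.
Implicit Types (w v s t : R).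

(** Taking logarithms in [w exp (- w) = exp (- 1 - s)] gives [entropy w = s]. The minimum 0 at
    [w = 1] is the point where the two real branches meet. *)
Definition entropy w : R := w - 1 - ln w.

(* The negated real Lambert branches: [lam0 s = - W_0 (- e^(-1-s))] and
   [lam1 s = - W_(-1) (- e^(-1-s))].  For [s < 0] both equations are unsolvable and
   [xget] returns [1], so that [gap] vanishes there. *)
Definition lam0 s : R := xget 1 [set w | 0 < w <= 1 /\ entropy w = s].
Definition lam1 s : R := xget 1 [set w | 1 <= w /\ entropy w = s].
Definition gap s : R := lam1 s - lam0 s.

(** From [ln w = 2 ln (sqrt w) <= 2 (sqrt w - 1)]. Quadratic growth at the minimum is the source of
    the exponent 1/2 for the branches. *)
Lemma entropy_ge w : 0 < w -> (Num.sqrt w - 1) ^+ 2 <= entropy w.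
Proof.
move=> w0; have s0 : 0 < Num.sqrt w by rewrite sqrtr_gt0.
have e : Num.sqrt w ^+ 2 = w by rewrite sqr_sqrtr// ltW.
have l : ln w <= 2 * (Num.sqrt w - 1).
  rewrite -[in leLHS]e lnXn// mulr_natl ler_pMn2r//.
  have E : 1 + (Num.sqrt w - 1) = Num.sqrt w by ring.
  by have := @le_ln1Dx _ (Num.sqrt w - 1); rewrite E; apply; lra.
by rewrite /entropy sqrrB1 e; lra.
Qed.

Lemma entropy_ge0 w : 0 < w -> 0 <= entropy w.
Proof. by move=> w0; apply: le_trans (entropy_ge w0); exact: sqr_ge0. Qed.

Lemma entropy_diff w v : 0 < w -> 0 < v ->
  entropy w - entropy v = (w - v) - ln (w / v).
Proof. by move=> w0 v0; rewrite /entropy ln_div//; ring. Qed.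

(** Since [v >= 1], [w - v >= w / v - 1], so the difference dominates [entropy (w / v)]. The
    companion below argues in the same way under 1. *)
Lemma entropy_diff_up w v : 1 <= v -> v <= w ->
  (Num.sqrt (w / v) - 1) ^+ 2 <= entropy w - entropy v.
Proof.
move=> v1 vw; have v0 : 0 < v by lra.
have w0 : 0 < w by lra.
rewrite entropy_diff//; apply: le_trans (entropy_ge (divr_gt0 w0 v0)) _.
rewrite /entropy lerD2r lerBlDr ler_pdivrMr//.
by have : 0 <= (w - v) * (v - 1) by [rewrite mulr_ge0 ?subr_ge0]; lra.
Qed.

Lemma entropy_diff_down w v : w <= 1 -> 0 < v -> v <= w ->
  (Num.sqrt (v / w) - 1) ^+ 2 <= entropy v - entropy w.
Proof.
move=> w1 v0 vw; have w0 : 0 < w by lra.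
rewrite entropy_diff//; apply: le_trans (entropy_ge (divr_gt0 v0 w0)) _.
rewrite /entropy lerD2r lerBlDr ler_pdivrMr//.
by have : 0 <= (w - v) * (1 - w) by [rewrite mulr_ge0 ?subr_ge0]; lra.
Qed.

Lemma continuous_entropy w : 0 < w -> {for w, continuous entropy}.
Proof.
move=> w0; apply: cvgB; last exact: continuous_ln.
by apply: cvgB; [exact: cvg_id|exact: cvg_cst].
Qed.

Lemma entropy_within v w : 0 < v -> {within `[v, w], continuous entropy}.
Proof.
move=> v0; apply: continuous_in_subspaceT => x; rewrite inE/= in_itv/= => /andP[vx _].
by apply: continuous_entropy; exact: lt_le_trans vx.
Qed.

Lemma entropy1 : entropy 1 = 0. Proof. by rewrite /entropy ln1; ring. Qed.

Lemma lam1P s : 0 <= s -> 1 <= lam1 s /\ entropy (lam1 s) = s.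
Proof.
move=> s0; rewrite /lam1.
apply: (@xgetPex _ (1:R) [set w | 1 <= w /\ entropy w = s]).
have s0' := sqrtr_ge0 s.
pose w := (1 + Num.sqrt s) ^+ 2.
have w1 : 1 <= w by rewrite /w expr_ge1//; lra.
have wE : s <= entropy w.
  apply: le_trans (entropy_ge _); last by lra.
  by rewrite /w sqrtr_sqr ger0_norm; [rewrite addrAC subrr add0r sqr_sqrtr|lra].
have [|x] := IVT w1 (@entropy_within 1 w ltr01) (v := s).
  by rewrite entropy1 ge_min le_max s0 wE orbT.
by rewrite in_itv/= => /andP[x1 _] <-; exists x.
Qed.

Lemma lam0P s : 0 <= s -> [/\ 0 < lam0 s, lam0 s <= 1 & entropy (lam0 s) = s].
Proof.
move=> s0; suff : 0 < lam0 s <= 1 /\ entropy (lam0 s) = s by case=> /andP[].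
rewrite /lam0.
apply: (@xgetPex _ (1:R) [set w | 0 < w <= 1 /\ entropy w = s]).
pose w := expR (- s - 1).
have w0 : 0 < w by exact: expR_gt0.
have w1 : w <= 1 by rewrite /w -[leRHS]expR0 ler_expR; lra.
have wE : s <= entropy w by rewrite /entropy /w expRK -/w; lra.
have [|x] := IVT w1 (@entropy_within w 1 w0) (v := s).
  by rewrite entropy1 ge_min le_max s0 wE orbT.
rewrite in_itv/= => /andP[x1 x2] <-; exists x; split => //.
by rewrite x2 (lt_le_trans w0).
Qed.

Lemma entropy_inj_up w v : 1 <= w -> 1 <= v -> entropy w = entropy v -> w = v.
Proof.
wlog vw : w v / v <= w => [h w1 v1 e|w1 v1 e].
  by have [vw|/ltW wv] := leP v w; [exact: h|apply/esym/h].
have v0 : 0 < v by lra.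
have := entropy_diff_up v1 vw; rewrite e subrr => h.
have : (Num.sqrt (w / v) - 1) ^+ 2 == 0 by rewrite eq_le h sqr_ge0.
rewrite sqrf_eq0 subr_eq0 => /eqP h1.
have : w / v = 1 by rewrite -[LHS]sqr_sqrtr ?h1 ?expr1n// divr_ge0// ltW//; lra.
by move=> /(congr1 (fun x => x * v)); rewrite divfK ?mul1r// gt_eqF.
Qed.

Lemma entropy_inj_down w v : 0 < w <= 1 -> 0 < v <= 1 -> entropy w = entropy v -> w = v.
Proof.
wlog vw : w v / v <= w => [h w1 v1 e|/andP[w0 w1] /andP[v0 v1] e].
  by have [vw|/ltW wv] := leP v w; [exact: h|apply/esym/h].
have := entropy_diff_down w1 v0 vw; rewrite e subrr => h.
have : (Num.sqrt (v / w) - 1) ^+ 2 == 0 by rewrite eq_le h sqr_ge0.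
rewrite sqrf_eq0 subr_eq0 => /eqP h1.
have : v / w = 1 by rewrite -[LHS]sqr_sqrtr ?h1 ?expr1n// divr_ge0// ltW.
by move=> /(congr1 (fun x => x * w)); rewrite divfK ?mul1r ?gt_eqF.
Qed.

Lemma lam1_neg s : s < 0 -> lam1 s = 1.
Proof.
move=> s0; rewrite /lam1; case: xgetP => [w _ [w1 e]|//].
by have : 0 <= entropy w; [apply: entropy_ge0; lra|rewrite e leNgt s0].
Qed.

Lemma lam0_neg s : s < 0 -> lam0 s = 1.
Proof.
move=> s0; rewrite /lam0; case: xgetP => [w _ [/andP[w0 w1] e]|//].
by have := entropy_ge0 w0; rewrite e leNgt s0.
Qed.

Lemma lam1_0 : lam1 0 = 1.
Proof. by have [h1 h2] := lam1P (lexx 0); apply: entropy_inj_up => //; rewrite h2 entropy1. Qed.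

Lemma lam0_0 : lam0 0 = 1.
Proof.
have [h1 h2 h3] := lam0P (lexx 0); apply: entropy_inj_down; rewrite ?h1 ?h2 ?ltr01 ?lexx//.
by rewrite h3 entropy1.
Qed.

Lemma gap_npos s : s <= 0 -> gap s = 0.
Proof.
by rewrite le_eqVlt => /predU1P[->|s0]; rewrite /gap ?lam1_0 ?lam0_0 ?lam1_neg ?lam0_neg// subrr.
Qed.

Lemma lam1_le s t : 0 <= t -> t <= s -> lam1 t <= lam1 s.
Proof.
move=> t0 ts; have [h1 h2] := lam1P t0; have [h3 h4] := lam1P (le_trans t0 ts).
rewrite leNgt; apply/negP => h.
have := entropy_diff_up h3 (ltW h); rewrite h2 h4 => h5.
have := sqr_ge0 (Num.sqrt (lam1 t / lam1 s) - 1) => h6.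
have st : s = t by apply/eqP; rewrite eq_le ts andbT; lra.
by move: h; rewrite st ltxx.
Qed.

Lemma lam0_le s t : 0 <= t -> t <= s -> lam0 s <= lam0 t.
Proof.
move=> t0 ts; have [h0 h1 h2] := lam0P t0; have [h3 h4 h5] := lam0P (le_trans t0 ts).
rewrite leNgt; apply/negP => h.
have := entropy_diff_down h4 h0 (ltW h); rewrite h2 h5 => h6.
have := sqr_ge0 (Num.sqrt (lam0 t / lam0 s) - 1) => h7.
have st : s = t by apply/eqP; rewrite eq_le ts andbT; lra.
by move: h; rewrite st ltxx.
Qed.

Lemma gap_ge0 s : 0 <= gap s.
Proof.
have [s0|s0] := leP s 0; first by rewrite gap_npos.
have [h1 h2] := lam1P (ltW s0); have [h3 h4 _] := lam0P (ltW s0).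
by rewrite /gap; lra.
Qed.

Lemma gap_le s t : t <= s -> gap t <= gap s.
Proof.
move=> ts; have [t0|/ltW t0] := leP t 0; first by rewrite gap_npos// gap_ge0.
by rewrite /gap; have := lam1_le t0 ts; have := lam0_le t0 ts; lra.
Qed.

Lemma lam1_bound s : 0 <= s -> lam1 s <= (1 + Num.sqrt s) ^+ 2.
Proof.
move=> s0; have [h1 h2] := lam1P s0; have l0 : 0 < lam1 s by lra.
have := entropy_ge l0; rewrite h2 => h.
have s1 : 1 <= Num.sqrt (lam1 s) by rewrite -(@sqrtr1 R) ler_wsqrtr.
have : Num.sqrt ((Num.sqrt (lam1 s) - 1) ^+ 2) <= Num.sqrt s by rewrite ler_wsqrtr.
rewrite sqrtr_sqr ger0_norm ?subr_ge0// => h3.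
rewrite -[leLHS](sqr_sqrtr (ltW l0)) ler_pXn2r// ?nnegrE; last 1 first.
- by have := sqrtr_ge0 s; lra.
- by lra.
- by lra.
Qed.

(** With [w = v p^2], the previous bounds give [p - 1 <= sqrt (s - t)], and
    [w - v = v (p - 1) (p + 1)] with [p + 1 <= 2 p^2]. *)
Lemma lam1_holder s t : 0 <= t -> t <= s ->
  lam1 s - lam1 t <= 2 * lam1 s * Num.sqrt (s - t).
Proof.
move=> t0 ts; have [v1 ve] := lam1P t0; have [w1 we] := lam1P (le_trans t0 ts).
have vw := lam1_le t0 ts; have := entropy_diff_up v1 vw; rewrite ve we.
move: (lam1 s) (lam1 t) v1 w1 vw {ve we} => w v v1 w1 vw h.
have v0 : 0 < v by lra.
pose p := Num.sqrt (w / v).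
have p2 : p ^+ 2 = w / v by rewrite sqr_sqrtr// divr_ge0; lra.
have p1 : 1 <= p by rewrite -(@sqrtr1 R) ler_wsqrtr// ler_pdivlMr// mul1r.
have h1 : p - 1 <= Num.sqrt (s - t).
  by rewrite -[p - 1]ger0_norm ?subr_ge0// -sqrtr_sqr ler_wsqrtr.
have wE : w = v * p ^+ 2 by rewrite p2 mulrC divfK// gt_eqF.
have e : w - v = v * (p - 1) * (p + 1) by rewrite wE; ring.
rewrite e wE; have : 0 <= v * (p + 1) * (Num.sqrt (s - t) - (p - 1)).
  by rewrite !mulr_ge0 ?subr_ge0//; lra.
have : 0 <= v * Num.sqrt (s - t) * ((p - 1) * (2 * p + 1)).
  by rewrite !mulr_ge0 ?subr_ge0 ?sqrtr_ge0//; lra.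
by rewrite expr2; lra.
Qed.

Lemma lam0_holder s t : 0 <= t -> t <= s ->
  lam0 t - lam0 s <= 2 * Num.sqrt (s - t).
Proof.
move=> t0 ts; have [w0 w1 we] := lam0P t0; have [v0 v1 ve] := lam0P (le_trans t0 ts).
have vw := lam0_le t0 ts; have := entropy_diff_down w1 v0 vw; rewrite ve we.
move: (lam0 s) (lam0 t) v0 v1 w0 w1 vw {ve we} => v w v0 v1 w0 w1 vw h.
pose p := Num.sqrt (v / w).
have p2 : p ^+ 2 = v / w by rewrite sqr_sqrtr// divr_ge0; lra.
have p0 : 0 <= p by exact: sqrtr_ge0.
have p1 : p <= 1 by rewrite -(@sqrtr1 R) ler_wsqrtr// ler_pdivrMr// mul1r.
have h1 : 1 - p <= Num.sqrt (s - t).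
  by rewrite -[1 - p]ger0_norm ?subr_ge0// -sqrtr_sqr ler_wsqrtr// -sqrrN opprB.
have vE : v = w * p ^+ 2 by rewrite p2 mulrC divfK// gt_eqF.
have e : w - v = w * ((1 - p) * (p + 1)) by rewrite vE; ring.
rewrite e; have h2 : 0 <= (1 - w) * ((1 - p) * (p + 1)) by rewrite !mulr_ge0 ?subr_ge0//; lra.
have h3 : 0 <= (1 - p) * (1 - p) by rewrite mulr_ge0// subr_ge0.
by lra.
Qed.

(** The constant depends on [S] because [lam1] is unbounded; it is controlled by
    [(1 + sqrt S) ^+ 2]. A negative [t] is replaced by 0, where [gap] also vanishes. *)
Lemma gap_holder s t S : 0 <= S -> s <= S -> t <= s ->
  gap s - gap t <= (2 * (1 + Num.sqrt S) ^+ 2 + 2) * Num.sqrt (s - t).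
Proof.
move=> S0 sS ts; have q0 := sqrtr_ge0 S; have q1 := sqrtr_ge0 (s - t).
have c0 : 0 <= 2 * (1 + Num.sqrt S) ^+ 2 + 2 by have := sqr_ge0 (1 + Num.sqrt S); lra.
have [s0|/ltW s0] := leP s 0.
  by rewrite !gap_npos ?(le_trans ts)// subrr mulr_ge0.
wlog t0 : t ts q1 / 0 <= t.
  move=> hw; have [t0|t0] := leP 0 t; first exact: hw.
  have := hw 0 s0 (sqrtr_ge0 _) (lexx _); rewrite !(gap_npos (lexx 0)) (gap_npos (ltW t0)).
  move=> h; apply: (le_trans h); rewrite ler_wpM2l// ler_wsqrtr//; lra.
have h1 := lam1_holder t0 ts; have h2 := lam0_holder t0 ts.
have h3 := lam1_bound s0.
have h4 : (1 + Num.sqrt s) ^+ 2 <= (1 + Num.sqrt S) ^+ 2.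
  have := sqrtr_ge0 s => ?; have : Num.sqrt s <= Num.sqrt S by rewrite ler_wsqrtr.
  by move=> ?; rewrite ler_pXn2r// ?nnegrE; lra.
have : 0 <= ((1 + Num.sqrt S) ^+ 2 - lam1 s) * Num.sqrt (s - t).
  by rewrite mulr_ge0// subr_ge0 (le_trans h3).
by rewrite /gap; lra.
Qed.

(** The derivative of [gap] at positive [s], each term being [1 / (1 - 1 / w)] up to sign by the
    inverse function rule. For [s <= 0] both branches are 1 and the value is 0 by convention. *)
Definition gap' s : R := lam1 s / (lam1 s - 1) + lam0 s / (1 - lam0 s).

Lemma lam_neq1 s : 0 < s -> 1 < lam1 s /\ 0 < lam0 s < 1.
Proof.
move=> s0; have [h1 h2] := lam1P (ltW s0); have [h3 h4 h5] := lam0P (ltW s0).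
split; rewrite ?h3/= lt_neqAle ?h1 ?h4 andbT; apply/eqP => e.
  by move: s0; rewrite -h2 -e entropy1 ltxx.
by move: s0; rewrite -h5 e entropy1 ltxx.
Qed.

Lemma gap'_ge0 s : 0 <= gap' s.
Proof.
have [s0|s0] := ltP 0 s.
  have [h1 /andP[h2 h3]] := lam_neq1 s0.
  by rewrite addr_ge0// divr_ge0//; lra.
have [->|sn] := eqVneq s 0; first by rewrite /gap' lam1_0 lam0_0 !subrr invr0 !mulr0 addr0.
have {}s0 : s < 0 by rewrite lt_neqAle sn.
by rewrite /gap' lam1_neg// lam0_neg// !subrr invr0 !mulr0 addr0.
Qed.

Lemma is_derive_entropy w : 0 < w -> is_derive w 1 entropy (1 - w^-1).
Proof.
move=> w0; have d1 : is_derive w 1 ((@id R) - cst (1:R)) (1 - 0).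
  by apply: is_deriveB.
have d := @is_deriveB _ _ _ _ _ _ _ _ _ d1 (is_derive1_ln w0).
by apply: is_derive_eq d _; ring.
Qed.

Lemma is_derive_lam1 s : 0 < s -> is_derive s 1 lam1 (lam1 s / (lam1 s - 1)).
Proof.
move=> s0; have [w1 _] := lam_neq1 s0; have [_ we] := lam1P (ltW s0).
set w := lam1 s in w1 we *; have w0 : 0 < w by lra.
have -> : w / (w - 1) = (1 - w^-1)^-1.
  by field; rewrite !gt_eqF// ?subr_gt0// invf_lt1.
rewrite -we; apply: is_derive_inverse.
- near=> v; have v1 : 1 <= v by apply: ltW; near: v; exact: lt_nbhsr.
  have v0 : 0 < v by lra.
  have [h1 h2] := lam1P (entropy_ge0 v0).
  exact: entropy_inj_up.
- near=> v; apply: continuous_entropy; near: v; exact: lt_nbhsr.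
- exact: is_derive_entropy.
- by rewrite subr_eq0 eq_sym invr_eq1 gt_eqF.
Unshelve. all: by end_near. Qed.

Lemma is_derive_lam0 s : 0 < s -> is_derive s 1 lam0 (- (lam0 s / (1 - lam0 s))).
Proof.
move=> s0; have [_ /andP[w0 w1]] := lam_neq1 s0; have [_ _ we] := lam0P (ltW s0).
set w := lam0 s in w0 w1 we *.
have -> : - (w / (1 - w)) = (1 - w^-1)^-1.
  by field; rewrite ?(gt_eqF w0) ?subr_eq0 ?(gt_eqF w1) ?(lt_eqF w1).
rewrite -we; apply: is_derive_inverse.
- near=> v; have v0 : 0 < v by near: v; exact: lt_nbhsr.
  have v1 : v <= 1 by apply: ltW; near: v; exact: lt_nbhsl.
  have [h1 h2 h3] := lam0P (entropy_ge0 v0).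
  by apply: entropy_inj_down => //; rewrite ?h1 ?h2 ?v0.
- near=> v; apply: continuous_entropy; near: v; exact: lt_nbhsr.
- exact: is_derive_entropy.
- by rewrite subr_eq0 eq_sym invr_eq1 lt_eqF.
Unshelve. all: by end_near. Qed.

Lemma is_derive_gap s : 0 < s -> is_derive s 1 gap (gap' s).
Proof.
move=> s0; have d := @is_deriveB _ _ _ _ _ _ _ _ _ (is_derive_lam1 s0) (is_derive_lam0 s0).
by apply: is_derive_eq d _; rewrite opprK.
Qed.

Lemma continuous_gap : continuous gap.
Proof.
move=> s; apply/cvgrPdist_le => e e0.
pose S := `|s| + 1; have S0 : 0 <= S by rewrite addr_ge0.
pose C := 2 * (1 + Num.sqrt S) ^+ 2 + 2.
have C0 : 0 < C by have := sqr_ge0 (1 + Num.sqrt S); rewrite /C; lra.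
near=> t.
have h (a c : R) : a <= S -> c <= a -> a - c <= (e / C) ^+ 2 -> `|gap a - gap c| <= e.
  move=> aS ca ac; rewrite ger0_norm ?subr_ge0 ?gap_le//.
  apply: le_trans (gap_holder S0 aS ca) _; rewrite -/C mulrC -ler_pdivlMr//.
  rewrite -[leRHS]ger0_norm; last by rewrite divr_ge0// ltW.
  by rewrite -sqrtr_sqr ler_wsqrtr.
have sS : s <= S by rewrite /S; have := ler_norm s; lra.
have d : `|s - t| <= (e / C) ^+ 2.
  near: t; apply: cvgr_dist_le; [exact: cvg_id|by rewrite exprn_gt0// divr_gt0].
have tS : t <= S.
  have : `|s - t| <= 1 by near: t; apply: cvgr_dist_le; [exact: cvg_id|].
  by rewrite /S ler_norml => /andP[? ?]; have := ler_norm s; lra.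
move: d; rewrite ler_norml => /andP[d1 d2].
have [st|/ltW ts] := leP s t; first by rewrite distrC; apply: h => //; lra.
by apply: h => //; lra.
Unshelve. all: by end_near. Qed.

End Branches.

(** * An improper fundamental theorem, and interpolation against a moment *)

(** Meant for derivatives that blow up at an endpoint, as [gap'] does at level 0. The open interval
    is exhausted by compact ones; monotone convergence handles the integrals and continuity of [F]
    the boundary values. *)
Lemma ge0_FTC_oo (R : realType) (f F : R -> R) (a c : R) : a < c ->
  {within `[a, c], continuous F} ->
  (forall x, a < x < c -> is_derive x 1 F (f x)) ->
  (forall x, a < x < c -> {for x, continuous f}) ->
  (forall x, a < x < c -> 0 <= f x) ->
  (\int[@lebesgue_measure R]_(x in `]a, c[) (f x)%:E = (F c - F a)%:E)%E.
Proof.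
move=> ac cF dF cf f0.
(* The shift by 3 gives [2 * w n < c - a], so that every interval of the exhaustion is
   nondegenerate. *)
pose w n : R := (c - a) / n.+3%:R.
have w0 n : 0 < w n by rewrite divr_gt0// subr_gt0.
have w2 n : 2 * w n < c - a.
  rewrite /w mulrA ltr_pdivrMr// mulrC ltr_pM2l ?subr_gt0// ltr_nat//.
have wS n m : (n <= m)%N -> w m <= w n.
  move=> nm; rewrite /w ler_pM2l ?subr_gt0// lef_pV2 ?posrE// ler_nat.
  by rewrite !ltnS.
pose I n : set R := `[a + w n, c - w n]%classic.
have IE n (x : R) : I n x = (a + w n <= x <= c - w n) by rewrite /I /= in_itv.
have Isub n (x : R) : I n x -> a < x < c.
  by rewrite IE => /andP[h1 h2]; have := w0 n => ?; apply/andP; split; lra.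
have bigI : \bigcup_n I n = `]a, c[%classic.
  apply/seteqP; split => x; first by move=> [n _ /Isub]; rewrite /= in_itv.
  rewrite /= in_itv/= => /andP[ax xc].
  pose e := Num.min (x - a) (c - x); have e0 : 0 < e by rewrite lt_min !subr_gt0 ax.
  exists (Num.truncn ((c - a) / e)) => //; rewrite IE.
  set n := Num.truncn _.
  have we : w n <= e.
    rewrite /w ler_pdivrMr// mulrC -ler_pdivrMr//; apply: ltW.
    by apply: (lt_le_trans (truncnS_gt _)); rewrite ler_nat -/n ltnS leqW.
  have e1 : e <= x - a by rewrite /e ge_min lexx.
  have e2 : e <= c - x by rewrite /e ge_min lexx orbT.
  by apply/andP; split; lra.
have mf : measurable_fun `]a, c[ f.
  apply: open_continuous_measurable_fun => // x; rewrite inE/= in_itv/=; exact: cf.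
have mono : nondecreasing_seq I.
  move=> n m nm; apply/subsetPset; apply: subset_itv; rewrite bnd_simp;
    by have := wS _ _ nm; lra.
have FI n : (\int[@lebesgue_measure R]_(x in I n) (f x)%:E = (F (c - w n) - F (a + w n))%:E)%E.
  have lt : a + w n < c - w n by have := w2 n; lra.
  rewrite (@continuous_FTC2 _ f F)//.
  - apply: continuous_in_subspaceT => x; rewrite inE => /Isub; exact: cf.
  - split.
    + move=> x xI; have xac : a < x < c by apply: (Isub n); apply: subset_itv_oo_cc xI.
      by have [] := dF x xac.
    + have h := Isub n (a + w n); rewrite IE lexx (ltW lt) in h.
      have [dd _] := dF _ (h isT); apply: cvg_at_right_filter.
      exact/differentiable_continuous/derivable1_diffP.
    + have h := Isub n (c - w n); rewrite IE lexx (ltW lt) in h.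
      have [dd _] := dF _ (h isT); apply: cvg_at_left_filter.
      exact/differentiable_continuous/derivable1_diffP.
  - move=> x xI; have xac : a < x < c by apply: (Isub n); apply: subset_itv_oo_cc xI.
    by have := dF x xac => dx; rewrite derive1E derive_val.
have lim1 : (\int[@lebesgue_measure R]_(x in I n) (f x)%:E)%E @[n --> \oo] -->
    (\int[@lebesgue_measure R]_(x in `]a, c[) (f x)%:E)%E.
  rewrite -bigI; apply: ge0_nondecreasing_set_cvg_integral => //.
  - by move=> n; exact: measurable_itv.
  - move=> n; apply/measurable_EFinP; apply: measurable_funS mf => //.
    by move=> x /Isub; rewrite /= in_itv.
  - by move=> n x /Isub xac; rewrite lee_fin f0.
have wsmall d : 0 < d -> \forall n \near \oo, w n < d.
  move=> d0; exists (Num.truncn ((c - a) / d)) => // n /= Nn.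
  rewrite /w ltr_pdivrMr// mulrC -ltr_pdivrMr//.
  by apply: (lt_le_trans (truncnS_gt _)); rewrite ler_nat ltnS (leq_trans Nn)// leqW.
have [_ Fa Fc] := (continuous_within_itvP F ac).1 cF.
have lim2 : (F (c - w n) - F (a + w n))%:E @[n --> \oo] --> (F c - F a)%:E.
  apply: cvg_EFin; first exact: nearW.
  apply: cvgB; apply/cvgrPdist_le => e e0.
    move/cvgrPdist_le/(_ _ e0): Fc => -[d/= d0 dP].
    have := wsmall d d0; apply: filterS => n wd; apply: dP => /=.
      by rewrite opprB addrC subrK gtr0_norm.
    by rewrite ltrBlDr ltrDl.
  move/cvgrPdist_le/(_ _ e0): Fa => -[d/= d0 dP].
  have := wsmall d d0; apply: filterS => n wd; apply: dP => /=.
    by rewrite opprD addrA subrr sub0r normrN gtr0_norm.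
  by rewrite ltrDl.
rewrite (_ : (fun n => _) = (fun n => (F (c - w n) - F (a + w n))%:E)) in lim1.
  exact: (cvg_unique (@ereal_hausdorff R) lim1 lim2).
exact/funext.
Qed.

(* For [|x| <= X] the weight is [X^-2], so that [A = A X^2 weight]; for [|x| > X]
   it is [x^-2] and AM-GM bounds [B sqrt u]. *)
Definition tail_weight (R : realType) (X x : R) : R := (Num.max X `|x|) ^- 2.

Lemma tail_weight_gt0 (R : realType) (X x : R) : 0 < X -> 0 < tail_weight X x.
Proof. by move=> X0; rewrite invr_gt0 exprn_gt0// lt_max X0. Qed.

Lemma continuous_tail_weight (R : realType) (X : R) : 0 < X -> continuous (tail_weight X).
Proof.
move=> X0 x; apply: cvgV; first by rewrite expf_neq0// gt_eqF// lt_max X0.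
apply: (@continuous_comp _ _ _ (fun x : R => Num.max X `|x|) (fun t : R => t ^+ 2)).
  apply: continuous_max; first exact: cvg_cst.
  exact: norm_continuous.
exact: exprn_continuous.
Qed.

Lemma integral_tail_weight (R : realType) (X : R) : 0 < X ->
  (\int[@lebesgue_measure R]_x (tail_weight X x)%:E = (4 / X)%:E)%E.
Proof.
move=> X0; have wge x : 0 <= tail_weight X x by exact/ltW/tail_weight_gt0.
have cw := continuous_tail_weight X0.
rewrite ge0_symfun_integralT//; last by move=> x /=; rewrite /tail_weight normrN.
have mw (D : set R) : measurable D -> measurable_fun D (EFin \o tail_weight X).
  move=> mD; apply/measurable_EFinP; apply: measurable_funTS.
  exact: continuous_measurable_fun.
have -> : [set x : R | 0 <= x] = `[0, X[ `|` `[X, +oo[.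
  apply/seteqP; split => x /=; rewrite !in_itv/=.
    by move=> x0; have [xX|Xx] := ltP x X; [left|right]; rewrite ?in_itv/= ?x0 ?xX ?Xx.
  by rewrite andbT => -[/andP[]//|Xx]; lra.
rewrite ge0_integral_setU//; last 3 first.
- by apply: mw; exact: measurableU.
- by move=> x _; rewrite lee_fin.
- by apply/disj_setPS => x /=; rewrite !in_itv/= andbT => -[/andP[_ h1] h2]; lra.
have -> : (\int[@lebesgue_measure R]_(x in `[0%R, X[) (tail_weight X x)%:E = (X^-1)%:E)%E.
  rewrite (eq_integral (fun _ => (X ^- 2)%:E)); last first.
    move=> x; rewrite inE/= in_itv/= => /andP[x0 xX]; congr EFin.
    by rewrite /tail_weight ger0_norm// (max_idPl (ltW xX)).
  rewrite integral_cst//= lebesgue_measure_itv/= lte_fin X0 oppr0 adde0 -EFinM.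
  by congr EFin; field; rewrite gt_eqF.
have -> : (\int[@lebesgue_measure R]_(x in `[X, +oo[) (tail_weight X x)%:E = (X^-1)%:E)%E.
  rewrite (@ge0_continuous_FTC2y _ (tail_weight X) (fun x => - x^-1) X 0).
  - by rewrite -EFinB sub0r opprK.
  - by move=> x _.
  - exact: continuous_subspaceT.
  - rewrite -oppr0; apply: cvgN; apply/(gtr0_cvgV0 (f := id)); last exact: cvg_id.
    exact: nbhs_pinfty_gt.
  - by move=> x Xx; apply: derivableN; apply: derivableV; rewrite ?gt_eqF// (lt_trans X0).
  - apply: cvg_at_right_filter; apply: cvgN; apply: cvgV; [by rewrite gt_eqF|exact: cvg_id].
  - move=> x; rewrite in_itv/= andbT => Xx; have x0 := lt_trans X0 Xx.
    rewrite derive1E; have xn : x != 0 by rewrite gt_eqF.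
    have d1 := @is_deriveV _ (@id R) x 1 1 xn (is_derive_id _ _).
    have d2 := is_deriveN d1.
    have [_ d3] := d2; rewrite [LHS]d3.
    by rewrite /tail_weight gtr0_norm// (max_idPr (ltW Xx)) /GRing.scale/= mulr1 opprK.
by rewrite -EFinD -EFinM; congr EFin; field; rewrite gt_eqF.
Qed.

Section Tail.
Context {R : realType}.
Local Notation mu := (@lebesgue_measure R).

Lemma integrable_tail_weight (X : R) : 0 < X -> mu.-integrable setT (EFin \o tail_weight X).
Proof.
move=> X0; apply/integrableP; split.
  by apply/measurable_EFinP; apply: continuous_measurable_fun; exact: continuous_tail_weight.
rewrite [ltLHS](_ : _ = (4 / X)%:E) ?ltry// -(integral_tail_weight X0).
apply: eq_integral => x _; rewrite /= ger0_norm//.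
by rewrite ltW// tail_weight_gt0.
Qed.

Lemma Rintegral_tail_weight (X : R) : 0 < X -> \int[mu]_x tail_weight X x = 4 / X.
Proof. by move=> X0; rewrite /Rintegral integral_tail_weight. Qed.

Variables (u g : R -> R).
Hypothesis u0 : forall x, 0 <= u x.
Hypothesis iu : mu.-integrable setT (fun x => ((x ^+ 2 + 1) * u x)%:E).
Let M := \int[mu]_x ((x ^+ 2 + 1) * u x).

Lemma tail_interpolation_pointwise (A B X l s x : R) : 0 < X -> 0 < l -> 0 <= A -> 0 <= B ->
  s <= A -> s <= B * Num.sqrt (u x) ->
  s <= A * X ^+ 2 * tail_weight X x
     + B / 2 * (l * ((x ^+ 2 + 1) * u x) + l^-1 * tail_weight X x).
Proof.
move=> X0 l0 A0 B0 sA sB; have w0 := tail_weight_gt0 x X0.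
have B20 : 0 <= B / 2 by rewrite divr_ge0.
have li0 : 0 < l^-1 by rewrite invr_gt0.
have r0 : 0 <= l * ((x ^+ 2 + 1) * u x).
  by rewrite !mulr_ge0 ?(ltW l0)// addr_ge0// sqr_ge0.
have [xX|Xx] := leP `|x| X.
  have -> : A * X ^+ 2 * tail_weight X x = A.
    by rewrite /tail_weight (max_idPl xX) mulfK// expf_neq0// gt_eqF.
  apply: (le_trans sA); rewrite lerDl mulr_ge0// addr_ge0// mulr_ge0// ltW//.
apply: (le_trans sB); apply: ler_wpDl; first by rewrite !mulr_ge0 ?sqr_ge0// ltW.
rewrite /tail_weight (max_idPr (ltW Xx)) real_normK ?num_real//.
have x0 : 0 < x ^+ 2 by rewrite exprn_even_gt0//= -normr_gt0 (lt_trans X0).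
set q := Num.sqrt (u x); have uE : u x = q ^+ 2 by rewrite sqr_sqrtr.
rewrite uE (_ : B * q = B / 2 * (q * 2)); last by field.
rewrite ler_wpM2l//.
have y0 : x ^+ 2 != 0 by rewrite gt_eqF.
move: (x ^+ 2) x0 y0 => y y0 y0'.
have e : l * (y * q ^+ 2) + l^-1 * y^-1 - q * 2 = (l * y) * (q - (l * y)^-1) ^+ 2.
  by field; rewrite y0' gt_eqF.
have : 0 <= (l * y) * (q - (l * y)^-1) ^+ 2 by rewrite mulr_ge0 ?sqr_ge0// mulr_ge0 ?ltW.
have : 0 <= l * q ^+ 2 by rewrite mulr_ge0 ?sqr_ge0 ?ltW.
by rewrite -e; nra.
Qed.

(** The pointwise bound is taken with [X = Y ^+ 2] and [l = Y^-1]. As the weight integrates to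
    [4 / X], the core gives [4 * A * Y ^+ 2], and the moment and the weight contribute [M / Y] and
    [4 / Y] to the tail. *)
Lemma tail_interpolation (A B Y : R) : 0 <= A -> 0 <= B -> 0 < Y ->
  measurable_fun setT g -> (forall x, 0 <= g x <= A) ->
  (forall x, g x <= B * Num.sqrt (u x)) ->
  \int[mu]_x g x <= 4 * A * Y ^+ 2 + B * (M + 4) / (2 * Y).
Proof.
move=> A0 B0 Y0 mg gA gB; have Y20 : 0 < Y ^+ 2 by rewrite exprn_gt0.
have l0 : 0 < Y^-1 by rewrite invr_gt0.
have iw := integrable_tail_weight Y20.
pose v (x : R) := A * (Y ^+ 2) ^+ 2 * tail_weight (Y ^+ 2) x
     + B / 2 * (Y^-1 * ((x ^+ 2 + 1) * u x) + (Y^-1)^-1 * tail_weight (Y ^+ 2) x).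
have i1 : mu.-integrable setT (EFin \o (fun x => A * (Y ^+ 2) ^+ 2 * tail_weight (Y ^+ 2) x)).
  exact: (integrable_scale _ _ iw).
have i2 : mu.-integrable setT (EFin \o (fun x => Y^-1 * ((x ^+ 2 + 1) * u x))).
  exact: (@integrable_scale _ _ _ mu setT measurableT _ _ iu).
have i3 : mu.-integrable setT (EFin \o (fun x => (Y^-1)^-1 * tail_weight (Y ^+ 2) x)).
  exact: (integrable_scale _ _ iw).
have i4 : mu.-integrable setT (EFin \o (fun x =>
    Y^-1 * ((x ^+ 2 + 1) * u x) + (Y^-1)^-1 * tail_weight (Y ^+ 2) x)).
  exact: (integrable_add _ i2 i3).
have i5 : mu.-integrable setT (EFin \o (fun x =>
    B / 2 * (Y^-1 * ((x ^+ 2 + 1) * u x) + (Y^-1)^-1 * tail_weight (Y ^+ 2) x))).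
  exact: (integrable_scale _ _ i4).
have iv : mu.-integrable setT (EFin \o v) by exact: (integrable_add _ i1 i5).
have gv x : g x <= v x.
  have /andP[_ gA'] := gA x.
  exact: (tail_interpolation_pointwise Y20 l0 A0 B0 gA' (gB x)).
have ig : mu.-integrable setT (EFin \o g).
  apply: integrable_dominated iv => // x _.
  by have /andP[g0 _] := gA x; rewrite ger0_norm.
apply: (@le_trans _ _ (\int[mu]_x v x)); first exact: le_Rintegral.
rewrite RintegralD// RintegralZl// RintegralZl// RintegralD// !RintegralZl//.
rewrite Rintegral_tail_weight// -/M le_eqVlt; apply/orP; left; apply/eqP.
by field; rewrite gt_eqF.
Qed.
End Tail.

(** * The Lambert branches and the curve in real terms *)

Section Complex.
Context {R : realType}.
Implicit Types (x y s k u : R).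

Lemma polar_uniq (rho x y : R) : 0 < rho -> 0 < x < pi -> - pi < y <= pi ->
  rho * cos x = rho * cos y -> rho * sin x = rho * sin y -> x = y.
Proof.
move=> r0 /andP[x0 xpi] /andP[y0 ypi] /(mulfI (lt0r_neq0 r0)) ec /(mulfI (lt0r_neq0 r0)) es.
have sx : 0 < sin x by apply: sin_gt0_pi; rewrite x0.
have y0' : 0 <= y.
  rewrite leNgt; apply/negP => yn.
  have : 0 < sin (- y) by apply: sin_gt0_pi; apply/andP; split; lra.
  by rewrite sinN -es; lra.
by apply: cos_inj => //; rewrite in_itv/= ?y0' ?ypi// !ltW.
Qed.

Lemma cArg_polar (rho x : R) : 0 < rho -> 0 < x < pi ->
  cabs (rho * cos x, rho * sin x) = rho /\ cArg (rho * cos x, rho * sin x) = x.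
Proof.
move=> r0 xpi.
have ea : cabs (rho * cos x, rho * sin x) = rho.
  rewrite /cabs/= !exprMn -mulrDr cos2Dsin2 mulr1 sqrtr_sqr ger0_norm//; exact: ltW.
split=> //; rewrite /cArg ea; case: xgetP => [y _ [yp [ec es]]|H].
  by apply/esym; exact: (polar_uniq r0 xpi yp ec es).
by exfalso; apply: (H x); split=> //; case/andP: xpi => ? ?; apply/andP; split; lra.
Qed.

Lemma cofR_inj (a c : R) : cofR a = cofR c -> a = c.
Proof. by case. Qed.

Lemma lambertW_real (x a : R) : lambertW_eq (x, 0) (cofR a) <-> x * expR x = a.
Proof.
rewrite /lambertW_eq /cmul /cexp /cofR /= cos0 sin0 !mulr1 !mulr0 !mul0r subr0 addr0.
by split => [[]|->].
Qed.

Lemma lambertW_entropy (v s : R) : 0 < v ->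
  (- v * expR (- v) = - expR (- 1 - s)) <-> entropy v = s.
Proof.
move=> v0; rewrite mulNr /entropy; split.
  move=> /oppr_inj/(congr1 (@ln R)); rewrite lnM ?posrE ?expR_gt0// !expRK; lra.
move=> e; congr (- _); rewrite -[X in X * _](lnK (x := v)) ?posrE// -expRD.
by congr expR; lra.
Qed.

(** The choice in [W0] is forced: on this range its defining conditions leave a real solution in
    [[-1, 0[], unique by injectivity of [entropy] on []0, 1]]. *)
Lemma W0_real (s : R) : 0 <= s -> W0 (cofR (- expR (- 1 - s))) = (- lam0 s, 0).
Proof.
move=> s0; have [l0 l1 le] := lam0P s0.
have an : - expR (- 1 - s) < 0 by rewrite oppr_lt0 expR_gt0.
have ae : - expR (-1) <= - expR (- 1 - s) by rewrite lerN2 ler_expR; lra.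
rewrite /W0; case: xgetP => [[x y] _ [/= we]|H].
  move=> /(_ (conj erefl an))[/(_ ae)[/= y0 [x1 x2]] _].
  rewrite y0 in we *; move/lambertW_real: we; rewrite -[x]opprK => we.
  congr (_, _); congr (- _); apply: entropy_inj_down; rewrite ?l0 ?l1//.
    by apply/andP; split; lra.
  by rewrite le; apply/lambertW_entropy => //; lra.
exfalso; apply: (H (- lam0 s, 0)); split => /=.
  by apply/lambertW_real/lambertW_entropy.
by move=> _; split => [_|]; [split => //; split; lra|lra].
Qed.

Lemma Wm1_real (s : R) : 0 <= s -> Wm1 (cofR (- expR (- 1 - s))) = (- lam1 s, 0).
Proof.
move=> s0; have [l1 le] := lam1P s0.
have an : - expR (- 1 - s) < 0 by rewrite oppr_lt0 expR_gt0.
have ae : - expR (-1) <= - expR (- 1 - s) by rewrite lerN2 ler_expR; lra.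
rewrite /Wm1 /= eqxx/= ltNge ae/=; case: xgetP => [[x y] _ [/= we]|H].
  move=> /(_ (conj erefl an))[/= y0 x1].
  rewrite y0 in we *; move/lambertW_real: we; rewrite -[x]opprK => we.
  congr (_, _); congr (- _); apply: entropy_inj_up => //; first by lra.
  by rewrite le; apply/lambertW_entropy => //; lra.
exfalso; apply: (H (- lam1 s, 0)); split => /=.
  by apply/lambertW_real/lambertW_entropy => //; lra.
by move=> _; split => //; lra.
Qed.

(* For [0 < y < pi] the equation [w e^w < 0] with [w = x + i y] forces
   [x = - y cot y], and then [w e^w = - exp (phase y - 1)]. *)
Lemma lambertW_complex (x y s : R) : 0 < y < pi ->
  lambertW_eq (x, y) (cofR (- expR (s - 1))) <->
  x = - (y * (cos y / sin y)) /\ phase y = s.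
Proof.
move=> ypi; have sy := sin_gt0_pi ypi; case/andP: ypi => y0 ypi.
have sn : sin y != 0 by rewrite gt_eqF.
have cs := cos2Dsin2 y.
rewrite /lambertW_eq /cmul /cexp /cofR/=.
have re : x = - (y * (cos y / sin y)) ->
    x * (expR x * cos y) - y * (expR x * sin y) = - expR (phase y - 1).
  move=> xE; rewrite phaseE//.
  have -> : x * (expR x * cos y) - y * (expR x * sin y) =
     - (expR x * (y / sin y) * (cos y ^+ 2 + sin y ^+ 2)).
    by move: (expR x) => E; rewrite xE; field; rewrite ?sn.
  have -> : 1 - y * (cos y / sin y) + ln (y / sin y) - 1 = x + ln (y / sin y).
    by rewrite xE; ring.
  by rewrite cs mulr1 expRD lnK ?posrE ?divr_gt0.
split.
  case=> hr hi.
  have xE : x = - (y * (cos y / sin y)).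
    have : expR x * (x * sin y + y * cos y) = 0 by rewrite -hi; ring.
    move=> /eqP; rewrite mulf_eq0 gt_eqF ?expR_gt0//= => /eqP e.
    have -> : x = (x * sin y + y * cos y) / sin y - y * (cos y / sin y) by field; rewrite ?sn//.
    by rewrite e mul0r sub0r.
  split => //; move: hr; rewrite re// => /oppr_inj/expR_inj; lra.
move=> [xE pE]; rewrite re// pE; congr (_, _); rewrite xE; field; rewrite ?sn//.
Qed.

(** Solutions with imaginary part in []0, pi[] are parametrized by that part through [phase], so
    strict monotonicity of [phase] singles out [y]. *)
Lemma W0_complex (y : R) : 0 < y < pi ->
  W0 (cofR (- expR (phase y - 1))) = (- (y * (cos y / sin y)), y).
Proof.
move=> ypi; have [y0 yp] := andP ypi.
have ph : 0 < phase y by rewrite -phase0 phase_lt// lexx.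
have an : - expR (phase y - 1) < 0 by rewrite oppr_lt0 expR_gt0.
have ae : - expR (phase y - 1) < - expR (-1) by rewrite ltrN2 ltr_expR; lra.
rewrite /W0; case: xgetP => [[x z] _ [/= we]|H].
  move=> /(_ (conj erefl an))[_ /(_ ae) /= zpi].
  have [-> pz] := (lambertW_complex _ _ zpi).1 we.
  have [z0 zp] := andP zpi.
  suff -> : z = y by [].
  have [zy|yz|//] := ltgtP z y.
    by have := @phase_lt _ y z; rewrite pz ltxx zy (ltW z0) => /(_ isT yp).
  by have := @phase_lt _ z y; rewrite pz ltxx yz (ltW y0) => /(_ isT zp).
exfalso; apply: (H (- (y * (cos y / sin y)), y)); split => /=.
  exact/lambertW_complex.
by move=> _; split => // h; exfalso; lra.
Qed.

Lemma Wm1_complex (y : R) : 0 < y < pi ->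
  Wm1 (cofR (- expR (phase y - 1))) = (- (y * (cos y / sin y)), - y).
Proof.
move=> ypi; have [y0 yp] := andP ypi.
have ph : 0 < phase y by rewrite -phase0 phase_lt// lexx.
have ae : - expR (phase y - 1) < - expR (-1) by rewrite ltrN2 ltr_expR; lra.
by rewrite /Wm1 /= eqxx ae/= W0_complex.
Qed.

Variable delta : R.
Hypothesis d0 : 0 < delta.
Let h := 2 * delta.
Let h0 : 0 < h. Proof. exact: mulr_gt0. Qed.

Definition curve_re (k : R) : R := (zeta delta k).1.

Lemma zetaE k : zeta delta k = (curve_re k, k).
Proof. by rewrite /curve_re /zeta; case: eqP => [->|]. Qed.

(** With [y = h k > 0], the number [h zeta(k)] has modulus [y / sin y] and argument [y]. The
    imaginary part of its logarithm cancels that of [- zeta(k)], and the real part assembles into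
    [phase y / h]. *)
Lemma Efun_zeta k : 0 <= k -> h * k < pi ->
  Efun delta (zeta delta k) = cofR (phase (h * k) / h).
Proof.
move=> k0 kpi; rewrite /Efun /zeta -/h.
have [->|kn] := eqVneq k 0.
  rewrite mulr0 phase0 mul0r /Defs.cscale/= mulfV ?gt_eqF// mulr0.
  rewrite /cLog /cabs/= expr1n expr0n addr0 sqrtr1 ln1.
  have -> : cArg (1, 0) = 0 :> R.
    rewrite /cArg; case: xgetP => [y _ [/andP[y1 y2] []]|H].
      rewrite /cabs/= expr1n expr0n addr0 sqrtr1 !mul1r => ec es.
      have p0 := @pi_gt0 R.
      apply/eqP; rewrite -normr_eq0; apply/eqP; apply: cos_inj.
      - by rewrite in_itv/= normr_ge0 ler_norml y2 andbT ltW.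
      - by rewrite in_itv/= lexx ltW.
      - by rewrite cos_norm cos0.
    exfalso; apply: (H 0); split.
      by rewrite oppr_lt0 pi_gt0 pi_ge0.
    by rewrite /cabs/= expr1n expr0n addr0 sqrtr1 cos0 sin0 !mul1r.
  by rewrite /Defs.cadd /Defs.copp /cofR/= !addr0 mulr1 mulr0 oppr0 addr0 addNr.
have {}k0 : 0 < k by rewrite lt_neqAle eq_sym kn.
have hk0 : 0 < h * k by exact: mulr_gt0.
have hkpi : 0 < h * k < pi by rewrite hk0.
have sy := sin_gt0_pi hkpi.
have hn : h != 0 by rewrite gt_eqF.
have [e1 e2] := cArg_polar (divr_gt0 hk0 sy) hkpi.
have zE : Defs.cscale h (k * (cos (h * k) / sin (h * k)), k) =
   (h * k / sin (h * k) * cos (h * k), h * k / sin (h * k) * sin (h * k)).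
  by rewrite /Defs.cscale/=; congr (_, _); field; rewrite gt_eqF.
rewrite zE /cLog e1 e2 phaseE// /Defs.cadd /Defs.copp /Defs.cscale /cofR/=.
by congr (_, _); field; rewrite ?hn ?gt_eqF.
Qed.

(** The factor [exp (- h zeta)] rotates by [- h k], exactly undoing the argument of [zeta], so
    [a(k, u)] is a negative real. *)
Lemma aaE k u : 0 <= k -> h * k < pi ->
  aa delta k u = cofR (- expR (phase (h * k) - 1 - h * u)).
Proof.
move=> k0 kpi; rewrite /aa /zeta -/h; have [->|kn] := eqVneq k 0.
  rewrite mulr0 phase0 /cmul /Defs.cscale /cexp /Defs.cadd /cofR/=.
  rewrite addr0 mulr0 sin0 cos0 !mulr0 !mulr1 mul0r subr0 addr0.
  rewrite mulNr mulfV ?gt_eqF// mulN1r; congr (- expR _, _).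
  by field; rewrite gt_eqF.
have {}k0 : 0 < k by rewrite lt_neqAle eq_sym kn.
have hk0 : 0 < h * k by exact: mulr_gt0.
have hkpi : 0 < h * k < pi by rewrite hk0.
have sy := sin_gt0_pi hkpi; have cs := cos2Dsin2 (h * k).
rewrite phaseE// /cmul /Defs.cscale /cexp /Defs.cadd /cofR/= addr0 [- h * k]mulNr cosN sinN.
set x := h * k in hk0 hkpi sy cs *; set c := cos x in cs *; set s := sin x in sy cs *.
have sn : s != 0 by rewrite gt_eqF.
have -> : - h * (k * (c / s)) = - (x * (c / s)) by rewrite /x; ring.
have -> : - h * (k * (c / s) + u) = - (x * (c / s)) - h * u by rewrite /x; ring.
set E := expR _; congr (_, _); last by field; rewrite ?sn.
have -> : 1 - x * (c / s) + ln (x / s) - 1 - h * u = (- (x * (c / s)) - h * u) + ln (x / s) by ring.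
rewrite expRD lnK ?posrE ?divr_gt0// -/E.
transitivity (- (E * (x / s) * (c ^+ 2 + s ^+ 2))); last by rewrite cs mulr1.
by field; rewrite ?sn.
Qed.

Lemma kappa_maxE (u0 : R -> R) (xmax y : R) : 0 < y < pi -> phase y = h * u0 xmax ->
  kappa_max delta u0 xmax = y / h.
Proof.
move=> ypi pE; rewrite /kappa_max /umax -/h -pE Wm1_complex// /Defs.cscale /=.
by field; rewrite gt_eqF.
Qed.

End Complex.

(** * The density of solitons *)

Section Profile.
Context {R : realType}.
Variables (delta : R) (u0 : R -> R) (xmax : R).
Hypothesis d0 : 0 < delta.
Hypothesis au : admissible_u0 u0 xmax.
Local Notation mu := (@lebesgue_measure R).
Implicit Types (k x y : R).

Let h := 2 * delta.
Let h0 : 0 < h. Proof. exact: mulr_gt0. Qed.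

Lemma u0_derivable x : derivable u0 x 1. Proof. by case: au => + _; apply. Qed.
Lemma u0_gt0 x : 0 < u0 x. Proof. by case: au => _ [_ [+ _]]; apply. Qed.
Lemma u0_le_max x : u0 x <= u0 xmax.
Proof. by case: au => _ [_ [_ [_ [_ [_ [_ +]]]]]]; apply. Qed.
Lemma u0_crit x : derive1 u0 x = 0 <-> x = xmax.
Proof. by case: au => _ [_ [_ [_ [_ [_ [+ _]]]]]]; apply. Qed.

Lemma u0_continuous : continuous u0.
Proof. by move=> x; exact/differentiable_continuous/derivable1_diffP/u0_derivable. Qed.

Lemma u0_measurable : measurable_fun setT u0.
Proof. exact: continuous_measurable_fun u0_continuous. Qed.

Lemma u0_within (a c : R) : {within `[a, c], continuous u0}.
Proof. by apply: continuous_subspaceT; exact: u0_continuous. Qed.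

(* Between two points with equal values Rolle's theorem gives a critical point,
   so [u0] is injective on either side of [xmax]. *)
Lemma u0_inj_side (x y : R) : x < y -> u0 x = u0 y -> x < xmax < y.
Proof.
move=> xy e; have [c] := Rolle xy (fun z _ => @u0_derivable z) (@u0_within x y) e.
rewrite in_itv/= => cxy dc.
have : derive1 u0 c = 0 by rewrite derive1E; case: dc.
by move=> /u0_crit <-.
Qed.

Lemma u0_decr x y : xmax <= x -> x < y -> u0 y < u0 x.
Proof.
move=> mx xy; rewrite ltNge; apply/negP => le.
have mxy : xmax < y by lra.
have [|z] := @IVT R u0 xmax x (u0 y) mx (@u0_within _ _).
  by rewrite ge_min le_max le u0_le_max !orbT.
rewrite in_itv/= => /andP[z1 z2] e.
have zy : z < y by lra.
by have /andP[? ?] := u0_inj_side zy e; lra.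
Qed.

Lemma u0_incr x y : y <= xmax -> x < y -> u0 x < u0 y.
Proof.
move=> ym xy; rewrite ltNge; apply/negP => le.
have [|z] := @IVT R u0 y xmax (u0 x) ym (@u0_within _ _).
  by rewrite ge_min le_max le u0_le_max !orbT.
rewrite in_itv/= => /andP[z1 z2] e.
have xz : x < z by lra.
by have /andP[? ?] := u0_inj_side xz (esym e); lra.
Qed.

Lemma u0_surj_right s : 0 < s <= u0 xmax -> exists2 x, xmax <= x & u0 x = s.
Proof.
move=> /andP[s0 sm]; case: au => _ [_ [_ [cp _]]].
have [M [Mr MP]] : \forall x \near +oo, u0 x < s.
  by apply: cvgr_lt cp _ s0.
pose z := Num.max xmax (M + 1).
have zm : xmax <= z by rewrite le_max lexx.
have uz : u0 z < s by apply: MP; rewrite lt_max; apply/orP; right; lra.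
have [|x] := @IVT R u0 xmax z s zm (@u0_within _ _).
  by rewrite ge_min le_max sm (ltW uz) !orbT.
by rewrite in_itv/= => /andP[x1 _] <-; exists x.
Qed.

Lemma u0_surj_left s : 0 < s <= u0 xmax -> exists2 x, x <= xmax & u0 x = s.
Proof.
move=> /andP[s0 sm]; case: au => _ [_ [_ [_ [cn _]]]].
have [M [Mr MP]] : \forall x \near -oo, u0 x < s.
  by apply: cvgr_lt cn _ s0.
pose z := Num.min xmax (M - 1).
have zm : z <= xmax by rewrite ge_min lexx.
have uz : u0 z < s by apply: MP; rewrite gt_min; apply/orP; right; lra.
have [|x] := @IVT R u0 z xmax s zm (@u0_within _ _).
  by rewrite ge_min le_max sm (ltW uz) !orbT.
by rewrite in_itv/= => /andP[_ x1] <-; exists x.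
Qed.

(** The angle [h * kappa_max], characterized without Lambert functions. *)
Definition phase_max : R := xget 0 [set y | 0 <= y < pi /\ phase y = h * u0 xmax].

Lemma phase_maxP : 0 < phase_max < pi /\ phase phase_max = h * u0 xmax.
Proof.
have hu : 0 < h * u0 xmax by rewrite mulr_gt0// u0_gt0.
have : 0 <= phase_max < pi /\ phase phase_max = h * u0 xmax.
  rewrite /phase_max; apply: (@xgetPex _ (0:R) [set y | 0 <= y < pi /\ phase y = h * u0 xmax]).
  by have [y yb yE] := phase_surj (ltW hu); exists y.
case=> /andP[p0 p1] e; split => //; rewrite p1 andbT lt_neqAle p0 andbT.
by apply/eqP => p00; move: hu; rewrite -e -p00 phase0 ltxx.
Qed.

Local Notation b := (kappa_max delta u0 xmax).

Lemma kappa_max_phase : b = phase_max / h.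
Proof. by have [pb pE] := phase_maxP; rewrite (kappa_maxE d0 pb pE). Qed.

Lemma kappa_max_gt0 : 0 < b.
Proof. by rewrite kappa_max_phase divr_gt0//; have [/andP[]] := phase_maxP. Qed.

Lemma hk_bound k : 0 <= k <= b -> 0 <= h * k <= phase_max.
Proof.
move=> /andP[k0 kb]; rewrite mulr_ge0 ?(ltW h0)//=.
by rewrite mulrC -ler_pdivlMr// -kappa_max_phase.
Qed.

Lemma hk_pi k : 0 <= k <= b -> h * k < pi.
Proof.
move=> /hk_bound/andP[_ h1]; apply: (le_lt_trans h1).
by have [/andP[]] := phase_maxP.
Qed.

(** The exponent for which [a(k, u0 x) = - exp (- 1 - level)]: both branches are real exactly when
    it is nonnegative, which is the condition for [x] to lie in the window. *)
Definition level_fun k x : R := h * u0 x - phase (h * k).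

Lemma level_funP k : 0 < k <= b -> 0 < phase (h * k) / h <= u0 xmax.
Proof.
move=> /andP[k0 kb]; have kb' : 0 <= k <= b by rewrite kb ltW.
have hk0 : 0 < h * k by exact: mulr_gt0.
apply/andP; split.
  by rewrite divr_gt0// -phase0 phase_lt ?lexx ?hk_pi.
rewrite ler_pdivrMr// [_ * h]mulrC; have [/andP[_ pp] <-] := phase_maxP.
exact: phase_le (hk_bound kb') pp.
Qed.

Lemma xplusP k : 0 < k <= b ->
  xmax <= xplus delta u0 xmax k /\ u0 (xplus delta u0 xmax k) = phase (h * k) / h.
Proof.
move=> kb; have /andP[k0 kb'] := kb; have kb2 : 0 <= k <= b by rewrite kb' ltW.
have E := Efun_zeta d0 (ltW k0) (hk_pi kb2).
have [x xm xE] := u0_surj_right (level_funP kb).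
rewrite /xplus E; have := @xgetPex _ (0:R) [set x | xmax <= x /\ cofR (u0 x) = cofR (phase (h * k) / h)].
by move=> []; [exists x; split => //; rewrite xE|move=> ? /cofR_inj].
Qed.

Lemma xminusP k : 0 < k <= b ->
  xminus delta u0 xmax k <= xmax /\ u0 (xminus delta u0 xmax k) = phase (h * k) / h.
Proof.
move=> kb; have /andP[k0 kb'] := kb; have kb2 : 0 <= k <= b by rewrite kb' ltW.
have E := Efun_zeta d0 (ltW k0) (hk_pi kb2).
have [x xm xE] := u0_surj_left (level_funP kb).
rewrite /xminus E; have := @xgetPex _ (0:R) [set x | x <= xmax /\ cofR (u0 x) = cofR (phase (h * k) / h)].
by move=> []; [exists x; split => //; rewrite xE|move=> ? /cofR_inj].
Qed.

Lemma u0_le_right x y : xmax <= x -> x <= y -> u0 y <= u0 x.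
Proof. by move=> mx; rewrite le_eqVlt => /predU1P[->//|/(u0_decr mx)/ltW]. Qed.

Lemma le_xplus k x : 0 < k <= b -> xmax <= x -> (x <= xplus delta u0 xmax k) = (0 <= level_fun k x).
Proof.
move=> kb mx; have [mp pE] := xplusP kb.
rewrite /level_fun subr_ge0 [h * u0 x]mulrC -ler_pdivrMr// -pE.
apply/idP/idP => [xp|]; first exact: u0_le_right.
by apply: contraTT; rewrite -!ltNge => /(u0_decr mp).
Qed.

Lemma ge_xminus k x : 0 < k <= b -> x <= xmax -> (xminus delta u0 xmax k <= x) = (0 <= level_fun k x).
Proof.
move=> kb xm; have [mm mE] := xminusP kb.
rewrite /level_fun subr_ge0 [h * u0 x]mulrC -ler_pdivrMr// -mE.
apply/idP/idP => [|]; first by rewrite le_eqVlt => /predU1P[->//|/(u0_incr xm)/ltW].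
by apply: contraTT; rewrite -!ltNge => /(u0_incr mm).
Qed.

Lemma windowE k x : 0 <= k <= b -> window delta u0 xmax k x <-> 0 <= level_fun k x.
Proof.
move=> /andP[k0 kb]; rewrite /window; case: eqVneq => [->|kn].
  by split=> // _; rewrite /level_fun mulr0 phase0 subr0 mulr_ge0 ?(ltW h0) ?(ltW (u0_gt0 _)).
have kb2 : 0 < k <= b by rewrite kb lt_neqAle eq_sym kn k0.
have [xm mm] := xminusP kb2; have [mp pp] := xplusP kb2.
rewrite /=; have [mx|/ltW mx] := leP xmax x.
  by rewrite (le_trans xm mx) le_xplus.
by rewrite (le_trans mx mp) andbT ge_xminus.
Qed.

Lemma W_diff k x : 0 <= k <= b -> 0 <= level_fun k x ->
  cRe (csub (W0 (aa delta k (u0 x))) (Wm1 (aa delta k (u0 x)))) = gap (level_fun k x).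
Proof.
move=> kb l0; have /andP[k0 _] := kb.
rewrite aaE//; last exact: hk_pi.
have -> : phase (2 * delta * k) - 1 - 2 * delta * u0 x = - 1 - level_fun k x.
  by rewrite /level_fun /h; ring.
by rewrite W0_real// Wm1_real// /csub /Defs.cadd /Defs.copp /cRe/= opprK addrC.
Qed.

Lemma RWylE k : 0 <= k <= b ->
  RWyl delta u0 xmax k = (2 * h)^-1 * \int[mu]_x gap (level_fun k x).
Proof.
move=> kb; rewrite /RWyl; congr (_ * _); first by rewrite /h; congr (_^-1); ring.
rewrite Rintegral_mkcond; apply: eq_Rintegral => x _.
rewrite patchE; case: ifPn => [/set_mem/(windowE x kb)|/negP].
  exact: W_diff.
move=> xn; rewrite gap_npos//; apply: ltW; rewrite ltNge; apply/negP => l0.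
by apply: xn; apply/mem_set/(windowE x kb).
Qed.

End Profile.

(** * Slices of a nonnegative kernel by Tonelli's theorem *)

Section SliceMass.
Context {R : realType}.
Local Notation mu := (@lebesgue_measure R).
Variable K : R * R -> R.
Hypothesis mK : measurable_fun setT K.
Hypothesis K0 : forall z, 0 <= K z.

(** Under the finiteness hypothesis below, [fine] alters the slice integral only on a null set,
    where it is infinite, and makes the density real-valued everywhere. *)
Definition slice_mass (e : R) : R := fine (\int[mu]_x (K (e, x))%:E)%E.

Lemma slice_mass_ge0 e : 0 <= slice_mass e.
Proof. by apply: fine_ge0; apply: integral_ge0 => x _; rewrite lee_fin. Qed.

Let mKE : measurable_fun setT (EFin \o K). Proof. exact/measurable_EFinP. Qed.
Let KE0 (z : R * R) : (0 <= (EFin \o K) z)%E. Proof. by rewrite lee_fin. Qed.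

Hypothesis Kfin : (\int[mu]_x \int[mu]_e (K (e, x))%:E < +oo)%E.

Let I (e : R) := (\int[mu]_x (K (e, x))%:E)%E.

Let mI : measurable_fun setT I.
Proof. exact: (measurable_fun_fubini_tonelli_F (m2 := mu) _ mKE KE0). Qed.

Let I0 e : (0 <= I e)%E.
Proof. by apply: integral_ge0 => x _; rewrite lee_fin. Qed.

Let iI : mu.-integrable setT I.
Proof.
apply/integrableP; split; first exact: mI.
rewrite [ltLHS](_ : _ = (\int[mu]_x \int[mu]_e (K (e, x))%:E)%E)//.
rewrite -(fubini_tonelli (m1 := mu) (m2 := mu) _ mKE KE0).
by apply: eq_integral => e _; rewrite gee0_abs.
Qed.

Lemma slice_mass_measurable : measurable_fun setT slice_mass.
Proof. exact: measurableT_comp (@fine_measurable R setT measurableT) mI. Qed.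

Lemma integral_slice_mass (D : set R) : measurable D ->
  (\int[mu]_(e in D) (slice_mass e)%:E = \int[mu]_x \int[mu]_(e in D) (K (e, x))%:E)%E.
Proof.
move=> mD; transitivity (\int[mu]_(e in D) I e)%E.
  apply: ae_eq_integral => //; first last.
  - have := integrable_ae measurableT iI; apply: filterS => e eP _ /=.
    by rewrite /slice_mass fineK// eP.
  - exact: measurable_funTS mI.
  - by apply/measurable_EFinP; apply: measurable_funTS; exact: slice_mass_measurable.
rewrite integral_mkcond.
pose KD (z : R * R) := (K z * \1_D z.1)%:E.
have mKD : measurable_fun setT KD.
  apply/measurable_EFinP; apply: measurable_funM => //.
  exact: measurableT_comp (measurable_indic _) measurable_fst.
have KD0 (z : R * R) : (0 <= KD z)%E.
  by rewrite lee_fin mulr_ge0.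
transitivity (\int[mu]_e \int[mu]_x KD (e, x))%E.
  apply: eq_integral => e _; rewrite patchE /KD /=; case: ifPn => eD.
    by apply: eq_integral => x _; rewrite /= indicE eD mulr1.
  by rewrite integral0_eq// => x _; rewrite /= indicE (negbTE eD) mulr0.
rewrite (fubini_tonelli (m1 := mu) (m2 := mu) _ mKD KD0).
apply: eq_integral => x _; rewrite [RHS]integral_mkcond.
apply: eq_integral => e _; rewrite patchE /KD /= indicE.
by case: ifPn => eD; rewrite ?mulr1 ?mulr0.
Qed.

Lemma integrable_slice_mass : mu.-integrable setT (EFin \o slice_mass).
Proof.
apply/integrableP; split; first by apply/measurable_EFinP; exact: slice_mass_measurable.
rewrite [ltLHS](_ : _ = (\int[mu]_x \int[mu]_e (K (e, x))%:E)%E)//.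
rewrite -integral_slice_mass//; apply: eq_integral => e _.
by rewrite gee0_abs// lee_fin slice_mass_ge0.
Qed.

End SliceMass.

Section Continuity.
Context {R : realType}.

Lemma is_derive_continuous (f : R -> R) (x a : R) : is_derive x 1 f a -> {for x, continuous f}.
Proof. by case=> d _; exact/differentiable_continuous/derivable1_diffP. Qed.

Lemma continuous_gap' (s : R) : 0 < s -> {for s, continuous (@gap' R)}.
Proof.
move=> s0; have [w1 /andP[w0 w01]] := lam_neq1 s0.
have c1 := is_derive_continuous (is_derive_lam1 s0).
have c0 := is_derive_continuous (is_derive_lam0 s0).
apply: cvgD; apply: cvgM => //; apply: cvgV; rewrite ?subr_eq0.
- by rewrite gt_eqF.
- by apply: cvgB => //; exact: cvg_cst.
- by rewrite gt_eqF.
- by apply: cvgB => //; exact: cvg_cst.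
Qed.

Lemma continuous_phase' (x : R) : 0 < x < pi -> {for x, continuous (@phase' R)}.
Proof.
move=> xpi; have s0 := sin_gt0_pi xpi; have /andP[x0 _] := xpi.
have cs := @continuous_sin R x; have cc := @continuous_cos R x.
apply: cvgD; last exact: cvg_id.
apply: cvgM.
  apply: (@continuous_comp _ _ _ (fun x : R => sin x - x * cos x) (fun t : R => t ^+ 2)).
    by apply: cvgB => //; apply: cvgM => //; exact: cvg_id.
  exact: exprn_continuous.
apply: cvgV; first by rewrite mulf_neq0// ?expf_neq0// gt_eqF.
apply: cvgM; first exact: cvg_id.
apply: (@continuous_comp _ _ _ (@sin R) (fun t : R => t ^+ 2)) => //.
exact: exprn_continuous.
Qed.

End Continuity.

Section SolitonDensity.
Context {R : realType}.
Variables (delta : R) (u0 : R -> R) (xmax : R).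
Hypothesis d0 : 0 < delta.
Hypothesis au : admissible_u0 u0 xmax.
Local Notation mu := (@lebesgue_measure R).
Local Notation b := (kappa_max delta u0 xmax).
Implicit Types (k x y : R).

Let h := 2 * delta.
Let h0 : 0 < h. Proof. exact: mulr_gt0. Qed.
Let b0 : 0 < b. Proof. exact: kappa_max_gt0 d0 au. Qed.
Let lvl := level_fun delta u0.

Lemma phase_scaled_ucont : ucont b (fun k => phase (h * k)).
Proof.
apply: continuous_ucont => x xb e e0.
have := hk_bound d0 au xb; have := hk_pi d0 au xb; rewrite -/h => hp /andP[hx _].
have [|d dd dP] := @phase_cvg R (h * x) e _ e0; first by rewrite hx hp.
exists (d / h); first exact: divr_gt0.
move=> y /andP[y0 _] xy; apply: dP; first by rewrite mulr_ge0// ltW.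
by rewrite -mulrBr normrM gtr0_norm// mulrC -ltr_pdivlMr.
Qed.

Let phi : R -> R := (fun k => phase (h * k)) \o clip b.

Let phi_continuous : continuous phi.
Proof. exact: ucont_clip_continuous (ltW b0) phase_scaled_ucont. Qed.

Let domain : set (R * R) := [set z | 0 < z.1 < b /\ 0 < lvl z.1 z.2].

Let mlvl : measurable_fun setT (fun z : R * R => h * u0 z.2 - phi z.1).
Proof.
apply: measurable_funB.
  apply: measurable_funM => //.
  exact: measurableT_comp (u0_measurable au) measurable_snd.
exact: measurableT_comp (continuous_measurable_fun phi_continuous) measurable_fst.
Qed.

Let lvlE k x : 0 < k < b -> lvl k x = h * u0 x - phi k.
Proof. by move=> /andP[k0 kb]; rewrite /phi /= clip_id// !ltW. Qed.

Let mdomain : measurable domain.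
Proof.
rewrite (_ : domain = (fst @^-1` `]0, b[) `&`
    ((fun z : R * R => h * u0 z.2 - phi z.1) @^-1` `]0, +oo[)).
  apply: measurableI; first by rewrite -[X in measurable X]setTI; exact: measurable_fst.
  by rewrite -[X in measurable X]setTI; exact: mlvl.
apply/seteqP; split => -[k x] /=; rewrite /domain/= !in_itv/= ?andbT.
  by move=> [kb]; rewrite lvlE.
by move=> [kb]; rewrite -lvlE.
Qed.

Let slope (z : R * R) : R := gap' (lvl z.1 z.2) * (h * phase' (h * z.1)).

(** Minus the [k]-derivative of [gap] at the level, cut off to positive levels, where [gap] is
    differentiable. *)
Definition soliton_kernel : R * R -> R := slope \_ domain.

Lemma soliton_kernel_ge0 z : 0 <= soliton_kernel z.
Proof.
rewrite /soliton_kernel patchE; case: ifPn => // /set_mem[/andP[z0 _] _].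
have hz : 0 < h * z.1 by exact: mulr_gt0.
rewrite mulr_ge0 ?gap'_ge0// mulr_ge0 ?(ltW h0)//.
by rewrite (le_trans (ltW hz)) ?phase'_ge.
Qed.

Lemma soliton_kernel_measurable : measurable_fun setT soliton_kernel.
Proof.
apply/(measurable_restrictT _ mdomain).
have m1 : measurable_fun domain (@gap' R \o (fun z : R * R => lvl z.1 z.2)).
  apply: (measurable_comp (measurable_itv `]0, +oo[%R)).
  - by move=> s /= [z [_ ?] <-]; rewrite in_itv/= andbT.
  - apply: open_continuous_measurable_fun; first exact: interval_open.
    move=> s; rewrite inE/= in_itv/= andbT; exact: continuous_gap'.
  - apply: (@eq_measurable_fun _ _ _ _ _ (fun z : R * R => h * u0 z.2 - phi z.1)).
      by move=> z /set_mem[zb _]; rewrite lvlE.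
    exact: measurable_funTS mlvl.
have m2 : measurable_fun domain (@phase' R \o (fun z : R * R => h * z.1)).
  apply: (measurable_comp (measurable_itv `]0, pi[%R)).
  - move=> s /= [z [/andP[z0 zb] _] <-]; rewrite in_itv/= mulr_gt0//=.
    by apply: (hk_pi d0 au); rewrite !ltW.
  - apply: open_continuous_measurable_fun; first exact: interval_open.
    move=> s; rewrite inE/= in_itv/=; exact: continuous_phase'.
  - by apply: measurable_funTS; apply: measurable_funM => //; exact: measurable_fst.
by apply: measurable_funM => //; apply: measurable_funM.
Qed.

(* At a fixed [x] the level is positive exactly for [k] below the point [c] where
   [phase (h c) = h u0 x], and there the kernel is the derivative of [- gap]. *)
Let crossing x : exists c, [/\ 0 < c <= b, lvl c x = 0 &
  forall k, 0 <= k <= b -> (0 < lvl k x) = (k < c)].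
Proof.
have hu : 0 < h * u0 x by rewrite mulr_gt0// (u0_gt0 au).
have [y /andP[y0 yp] yE] := phase_surj (ltW hu).
have y1 : 0 < y.
  by rewrite lt_neqAle y0 andbT; apply/eqP => y00; move: hu; rewrite -yE -y00 phase0 ltxx.
have [/andP[m0 mp] mE] := phase_maxP d0 au.
have ym : y <= phase_max delta u0 xmax.
  rewrite leNgt; apply/negP => my.
  have := @phase_lt R y (phase_max delta u0 xmax); rewrite (ltW m0) my yp => /(_ isT isT).
  by rewrite mE yE ltr_pM2l// ltNge (u0_le_max au).
have hyh : h * (y / h) = y by rewrite mulrC divfK// gt_eqF.
exists (y / h); split.
- by rewrite divr_gt0//= kappa_max_phase// ler_pM2r// invr_gt0.
- by rewrite /lvl /level_fun -/h hyh yE subrr.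
- move=> k kb; have := hk_bound d0 au kb; have := hk_pi d0 au kb; rewrite -/h => kp /andP[k0 _].
  rewrite /lvl /level_fun -/h subr_gt0 -yE ltr_pdivlMr// [k * h]mulrC.
  apply/idP/idP => [lt|lt]; last by apply: phase_lt => //; rewrite k0.
  rewrite ltNge; apply/negP => ge; move: lt; rewrite ltNge => /negP; apply.
  by apply: phase_le => //; rewrite y0.
Qed.

(** Up to the crossing point [c] the kernel is the nonnegative derivative of [- gap], singular at
    [c], which calls for [ge0_FTC_oo]; past [c] it is 0. The boundary term at [c] vanishes because
    the level is 0 there. *)
Lemma integral_soliton_kernel k x : 0 <= k <= b ->
  (\int[mu]_(e in `]k, b]) (soliton_kernel (e, x))%:E = (gap (lvl k x))%:E)%E.
Proof.
move=> kb; have /andP[k0 kb'] := kb; have [c [/andP[c0 cb] cE cP]] := crossing x.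
transitivity (\int[mu]_(e in `]k, b] `&` `]0%R, c[) (slope (e, x))%:E)%E.
  rewrite integral_mkcondr; apply: eq_integral => e; rewrite inE/= in_itv/= => /andP[ke eb].
  rewrite patchE /soliton_kernel patchE; have e0 : 0 < e by lra.
  have eb2 : 0 <= e <= b by rewrite eb ltW.
  case: ifPn => [/set_mem[/= _]|/negP n1]; case: ifPn => [/set_mem|/negP n2] //=.
    by rewrite cP// => ec; case: n2; apply/mem_set; rewrite /= in_itv/= e0.
  rewrite in_itv/= => /andP[_ ec]; case: n1; apply/mem_set; split => /=; last by rewrite cP.
  by rewrite e0/=; lra.
have [ck|kc] := leP c k.
  rewrite (_ : `]k, b] `&` `]0, c[ = set0).
    by rewrite integral_set0 gap_npos// leNgt cP// -leNgt.
  by apply/seteqP; split => e //= []; rewrite !in_itv/= => /andP[? ?] /andP[? ?]; lra.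
rewrite (_ : `]k, b] `&` `]0, c[ = `]k, c[%classic); last first.
  apply/seteqP; split => e /=; rewrite !in_itv/=.
    by move=> [/andP[-> _] /andP[_ ->]].
  by move=> /andP[? ?]; split; apply/andP; split; lra.
transitivity ((- gap (lvl c x) - (- gap (lvl k x)))%:E); last first.
  by rewrite cE gap_npos// oppr0 add0r opprK.
apply: (@ge0_FTC_oo R (fun e => slope (e, x)) (fun e : R => - gap (lvl e x)) k c kc).
- have e1 e : e \in `[k, c]%classic -> - gap (h * u0 x - phi e) = - gap (lvl e x).
    rewrite inE/= in_itv/= => /andP[? ?]; rewrite /phi /= clip_id//.
    by apply/andP; split; lra.
  apply: (subspace_eq_continuous e1); apply: continuous_subspaceT => e.
  apply: cvgN; apply: (@continuous_comp _ _ _ (fun e => h * u0 x - phi e) (@gap R)).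
    by apply: cvgB; [exact: cvg_cst|exact: phi_continuous].
  exact: continuous_gap.
- move=> e /andP[ke ec]; have eb : 0 <= e <= b by apply/andP; split; lra.
  have e0 : 0 < e by lra.
  have he : 0 < h * e < pi by rewrite mulr_gt0//= (hk_pi d0 au).
  have l0 : 0 < lvl e x by rewrite cP.
  have dh : is_derive e 1 (fun e : R => h * e) h.
    have := @is_deriveZ _ _ _ (@id R) h e 1 1 (is_derive_id _ _).
    by rewrite /GRing.scale/= mulr1.
  have d1 := is_derive1_comp (is_derive_phase he) dh.
  have d2 : is_derive e 1 (fun e => lvl e x) (0 - phase' (h * e) * h).
    exact: @is_deriveB _ _ _ (cst (h * u0 x)) _ e 1 0 _ (is_derive_cst _ _ _) d1.
  have d3 := @is_deriveN _ _ _ _ _ _ _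
    (@is_derive1_comp _ _ (fun e => lvl e x) _ _ _ (is_derive_gap l0) d2).
  by apply: is_derive_eq d3 _; rewrite /slope /= sub0r mulrN opprK [_ * h]mulrC.
- move=> e /andP[ke ec]; have eb : 0 <= e <= b by apply/andP; split; lra.
  have e0 : 0 < e by lra.
  have he : 0 < h * e < pi by rewrite mulr_gt0//= (hk_pi d0 au).
  have l0 : 0 < lvl e x by rewrite cP.
  have ch : {for e, continuous (fun e : R => h * e)} by apply: cvgM; [exact: cvg_cst|exact: cvg_id].
  apply: cvgM.
    apply: (@continuous_comp _ _ _ (fun e => lvl e x) (@gap' R)).
      apply: cvgB; first exact: cvg_cst.
      apply: (@continuous_comp _ _ _ (fun e => h * e) (@phase R)) => //.
      exact: is_derive_continuous (is_derive_phase he).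
    exact: continuous_gap'.
  apply: cvgM; first exact: cvg_cst.
  apply: (@continuous_comp _ _ _ (fun e => h * e) (@phase' R)) => //.
  exact: continuous_phase'.
- move=> e /andP[ke ec]; have he : 0 < h * e by rewrite mulr_gt0//; lra.
  rewrite mulr_ge0 ?gap'_ge0// mulr_ge0 ?(ltW h0)//.
  by rewrite (le_trans (ltW he)) ?phase'_ge.
Qed.

Hypothesis su : mu.-integrable setT (fun x => (Num.sqrt (u0 x))%:E).

Lemma gap_sqrt_bound : exists2 C : R, 0 < C & forall s t : R, s <= h * u0 xmax -> t <= s ->
  gap s - gap t <= C * Num.sqrt (s - t).
Proof.
have hu : 0 <= h * u0 xmax by rewrite mulr_ge0 ?(ltW h0)// ltW// (u0_gt0 au).
exists (2 * (1 + Num.sqrt (h * u0 xmax)) ^+ 2 + 2).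
  by have := sqr_ge0 (1 + Num.sqrt (h * u0 xmax)); lra.
by move=> s t; exact: gap_holder.
Qed.

Lemma level_le k x : 0 <= k <= b -> lvl k x <= h * u0 x.
Proof.
move=> kb; rewrite /lvl /level_fun lerBlDr lerDl phase_ge0//.
by have /andP[-> _] := hk_bound d0 au kb; exact: (hk_pi d0 au kb).
Qed.

Lemma level_measurable k : measurable_fun setT (lvl k).
Proof.
apply: measurable_funB => //; apply: measurable_funM => //; exact: u0_measurable au.
Qed.

Lemma gap_level_measurable k : measurable_fun setT (fun x => gap (lvl k x)).
Proof.
apply: measurableT_comp (level_measurable k).
exact: continuous_measurable_fun (@continuous_gap R).
Qed.

(** Integrability of [sqrt u0] enters here: [gap] at the level is at most [gap (h u0)], hence at
    most a multiple of [sqrt u0]. *)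
Lemma integrable_gap_level k : 0 <= k <= b ->
  mu.-integrable setT (EFin \o (fun x => gap (lvl k x))).
Proof.
move=> kb; have [C C0 CP] := gap_sqrt_bound.
have i1 := integrable_scale measurableT (C * Num.sqrt h) su.
apply: integrable_dominated i1 => //; first exact: gap_level_measurable.
move=> x _; have ux := ltW (u0_gt0 au x); rewrite ger0_norm ?gap_ge0//.
have hux : h * u0 x <= h * u0 xmax by rewrite ler_pM2l// (u0_le_max au).
apply: (le_trans (gap_le (level_le x kb))).
have := CP (h * u0 x) 0 hux (mulr_ge0 (ltW h0) ux).
by rewrite (gap_npos (lexx 0)) !subr0 sqrtrM ?(ltW h0)// mulrA.
Qed.

Definition soliton_density k : R := (2 * h)^-1 * slice_mass soliton_kernel k.

Let kernel_fin : (\int[mu]_x \int[mu]_e (soliton_kernel (e, x))%:E < +oo)%E.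
Proof.
have zb : 0 <= (0 : R) <= b by rewrite lexx ltW.
rewrite [ltLHS](_ : _ = \int[mu]_x (gap (lvl 0 x))%:E)%E.
  by rewrite -(Rintegral_fineK measurableT (integrable_gap_level zb)) ltry.
apply: eq_integral => x _; rewrite -integral_soliton_kernel// [RHS]integral_mkcond.
apply: eq_integral => e _; rewrite patchE; case: ifPn => // /negP ne.
rewrite /soliton_kernel patchE; case: ifPn => // /set_mem[/= /andP[e0 eb] _].
by case: ne; apply/mem_set; rewrite /= in_itv/= e0 ltW.
Qed.

Lemma soliton_density_ge0 k : 0 <= soliton_density k.
Proof.
rewrite mulr_ge0 ?slice_mass_ge0//; last exact: soliton_kernel_ge0.
by rewrite invr_ge0 mulr_ge0// ltW.
Qed.

Lemma integrable_soliton_density : mu.-integrable setT (EFin \o soliton_density).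
Proof.
exact: (integrable_scale measurableT _ (integrable_slice_mass
  soliton_kernel_measurable soliton_kernel_ge0 kernel_fin)).
Qed.

Lemma RWyl_soliton_density k : 0 <= k <= b ->
  RWyl delta u0 xmax k = \int[mu]_(e in `]k, b]) soliton_density e.
Proof.
move=> kb; have im := integrable_slice_mass soliton_kernel_measurable soliton_kernel_ge0 kernel_fin.
rewrite (RWylE d0 au kb) -/h RintegralZl//; last exact: integrableS im.
congr (_ * _); rewrite /Rintegral; congr fine.
rewrite integral_slice_mass//.
- by apply: eq_integral => x _; rewrite integral_soliton_kernel.
- exact: soliton_kernel_measurable.
- exact: soliton_kernel_ge0.
Qed.

End SolitonDensity.

Lemma gap_lt (R : realType) (s t : R) : 0 < s -> t < s -> gap t < gap s.
Proof.
move=> s0 ts; have [w1 /andP[w0 w01]] := lam_neq1 s0.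
have [t0|t0] := leP t 0; first by rewrite gap_npos// /gap; lra.
have [v1 vE] := lam1P (ltW t0); have [w1' wE] := lam1P (ltW s0).
have l1 : lam1 t < lam1 s.
  rewrite lt_neqAle lam1_le ?(ltW t0) ?(ltW ts)// andbT; apply/eqP => e.
  by move: ts; rewrite -vE -wE e ltxx.
by have := lam0_le (ltW t0) (ltW ts); rewrite /gap; lra.
Qed.

Section SolitonProfile.
Context {R : realType}.
Variables (delta : R) (u0 : R -> R) (xmax : R).
Hypothesis d0 : 0 < delta.
Hypothesis au : admissible_u0 u0 xmax.
Local Notation mu := (@lebesgue_measure R).
Local Notation b := (kappa_max delta u0 xmax).
Local Notation rho := (soliton_density delta u0 xmax).
Local Notation Rf := (RWyl delta u0 xmax).
Implicit Types (k e x y : R).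
Hypothesis su : mu.-integrable setT (fun x => (Num.sqrt (u0 x))%:E).

Let h := 2 * delta.
Let h0 : 0 < h. Proof. exact: mulr_gt0. Qed.
Let b0 : 0 < b. Proof. exact: kappa_max_gt0 d0 au. Qed.
Let lvl := level_fun delta u0.

Lemma phase_lipschitz : exists2 C : R, 0 < C & forall k e, 0 <= k <= b -> 0 <= e <= b -> k <= e ->
  phase (h * e) - phase (h * k) <= C * (e - k).
Proof.
have [pm _] := phase_maxP d0 au; have [C C0 CP] := phase'_bound pm.
exists (C * h); first exact: mulr_gt0.
move=> k e kb eb ke; rewrite (_ : C * h * (e - k) = C * (h * e - h * k)); last by ring.
have /andP[k0 _] := hk_bound d0 au kb; have /andP[_ em] := hk_bound d0 au eb.
by apply: (phase_diff_le pm CP) em; rewrite k0/= ler_pM2l.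
Qed.

Lemma moment_integrable : mu.-integrable setT (fun x => ((x ^+ 2 + 1) * u0 x)%:E).
Proof. by case: au => _ [_ [_ [_ [_ []]]]]. Qed.

Definition moment : R := \int[mu]_x ((x ^+ 2 + 1) * u0 x).

Lemma moment_ge0 : 0 <= moment.
Proof.
apply: Rintegral_ge0 => x _; rewrite mulr_ge0 ?(ltW (u0_gt0 au x))//.
by rewrite addr_ge0// sqr_ge0.
Qed.

Let gapdiff k e x := gap (lvl k x) - gap (lvl e x).

Let lvl_le k e x : 0 <= k <= b -> 0 <= e <= b -> k <= e -> lvl e x <= lvl k x.
Proof.
move=> kb eb ke; rewrite /lvl /level_fun lerD2l lerN2.
have /andP[k0 _] := hk_bound d0 au kb; have ep := hk_pi d0 au eb.
by apply: phase_le ep; rewrite k0/= ler_pM2l.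
Qed.

Let RWyl_diffE k e : 0 <= k <= b -> 0 <= e <= b ->
  (2 * h) * (Rf k - Rf e) = \int[mu]_x gapdiff k e x.
Proof.
move=> kb eb; rewrite !(RWylE d0 au)// -/h -mulrBr mulrA mulfV ?mul1r; last first.
  by rewrite gt_eqF// mulr_gt0.
have ik := integrable_gap_level d0 au su kb; have ie := integrable_gap_level d0 au su eb.
by symmetry; exact: (RintegralB measurableT ik ie).
Qed.

Let mgapdiff k e : measurable_fun setT (gapdiff k e).
Proof. by apply: measurable_funB; apply: (gap_level_measurable _ au). Qed.

(** The integrand of [D = 2 h (Rf k - Rf e)] is at most [A = C sqrt (C1 (e - k))] and at most
    [B sqrt u0], so [D <= 4 A Y^2 + K / Y] for every [Y > 0]. The choice [Y = 2 K / D] yields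
    [D^3 <= 32 K^2 A], and squaring turns the root in [A] into the distance: hence the exponent
    6. *)
Lemma RWyl_holder : exists2 c0 : R, 0 < c0 & forall k e, 0 <= k <= b -> 0 <= e <= b ->
  c0 * `|Rf k - Rf e| ^+ 6 <= `|k - e|.
Proof.
have [C C0 CP] := gap_sqrt_bound d0 au; have [C1 C10 C1P] := phase_lipschitz.
pose B := C * Num.sqrt h; have B0 : 0 < B by rewrite mulr_gt0// sqrtr_gt0.
have M0 := moment_ge0.
pose K := B * (moment + 4) / 2; have K0 : 0 < K by rewrite divr_gt0// mulr_gt0//; lra.
exists ((2 * h) ^+ 6 / (32 * K ^+ 2 * C) ^+ 2 / C1).
  have h6 : 0 < (2 * h) ^+ 6 by rewrite exprn_gt0// mulr_gt0.
  have q0 : 0 < (32 * K ^+ 2 * C) ^+ 2.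
    by rewrite exprn_gt0// mulr_gt0// mulr_gt0// exprn_gt0.
  by rewrite !divr_gt0.
move=> k e; wlog ke : k e / k <= e => [H kb eb|kb eb].
  have [ke|/ltW ke] := leP k e; first exact: H.
  by rewrite distrC [leRHS]distrC; exact: H.
have ek0 : 0 <= e - k by lra.
pose D := 2 * h * (Rf k - Rf e).
pose A := C * Num.sqrt (C1 * (e - k)).
have A0 : 0 <= A by rewrite mulr_ge0 ?(ltW C0).
have hux x : h * u0 x <= h * u0 xmax by rewrite ler_pM2l// (u0_le_max au).
have g0 x : 0 <= gapdiff k e x by rewrite subr_ge0 gap_le// lvl_le.
have gA x : gapdiff k e x <= A.
  have le1 := le_trans (level_le d0 au x kb) (hux x).
  apply: (le_trans (CP _ _ le1 (lvl_le x kb eb ke))).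
  rewrite ler_pM2l// ler_wsqrtr// /lvl /level_fun -/h.
  by have := C1P k e kb eb ke; lra.
have gB x : gapdiff k e x <= B * Num.sqrt (u0 x).
  have ux := ltW (u0_gt0 au x).
  apply: (@le_trans _ _ (gap (lvl k x))); first by rewrite lerBlDr lerDl gap_ge0.
  apply: (le_trans (gap_le (level_le d0 au x kb))).
  have := CP (h * u0 x) 0 (hux x) (mulr_ge0 (ltW h0) ux).
  by rewrite (gap_npos (lexx 0)) !subr0 sqrtrM ?(ltW h0)// mulrA.
have DE : D = \int[mu]_x gapdiff k e x by exact: RWyl_diffE.
have D0 : 0 <= D by rewrite DE Rintegral_ge0.
have key (Y : R) : 0 < Y -> D <= 4 * A * Y ^+ 2 + K / Y.
  move=> Y0; rewrite DE; apply: (le_trans (tail_interpolation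
    (fun x => ltW (u0_gt0 au x)) moment_integrable A0 (ltW B0) Y0 (mgapdiff k e) _ gB)).
    by move=> x; rewrite g0 gA.
  rewrite lerD2l /K -/moment le_eqVlt; apply/orP; left; apply/eqP.
  by field; rewrite gt_eqF.
have D3 : D ^+ 3 <= 32 * K ^+ 2 * A.
  have [->|Dn] := eqVneq D 0; first by rewrite expr0n /= mulr_ge0// mulr_ge0// sqr_ge0.
  have {}D0 : 0 < D by rewrite lt_neqAle eq_sym Dn.
  have Y0 : 0 < 2 * K / D by rewrite divr_gt0// mulr_gt0.
  have := key _ Y0.
  rewrite (_ : K / (2 * K / D) = D / 2); last by field; rewrite !gt_eqF.
  move=> h1; have h2 : D / 2 <= 4 * A * (2 * K / D) ^+ 2 by lra.
  have : D / 2 * (2 * D ^+ 2) <= 4 * A * (2 * K / D) ^+ 2 * (2 * D ^+ 2).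
    by rewrite ler_wpM2r// mulr_ge0// sqr_ge0.
  rewrite (_ : D / 2 * (2 * D ^+ 2) = D ^+ 3); last by field.
  by rewrite (_ : 4 * A * _ ^+ 2 * _ = 32 * K ^+ 2 * A)//; field; rewrite gt_eqF.
have D6 : D ^+ 6 <= (32 * K ^+ 2 * C) ^+ 2 * (C1 * (e - k)).
  rewrite (_ : D ^+ 6 = (D ^+ 3) ^+ 2); last by rewrite -exprM.
  rewrite -[C1 * (e - k)]sqr_sqrtr ?mulr_ge0 ?(ltW C10)// -exprMn.
  rewrite ler_sqr ?nnegrE ?exprn_ge0//; first by apply: (le_trans D3); rewrite /A mulrA.
  by rewrite mulr_ge0// mulr_ge0 ?(ltW C0)// mulr_ge0// sqr_ge0.
have RD : 0 <= Rf k - Rf e.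
  by rewrite -(pmulr_rge0 _ (mulr_gt0 (ltr0Sn R 1) h0)).
rewrite ger0_norm// [leRHS]distrC ger0_norm//.
have E : D ^+ 6 = (2 * h) ^+ 6 * (Rf k - Rf e) ^+ 6 by rewrite /D exprMn.
have Q0 : 0 < (32 * K ^+ 2 * C) ^+ 2 by rewrite exprn_gt0// mulr_gt0// mulr_gt0// exprn_gt0.
move: D6; rewrite E => D6.
rewrite mulrAC ler_pdivrMr// mulrAC ler_pdivrMr// [(e - k) * _]mulrC.
by rewrite [leRHS]mulrC.
Qed.

(** The integrand of the difference is nonnegative, continuous, and positive at [xmax], where the
    level of [k] is positive; so it exceeds a positive constant on an interval to the right of
    [xmax]. *)
Lemma RWyl_lt k e : 0 <= k <= b -> 0 <= e <= b -> k < e -> Rf e < Rf k.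
Proof.
move=> kb eb ke; rewrite -subr_gt0 -(pmulr_rgt0 _ (mulr_gt0 (ltr0Sn R 1) h0)).
rewrite (RWyl_diffE kb eb).
have g0 x : 0 <= gapdiff k e x by rewrite subr_ge0 gap_le// lvl_le// ltW.
have gm : 0 < gapdiff k e xmax.
  have /andP[k0 _] := hk_bound d0 au kb; have /andP[_ em] := hk_bound d0 au eb.
  have ep := hk_pi d0 au eb.
  have hke : h * k < h * e by rewrite ltr_pM2l.
  have lt : phase (h * k) < phase (h * e) by apply: phase_lt ep; rewrite k0.
  have [/andP[_ pp] pE] := phase_maxP d0 au.
  have le : phase (h * e) <= h * u0 xmax.
    rewrite -pE; apply: phase_le pp; rewrite em andbT; exact: le_trans (ltW hke).
  by rewrite subr_gt0 gap_lt// /lvl /level_fun -/h; lra.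
have cg : {for xmax, continuous (gapdiff k e)}.
  have cl z : continuous (fun x => gap (lvl z x)).
    move=> x; apply: (@continuous_comp _ _ _ (lvl z) (@gap R)); last exact: continuous_gap.
    apply: cvgB; last exact: cvg_cst.
    by apply: cvgM; [exact: cvg_cst|exact: u0_continuous au _].
  by apply: cvgB; exact: cl.
pose c := gapdiff k e xmax / 2; have c0 : 0 < c by rewrite divr_gt0.
have : \forall x \near xmax, c < gapdiff k e x.
  by apply: cvgr_gt cg _ _; rewrite /c; lra.
move=> [d /= dd dP].
pose I : set R := `]xmax, xmax + d[%classic.
have ik := integrable_gap_level d0 au su kb; have ie := integrable_gap_level d0 au su eb.
have ig : mu.-integrable setT (EFin \o gapdiff k e) by exact: (integrable_sub _ ik ie).
rewrite -lte_fin (Rintegral_fineK measurableT ig).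
have mE (A : set R) : measurable A -> measurable_fun A (EFin \o gapdiff k e).
  by move=> mA; apply/measurable_EFinP; exact: measurable_funTS (mgapdiff k e).
apply: (@lt_le_trans _ _ (\int[mu]_(x in I) c%:E)%E).
  rewrite integral_cst//=; last exact: measurable_itv.
  rewrite -/mu lebesgue_measure_itv/= lte_fin ltrDl dd -EFinD -EFinM lte_fin.
  by rewrite mulr_gt0// addrC addKr.
apply: (@le_trans _ _ (\int[mu]_(x in I) (gapdiff k e x)%:E)%E).
  apply: ge0_le_integral => //.
  - exact: measurable_itv.
  - by move=> x _; rewrite lee_fin ltW.
  - by apply: mE; exact: measurable_itv.
  - move=> x; rewrite /I /= in_itv/= => /andP[x1 x2]; rewrite lee_fin ltW//.
    by apply: dP; rewrite /ball_ /= ltr_norml; apply/andP; split; lra.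
apply: ge0_subset_integral => //; [exact: measurable_itv|exact: mE|].
by move=> x _; rewrite lee_fin.
Qed.

Lemma soliton_profile : exists c0, density_profile b rho Rf c0.
Proof.
have [c0 c00 c0P] := RWyl_holder; exists c0; split => //.
- exact: integrable_soliton_density d0 au su.
- exact: soliton_density_ge0 d0.
- by move=> k kb; rewrite (RWyl_soliton_density d0 au su kb).
- exact: RWyl_lt.
Qed.

Lemma rhoWyl_soliton_density :
  {ae mu, forall x, 0 < x < b -> rhoWyl delta u0 xmax x = rho x}.
Proof.
have ir := integrable_soliton_density d0 au su.
have irS y : mu.-integrable [set` Interval (BRight 0) (BRight y)] (EFin \o rho).
  exact: integrableS ir.
have := FTC1 irS (open_integrable_locally openT ir).
move=> [A [mA A0 AP]]; exists A; split => // x; apply: contra_notP => /(contra_not (@AP x))/contrapT xP.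
move=> /andP[x0 xb].
have /xP[dF FE] : (BRight 0 < BRight x)%O by rewrite bnd_simp.
have zb : 0 <= (0 : R) <= b by rewrite lexx ltW.
set F := (fun y : R => _) in dF FE.
have near_eq : \forall y \near x, Rf y = Rf 0 - F y.
  near=> y; have yb : 0 <= y <= b.
    apply/andP; split; apply: ltW; near: y; [exact: lt_nbhsr|exact: lt_nbhsl].
  rewrite !(RWyl_soliton_density d0 au su)// /F.
  apply/esym; apply: Rintegral_itvB; rewrite ?bnd_simp; last 2 first.
  - by case/andP: yb.
  - by case/andP: yb.
  - exact: integrableS ir.
rewrite /rhoWyl derive1E (near_eq_derive _ near_eq).
have d1 := @is_deriveB _ _ _ (cst (Rf 0)) F x 1 0 _ (is_derive_cst _ _ _) (DeriveDef dF erefl).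
have [_ d2] := d1; rewrite [X in - X]d2 sub0r opprK.
by rewrite -FE derive1E.
Unshelve. all: by end_near.
Qed.

End SolitonProfile.

(** * The phase integral *)

Lemma sqrtr_le_sqr (R : rcfType) (z e : R) : 0 <= e -> z <= e ^+ 2 -> Num.sqrt z <= e.
Proof. by move=> e0 /ler_wsqrtr; rewrite sqrtr_sqr ger0_norm. Qed.

Section PhaseInverse.
Context {R : realType}.
Implicit Types s t : R.

Definition phase_inv s : R := xget 0 [set y | 0 <= y < pi /\ phase y = s].

Lemma phase_invP s : 0 <= s -> 0 <= phase_inv s < pi /\ phase (phase_inv s) = s.
Proof.
move=> s0; apply: (@xgetPex _ (0:R) [set y | 0 <= y < pi /\ phase y = s]).
by have [y yb yE] := phase_surj s0; exists y.
Qed.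

Lemma phase_inv_le s t : 0 <= s <= t -> phase_inv s <= phase_inv t.
Proof.
move=> /andP[s0 st]; have [/andP[a0 ap] aE] := phase_invP s0.
have [/andP[c0 cp] cE] := phase_invP (le_trans s0 st).
rewrite leNgt; apply/negP => lt; move: st.
by rewrite -aE -cE leNgt phase_lt// c0.
Qed.

Lemma phase_inv_holder s t : 0 <= s -> 0 <= t ->
  `|phase_inv s - phase_inv t| <= Num.sqrt (2 * `|s - t|).
Proof.
wlog ts : s t / t <= s => [H s0 t0|s0 t0].
  have [ts|/ltW ts] := leP t s; first exact: H.
  by rewrite distrC [`|s - t|]distrC; exact: H.
have [/andP[a0 ap] aE] := phase_invP s0; have [/andP[c0 cp] cE] := phase_invP t0.
have le : phase_inv t <= phase_inv s by apply: phase_inv_le; rewrite t0.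
have := @phase_diff_ge R (phase_inv s) (phase_inv t).
rewrite c0 le aE cE => /(_ isT ap) H.
rewrite -sqrtr_sqr ler_wsqrtr// [`|s - t|]ger0_norm ?subr_ge0//; lra.
Qed.

End PhaseInverse.

Section Theta.
Context {R : realType}.
Variables (delta : R) (u0 : R -> R) (xmax : R).
Hypothesis d0 : 0 < delta.
Hypothesis au : admissible_u0 u0 xmax.
Local Notation mu := (@lebesgue_measure R).
Local Notation b := (kappa_max delta u0 xmax).
Implicit Types (k e x y : R).
Hypothesis su : mu.-integrable setT (fun x => (Num.sqrt (u0 x))%:E).

Let h := 2 * delta.
Let h0 : 0 < h. Proof. exact: mulr_gt0. Qed.
Let b0 : 0 < b. Proof. exact: kappa_max_gt0 d0 au. Qed.
Let lvl := level_fun delta u0.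

(** Only [k = 0], where [zeta] is given by its limit, needs care: [cos z <= z cot z <= 1] for small
    positive [z = h k]. *)
Lemma curve_re_ucont : ucont b (curve_re delta).
Proof.
apply: continuous_ucont => x /[dup] xb /andP[x0 xb'] e e0.
have [->|xn] := eqVneq x 0.
  have he0 : 0 < h * e by exact: mulr_gt0.
  have /cvgrPdist_le/(_ _ he0)[d/= dd dP] := @continuous_cos R 0.
  have pp := @pi_gt0 R.
  exists (Num.min (d / h) (pi / 2 / h)); first by rewrite lt_min !divr_gt0.
  move=> y /andP[y0 _]; rewrite sub0r normrN ger0_norm// lt_min !ltr_pdivlMr// ![y * h]mulrC.
  move=> /andP[yd yp]; rewrite /curve_re /zeta eqxx -/h.
  have [_|yn] := eqVneq y 0; first by rewrite /= subrr normr0 ltW.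
  have {}y0 : 0 < y by rewrite lt_neqAle eq_sym yn.
  have z0 : 0 < h * y by exact: mulr_gt0.
  rewrite /= (_ : h^-1 - y * _ = h^-1 * (1 - (h * y) * (cos (h * y) / sin (h * y)))); last first.
    by move: (cos _ / sin _) => q; field; rewrite gt_eqF.
  rewrite normrM [`|h^-1|]gtr0_norm ?invr_gt0// mulrC ler_pdivrMr// [e * h]mulrC.
  have /= := dP (h * y); rewrite sub0r normrN gtr0_norm// cos0 => /(_ yd) H.
  move: (h * y) z0 yp H => z z0 zp H.
  have zpi : z < pi by lra.
  have s0 : 0 < sin z by apply: sin_gt0_pi; rewrite z0.
  have c0 : 0 < cos z by apply: cos_gt0_pihalf; apply/andP; split; lra.
  have h1 := sin_le_id (ltW z0); have h2 := cos_mul_le_sin (ltW z0) (ltW zpi).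
  have l3 : z * (cos z / sin z) <= 1 by rewrite mulrA ler_pdivrMr// mul1r.
  have l4 : cos z <= z * (cos z / sin z).
    rewrite mulrA ler_pdivlMr//; rewrite mulrC; apply: ler_wpM2r => //; exact: ltW.
  rewrite ger0_norm ?subr_ge0//; apply: le_trans H; apply: (le_trans _ (ler_norm _)); lra.
have {}x0 : 0 < x by rewrite lt_neqAle eq_sym xn.
have hx : 0 < h * x < pi by rewrite mulr_gt0//= (hk_pi d0 au).
have sx : sin (h * x) != 0 by rewrite gt_eqF// sin_gt0_pi.
have ch : {for x, continuous (fun y : R => h * y)} by apply: cvgM; [exact: cvg_cst|exact: cvg_id].
have : {for x, continuous (fun y : R => y * (cos (h * y) / sin (h * y)))}.
  apply: cvgM; first exact: cvg_id.
  apply: cvgM.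
    by apply: (@continuous_comp _ _ _ (fun y => h * y) (@cos R)) => //; exact: continuous_cos.
  apply: cvgV => //.
  by apply: (@continuous_comp _ _ _ (fun y => h * y) (@sin R)) => //; exact: continuous_sin.
move=> /cvgrPdist_le/(_ _ e0)[d/= dd dP].
(* The bound by [x] keeps [y] away from 0, where [zeta] switches formula. *)
exists (Num.min d x); first by rewrite lt_min dd.
move=> y _; rewrite lt_min => /andP[yd yx]; have := dP y yd.
have yn : y != 0.
  by apply/eqP => y00; move: yx; rewrite y00 subr0 gtr0_norm// ltxx.
by rewrite /curve_re /zeta (negbTE xn) (negbTE yn) -/h.
Qed.

(* For [x] beyond [x_+] this is the integrand of [theta_+].  On [[xmax, x_+]] the level
   is nonnegative, so that the integrand is [k]: it absorbs [k (x_+ - xmax)]. *)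
Definition theta_integrand k x : R := k - phase_inv (Num.max 0 (- lvl k x)) / h.

(** A form of [theta_+] in which the moving endpoint [x_+], infinite at [k = 0], is replaced by
    [xmax]; continuity up to [k = 0] becomes accessible. *)
Definition theta_shift k : R := k * xmax + \int[mu]_(x in `]xmax, +oo[) theta_integrand k x.

Let neg_level_ge0 k x : 0 <= Num.max 0 (- lvl k x).
Proof. by rewrite le_max lexx. Qed.

Lemma max0_dist (s t : R) : `|Num.max 0 s - Num.max 0 t| <= `|s - t|.
Proof.
have [s0|/ltW s0] := leP 0 s; have [t0|/ltW t0] := leP 0 t;
  rewrite ?(max_idPr s0) ?(max_idPr t0) ?(max_idPl s0) ?(max_idPl t0)//.
- by rewrite subr0 !ger0_norm//; lra.
- by rewrite sub0r normrN ger0_norm// ler0_norm//; lra.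
- by rewrite subrr normr0.
Qed.

Lemma theta_integrand_continuous k : continuous (theta_integrand k).
Proof.
move=> x; apply: cvgB; first exact: cvg_cst.
apply: cvgM; last exact: cvg_cst.
apply/cvgrPdist_le => e e0.
have e20 : 0 < e ^+ 2 / 2 / h by rewrite !divr_gt0// exprn_gt0.
have /cvgrPdist_le/(_ _ e20) := @u0_continuous _ _ _ au x; apply: filterS => y yP.
apply: (le_trans (phase_inv_holder (neg_level_ge0 k x) (neg_level_ge0 k y))).
apply: (sqrtr_le_sqr (ltW e0)).
rewrite mulrC -ler_pdivlMr//; apply: (le_trans (max0_dist _ _)).
rewrite /lvl /level_fun -/h (_ : _ - _ = - (h * (u0 x - u0 y))); last by ring.
by rewrite normrN normrM gtr0_norm// mulrC -ler_pdivlMr.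
Qed.

Lemma theta_integrand_measurable k : measurable_fun setT (theta_integrand k).
Proof. exact: continuous_measurable_fun (@theta_integrand_continuous k). Qed.

(** With [y] the value of [phase_inv], [phase (h k) - phase y <= h u0 x], and the quadratic lower
    bound on [phase] gives [(h k - y)^2 <= 2 h u0 x]. *)
Lemma theta_integrand_bound k x : 0 <= k <= b ->
  0 <= theta_integrand k x <= Num.sqrt (2 * h) / h * Num.sqrt (u0 x).
Proof.
move=> kb; have hkp := hk_pi d0 au kb; have /andP[hk0 _] := hk_bound d0 au kb.
rewrite -/h in hkp hk0; have ux := ltW (u0_gt0 au x).
have [/andP[y0 yp]] := phase_invP (neg_level_ge0 k x).
rewrite /theta_integrand; move: (phase_inv _) y0 yp => y y0 yp yE.
have ple : phase y <= phase (h * k).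
  rewrite yE ge_max phase_ge0 ?hk0//= /lvl /level_fun -/h opprB lerBlDr lerDl.
  by rewrite mulr_ge0// ltW.
have yk : y <= h * k.
  by rewrite leNgt; apply/negP => lt; move: ple; rewrite leNgt phase_lt// hk0.
have pd : phase (h * k) - phase y <= h * u0 x.
  have : - lvl k x <= phase y by rewrite yE le_max lexx orbT.
  by rewrite /lvl /level_fun -/h; lra.
have := @phase_diff_ge R (h * k) y; rewrite y0 yk => /(_ isT hkp) sq.
rewrite (_ : k - y / h = (h * k - y) / h); last by field; rewrite gt_eqF.
rewrite divr_ge0 ?subr_ge0 ?(ltW h0)//= [leRHS]mulrAC ler_pM2r ?invr_gt0//.
have y1 : 0 <= h * k - y by lra.
have h2 : 0 <= 2 * h by rewrite mulr_ge0// ltW.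
rewrite -(sqrtrM _ h2) -(ger0_norm y1) -sqrtr_sqr ler_wsqrtr//.
rewrite -[leRHS]mulrA; have := le_trans sq pd; rewrite ler_pdivrMr// [_ * 2]mulrC.
exact.
Qed.

Lemma integrable_theta_integrand k : 0 <= k <= b ->
  mu.-integrable setT (EFin \o theta_integrand k).
Proof.
move=> kb; have i1 := integrable_scale measurableT (Num.sqrt (2 * h) / h) su.
apply: integrable_dominated i1 => //; first exact: theta_integrand_measurable.
by move=> x _; have /andP[t0 tB] := theta_integrand_bound x kb; rewrite ger0_norm.
Qed.

Lemma Wm1_theta_integrand k x : 0 <= k <= b -> lvl k x < 0 ->
  cIm (Defs.cadd (zeta delta k) (Defs.cscale (2 * delta)^-1 (Wm1 (aa delta k (u0 x))))) =
  theta_integrand k x.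
Proof.
move=> kb l0; have /andP[k0 _] := kb.
have [/andP[y0 yp] yE] := phase_invP (neg_level_ge0 k x).
have lE : Num.max 0 (- lvl k x) = - lvl k x by apply/max_idPr; lra.
rewrite /theta_integrand; move: (phase_inv _) y0 yp yE => y y0 yp; rewrite lE => yE.
have {}y0 : 0 < y.
  rewrite lt_neqAle y0 andbT; apply/eqP => y00.
  by move: l0; rewrite -oppr_gt0 -yE -y00 phase0 ltxx.
rewrite aaE//; last exact: (hk_pi d0 au kb).
have -> : phase (2 * delta * k) - 1 - 2 * delta * u0 x = phase y - 1.
  by rewrite yE /lvl /level_fun /h; ring.
rewrite Wm1_complex ?y0// zetaE /cIm /= -/h mulrN.
by rewrite mulrC.
Qed.

Lemma theta_plusE k : 0 < k <= b -> theta_plus delta u0 xmax k = theta_shift k.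
Proof.
move=> kb; have /andP[k0 kb'] := kb; have kb2 : 0 <= k <= b by rewrite kb' ltW.
have [mp _] := xplusP d0 au kb; rewrite /theta_plus /theta_shift.
set X := xplus delta u0 xmax k in mp *.
have iT := integrable_theta_integrand kb2.
have -> : \int[mu]_(x in `]X, +oo[) cIm (Defs.cadd (zeta delta k)
    (Defs.cscale (2 * delta)^-1 (Wm1 (aa delta k (u0 x))))) =
    \int[mu]_(x in `]X, +oo[) theta_integrand k x.
  apply: eq_Rintegral => x; rewrite inE/= in_itv/= andbT => Xx.
  apply: Wm1_theta_integrand => //.
  by rewrite ltNge -(le_xplus d0 au kb) ?(le_trans mp (ltW Xx))// -/X -ltNge.
have -> : \int[mu]_(x in `]xmax, +oo[) theta_integrand k x =
    \int[mu]_(x in `]xmax, X]) theta_integrand k x + \int[mu]_(x in `]X, +oo[) theta_integrand k x.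
  rewrite (_ : `]xmax, +oo[ = `]xmax, X] `|` `]X, +oo[)%classic; last first.
    apply/seteqP; split => x /=; rewrite !in_itv/= !andbT.
      by move=> mx; have [xX|Xx] := leP x X; [left; rewrite mx|right].
    by move=> [/andP[]//|]; exact: le_lt_trans.
  rewrite Rintegral_setU//.
  - apply: integrableS iT => //; apply: measurableU; exact: measurable_itv.
  - by apply/disj_setPS => x /=; rewrite !in_itv/= andbT => -[/andP[_ h1] h2]; lra.
rewrite addrA; congr (_ + _).
have -> : \int[mu]_(x in `]xmax, X]) theta_integrand k x = \int[mu]_(x in `]xmax, X]) k.
  apply: eq_Rintegral => x; rewrite inE/= in_itv/= => /andP[xm xX].
  have l0 : 0 <= lvl k x by rewrite -(le_xplus d0 au kb)// ltW.
  rewrite /theta_integrand (max_idPl _); last by rewrite oppr_le0.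
  have [/andP[y0 yp] yE] := phase_invP (lexx (0:R)).
  rewrite (_ : phase_inv 0 = 0) ?mul0r ?subr0//.
  apply/eqP; rewrite eq_le y0 andbT leNgt; apply/negP => lt.
  have zz : 0 <= (0 : R) < phase_inv 0 by apply/andP; split.
  by have := phase_lt zz yp; rewrite yE phase0 ltxx.
rewrite Rintegral_cst//= lebesgue_measure_itv/= lte_fin.
rewrite (_ : (if _ then _ else _) = (X - xmax)%:E) /=; first by ring.
case: ltP => [mX|Xm]; first by rewrite -EFinB.
by congr EFin; lra.
Qed.

(** The interpolation of [RWyl_holder] again: the increment of the integrand is uniformly small by
    the Hoelder bound on [phase_inv], and at most a multiple of [sqrt u0] because both integrands
    lie between 0 and that multiple. *)
Lemma theta_shift_ucont : ucont b theta_shift.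
Proof.
move=> ep ep0; have [C1 C10 C1P] := phase_lipschitz d0 au.
pose B := Num.sqrt (2 * h) / h.
have B0 : 0 < B by rewrite divr_gt0// sqrtr_gt0 mulr_gt0.
have M0 := moment_ge0 au.
pose K := B * (moment u0 + 4) / 2; have K0 : 0 < K by rewrite divr_gt0// mulr_gt0//; lra.
pose Y := 3 * K / ep; have Y0 : 0 < Y by rewrite divr_gt0// mulr_gt0.
pose A (d : R) := d + Num.sqrt (2 * (C1 * d)) / h.
(* [Y] makes the tail [K / Y] small; then [d] makes [4 A d Y^2] and [|xmax| d] small. *)
pose a := ep / 3 / (4 * Y ^+ 2); have a0 : 0 < a by rewrite !divr_gt0// mulr_gt0// exprn_gt0.
pose d1 := a / 2; pose d2 := (a / 2 * h) ^+ 2 / (2 * C1); pose d3 := ep / 3 / (`|xmax| + 1).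
have x1 : 0 < `|xmax| + 1 by have := normr_ge0 xmax; lra.
pose d := Num.min d1 (Num.min d2 d3).
have d1d : d <= d1 by rewrite ge_min lexx.
have d2d : d <= d2 by rewrite !ge_min lexx !orbT.
have d3d : d <= d3 by rewrite !ge_min lexx !orbT.
have dd : 0 < d.
  have q1 : 0 < a / 2 * h by rewrite mulr_gt0// divr_gt0.
  have q2 : 0 < d2 by apply: divr_gt0; [exact: exprn_gt0|exact: mulr_gt0].
  have q3 : 0 < d3 by apply: divr_gt0 => //; exact: divr_gt0.
  by rewrite !lt_min q2 q3 divr_gt0.
have Ad : A d <= a.
  rewrite /A; have : Num.sqrt (2 * (C1 * d)) / h <= a / 2.
    have q1 : 0 <= a / 2 * h by rewrite mulr_ge0 ?(ltW h0)// divr_ge0// ltW.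
    rewrite ler_pdivrMr//; apply: (sqrtr_le_sqr q1).
    by rewrite mulrA mulrC -ler_pdivlMr// mulr_gt0.
  by move: d1d; rewrite /d1; lra.
have A0 : 0 <= A d by rewrite addr_ge0 ?(ltW dd)// divr_ge0 ?(ltW h0).
exists d => // k e kb eb ked.
pose g x := `|theta_integrand k x - theta_integrand e x|.
have ik := integrable_theta_integrand kb; have ie := integrable_theta_integrand eb.
have idf : mu.-integrable setT (EFin \o (fun x => theta_integrand k x - theta_integrand e x)).
  exact: (integrable_sub _ ik ie).
have ig : mu.-integrable setT (EFin \o g) by exact: (integrable_absr idf).
have mg : measurable_fun setT g by exact: (integrable_measurable ig).
have gA x : g x <= A d.
  rewrite /g /theta_integrand (_ : _ - _ - _ = (k - e) - (phase_inv (Num.max 0 (- lvl k x))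
     - phase_inv (Num.max 0 (- lvl e x))) / h); last by ring.
  apply: (le_trans (ler_normB _ _)); rewrite /A lerD//.
  rewrite normrM [`|h^-1|]gtr0_norm ?invr_gt0// ler_pM2r ?invr_gt0//.
  apply: (le_trans (phase_inv_holder (neg_level_ge0 k x) (neg_level_ge0 e x))).
  rewrite ler_wsqrtr// ler_pM2l//; apply: (le_trans (max0_dist _ _)).
  rewrite /lvl /level_fun -/h (_ : _ - _ = phase (h * k) - phase (h * e)); last by ring.
  apply: (@le_trans _ _ (C1 * `|k - e|)); last by rewrite ler_pM2l.
  have mono k' e' : 0 <= k' <= b -> 0 <= e' <= b -> k' <= e' ->
      `|phase (h * k') - phase (h * e')| <= C1 * `|k' - e'|.
    move=> kb' eb' le; rewrite distrC [X in C1 * X]distrC [in leRHS]ger0_norm ?subr_ge0//.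
    rewrite ger0_norm ?C1P// subr_ge0; apply: phase_le (hk_pi d0 au eb').
    by have /andP[-> _] := hk_bound d0 au kb'; rewrite ler_pM2l.
  have [le|/ltW le] := leP k e; first exact: mono.
  by rewrite distrC [X in C1 * X]distrC; exact: mono.
have gB x : g x <= B * Num.sqrt (u0 x).
  have /andP[? ?] := theta_integrand_bound x kb; have /andP[? ?] := theta_integrand_bound x eb.
  by rewrite /g ler_norml /B; apply/andP; split; lra.
have H1 : \int[mu]_x g x <= 4 * A d * Y ^+ 2 + K / Y.
  apply: (le_trans (tail_interpolation
    (fun x => ltW (u0_gt0 au x)) (moment_integrable au) A0 (ltW B0) Y0 mg _ gB)).
    by move=> x; rewrite gA normr_ge0.
  rewrite lerD2l /K -/(moment u0) le_eqVlt; apply/orP; left; apply/eqP.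
  by field; rewrite gt_eqF.
have H2 : `|\int[mu]_(x in `]xmax, +oo[) theta_integrand k x
          - \int[mu]_(x in `]xmax, +oo[) theta_integrand e x| <= \int[mu]_x g x.
  have ikS : mu.-integrable `]xmax, +oo[ (EFin \o theta_integrand k) by exact: integrableS ik.
  have ieS : mu.-integrable `]xmax, +oo[ (EFin \o theta_integrand e) by exact: integrableS ie.
  rewrite -RintegralB//; apply: (le_trans (le_normr_Rintegral _ _)) => //.
    exact: integrableS idf.
  rewrite -lee_fin !Rintegral_fineK//; last exact: integrableS ig.
  apply: ge0_subset_integral => //.
  exact/measurable_EFinP.
have KY : K / Y = ep / 3 by rewrite /Y; field; rewrite !gt_eqF.
have AY : 4 * A d * Y ^+ 2 <= ep / 3.
  have Y2 : 0 < 4 * Y ^+ 2 by rewrite mulr_gt0// exprn_gt0.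
  by rewrite [4 * _]mulrC -[leLHS]mulrA -ler_pdivlMr.
have X3 : `|(k - e) * xmax| <= ep / 3.
  have : `|k - e| * (`|xmax| + 1) <= ep / 3.
    by rewrite -ler_pdivlMr//; apply: (le_trans ked).
  by apply: le_trans; rewrite normrM ler_wpM2l// lerDl.
rewrite /theta_shift (_ : _ - _ = (k - e) * xmax + (\int[mu]_(x in `]xmax, +oo[) theta_integrand k x
          - \int[mu]_(x in `]xmax, +oo[) theta_integrand e x)); last by ring.
apply: (le_trans (ler_normD _ _)); rewrite (_ : ep = ep / 3 + (ep / 3 + ep / 3)); last by field.
by rewrite lerD//; apply: (le_trans H2); apply: (le_trans H1); rewrite KY lerD2r.
Qed.

End Theta.

(** * Identification of the energies *)

Lemma Rintegral_cc_ae (R : realType) (b : R) (f g : R -> R) (A : set R) :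
  (@lebesgue_measure R).-negligible A ->
  measurable_fun `]0, b] f -> measurable_fun `]0, b] g ->
  (forall x, 0 < x <= b -> ~ A x -> f x = g x) ->
  \int[@lebesgue_measure R]_(x in `[0, b]) f x = \int[@lebesgue_measure R]_(x in `]0, b]) g x.
Proof.
move=> nA mf mg fg; rewrite /Rintegral; congr fine.
transitivity (\int[@lebesgue_measure R]_(x in `]0%R, b]) (f x)%:E)%E.
  by symmetry; apply: integral_itv_obnd_cbnd; exact/measurable_EFinP.
apply: ae_eq_integral => //; [exact/measurable_EFinP|exact/measurable_EFinP|].
apply: negligibleS nA => x; apply: contra_notP => nAx xb; congr EFin.
by apply: fg => //; move: xb; rewrite /= in_itv.
Qed.

Section Identification.
Context {R : realType}.
Variables (delta : R) (u0 : R -> R) (xmax : R).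
Hypothesis d0 : 0 < delta.
Hypothesis au : admissible_u0 u0 xmax.
Hypothesis su : (@lebesgue_measure R).-integrable setT (fun x => (Num.sqrt (u0 x))%:E).
Local Notation mu := (@lebesgue_measure R).
Local Notation b := (kappa_max delta u0 xmax).
Local Notation r := (soliton_density delta u0 xmax).
Local Notation Rf := (RWyl delta u0 xmax).
Local Notation xi := (curve_re delta).
Local Notation th := (theta_shift delta u0 xmax).
Implicit Types (k e x t : R) (rho : R -> R).

Let h := 2 * delta.
Let h0 : 0 < h. Proof. exact: mulr_gt0. Qed.
Let b0 : 0 < b. Proof. exact: kappa_max_gt0 d0 au. Qed.

(* The imaginary part of [(zeta k - h^-1)^2]. *)
Definition curve_im_sqr k : R := 2 * (xi k - h^-1) * k.
Local Notation q := curve_im_sqr.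

Lemma curve_im_sqr_ucont : ucont b q.
Proof.
have uxi := curve_re_ucont d0 au; have [M M0 MP] := ucont_bounded (ltW b0) uxi.
have hi : 0 < h^-1 by rewrite invr_gt0.
move=> e e0; pose c := M + h^-1; have c0 : 0 < c by rewrite addr_gt0.
have e1 : 0 < e / (4 * b) by rewrite divr_gt0// mulr_gt0.
have [d dd dP] := uxi _ e1.
exists (Num.min d (e / (4 * c))); first by rewrite lt_min dd divr_gt0// mulr_gt0.
move=> x y xb yb; rewrite le_min => /andP[xyd xye].
rewrite /q (_ : _ - _ = 2 * ((xi x - xi y) * x + (xi y - h^-1) * (x - y))); last by ring.
rewrite normrM ger0_norm// (_ : e = 2 * (e / 4 + e / 4)); last by field.
rewrite ler_pM2l//; apply: (le_trans (ler_normD _ _)); rewrite lerD// normrM.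
  have /andP[x0 xb'] := xb.
  apply: (@le_trans _ _ (e / (4 * b) * b)); last first.
    by rewrite le_eqVlt; apply/orP; left; apply/eqP; field; rewrite gt_eqF.
  by rewrite ler_pM// ?dP// ger0_norm.
apply: (@le_trans _ _ (c * (e / (4 * c)))); last first.
  by rewrite le_eqVlt; apply/orP; left; apply/eqP; field; rewrite gt_eqF.
rewrite ler_pM//; apply: (le_trans (ler_normB _ _)).
by rewrite lerD ?MP// gtr0_norm.
Qed.

Lemma Vfun_potential k x t : 0 < k <= b -> Vfun delta u0 xmax k x t = potential q th x t k.
Proof.
move=> kb; rewrite /Vfun /potential (theta_plusE d0 au su kb) zetaE.
by congr (_ + _ * _ - _); rewrite /cIm /q /h /=; ring.
Qed.

(** The identity extends to [k = e], where both sides are 0 by the conventions for division and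
    [ln]. *)
Lemma ln_cabs_ratio k e :
  ln (cabs (csub (zeta delta k) (cconj (zeta delta e))) / cabs (csub (zeta delta k) (zeta delta e)))
  = log_kernel xi 0 k e.
Proof.
rewrite !zetaE /log_kernel expr0n /= !addr0 /cabs /=.
rewrite opprK -/(far_sqr xi k e) -/(near_sqr xi k e).
have f0 : 0 <= far_sqr xi k e by rewrite addr_ge0// sqr_ge0.
rewrite -sqrtrV ?near_sqr_ge0// -sqrtrM//.
have X0 : 0 <= far_sqr xi k e / near_sqr xi k e by rewrite divr_ge0// near_sqr_ge0.
move: (_ / _) X0 => X; rewrite le_eqVlt => /predU1P[<-|X0].
  by rewrite sqrtr0 ln0// mulr0.
have s0 : 0 < Num.sqrt X by rewrite sqrtr_gt0.
rewrite -[in RHS](sqr_sqrtr (ltW X0)) lnXn// -[ln _ *+ 2]mulr_natl mulrA mulVf ?mul1r//.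
Qed.

Lemma ln_cabs_diag k : 0 <= k ->
  ln (cabs (csub (zeta delta k) (cconj (zeta delta k)))) = ln (2 * k).
Proof.
move=> k0; rewrite zetaE /cabs /= subrr expr0n /= add0r opprK sqrtr_sqr.
by congr ln; rewrite ger0_norm ?addr_ge0//; ring.
Qed.

(** Densities that agree off a null set have the same energy. The endpoints are discarded: 0 because
    the potential is identified for [k > 0] only, and [b] because agreement is assumed inside []0,
    b[] only. *)
Lemma density_energyE rho rho' (A : set R) x t : mu.-negligible A ->
  measurable_fun `[0, b] rho -> subdensity r rho' ->
  (forall k, 0 < k < b -> ~ A k -> rho k = rho' k) ->
  Efunc delta u0 xmax rho x t = energy b xi q th rho' x t.
Proof.
move=> nA mr sr rE; have [c0 H] := soliton_profile d0 au su.
have uxi := curve_re_ucont d0 au.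
pose A' := A `|` [set b].
have nA' : mu.-negligible A'.
  apply: negligibleU => //; exists [set b]; split => //.
  exact: lebesgue_measure_set1.
have rE' k : 0 < k <= b -> ~ A' k -> rho k = rho' k.
  move=> /andP[k0 kb] nAk; apply: rE => [|Ak]; last by apply: nAk; left.
  rewrite k0 lt_neqAle kb andbT; apply/eqP => kE; apply: nAk; right; exact: kE.
have mrS : measurable_fun `]0, b] rho.
  by apply: measurable_funS mr => //; apply: subset_itvr; rewrite bnd_simp.
have mr' : measurable_fun `]0, b] rho' by apply: measurable_funTS; case: sr.
have LE k : Lop delta u0 xmax rho (zeta delta k) = pi^-1 * field b xi rho' k.
  rewrite /Lop; congr (_ * _).
  have mL : measurable_fun `]0, b] (log_kernel xi 0 k) by exact: (measurable_log_kernel H uxi).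
  rewrite /field /density_functional.
  transitivity (\int[mu]_(e in `[0, b]) (log_kernel xi 0 k e * rho e)).
    by apply: eq_Rintegral => e _; rewrite ln_cabs_ratio.
  apply: (Rintegral_cc_ae nA'); [exact: measurable_funM|exact: measurable_funM|].
  by move=> e eb nAe; rewrite rE'.
have mF : measurable_fun `]0, b] (field b xi rho').
  exact: (ucont_measurable_oc H (field_ucont H uxi sr)).
have mP : measurable_fun `]0, b] (potential q th x t).
  apply: (ucont_measurable_oc H).
  exact: (potential_ucont (ltW b0) curve_im_sqr_ucont (theta_shift_ucont d0 au su)).
have mI : measurable_fun `]0, b] (fun k => potential q th x t k + (2 * pi)^-1 * field b xi rho' k).
  by apply: measurable_funD => //; exact: measurable_funM.
have VE k : 0 < k <= b ->
    Vfun delta u0 xmax k x t + 2^-1 * Lop delta u0 xmax rho (zeta delta k) =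
    potential q th x t k + (2 * pi)^-1 * field b xi rho' k.
  by move=> kb; rewrite Vfun_potential// LE mulrA -invfM.
rewrite /Efunc /energy; apply: (Rintegral_cc_ae nA').
- apply: (@eq_measurable_fun _ _ _ _ _ (fun k => (potential q th x t k +
    (2 * pi)^-1 * field b xi rho' k) * rho k)); last exact: measurable_funM.
  by move=> k /set_mem; rewrite /= in_itv/= => kb; rewrite VE.
- exact: measurable_funM.
- by move=> k kb nAk; rewrite VE// rE'.
Qed.

Let nrho : mu.-negligible (~` [set x | 0 < x < b -> rhoWyl delta u0 xmax x = r x]).
Proof. exact: rhoWyl_soliton_density d0 au su. Qed.

Lemma subdensity_admissible rho : subdensity r rho -> admissible delta u0 xmax rho.
Proof.
move=> [mr rr]; split; first exact: measurable_funTS.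
have n0 a : mu.-negligible [set a].
  by exists [set a]; split => //; exact: lebesgue_measure_set1.
apply: negligibleS (negligibleU nrho (negligibleU (n0 0) (n0 b))) => k.
apply: contra_notP => /not_orP[/contrapT nk /not_orP[k0 kb]].
move=> /set_mem; rewrite /= in_itv/= => /andP[k0' kb'].
rewrite nk//; apply/andP; split; rewrite lt_neqAle ?k0' ?kb' andbT; apply/eqP => e.
  by apply: k0; rewrite /= e.
by apply: kb; rewrite /= e.
Qed.

(** Extension by 0 and clipping between 0 and the soliton density enforce the bounds everywhere;
    inside the interval this changes [rho] only where its own bounds or the identity of [rhoWyl]
    with the soliton density fail, a null set. *)
Lemma admissible_subdensity rho x t : admissible delta u0 xmax rho ->
  exists2 rho', subdensity r rho' & Efunc delta u0 xmax rho x t = energy b xi q th rho' x t.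
Proof.
move=> [mr ar]; have [c0 H] := soliton_profile d0 au su.
have mr0 : measurable_fun setT r := integrable_measurable (profile_integrable H).
pose rho' y := Num.max 0 (Num.min ((rho \_ `[0, b]) y) (r y)).
have sr : subdensity r rho'.
  split.
    apply: measurable_funTS; apply: measurable_maxr => //; apply: measurable_minr => //.
    exact/(measurable_restrictT _ (measurable_itv `[0, b]%R)).
  move=> y; have r0 := profile_ge0 H y.
  by rewrite /rho' le_max lexx/= ge_max r0/= ge_min lexx orbT.
exists rho' => //; apply: (density_energyE _ _ (negligibleU nrho ar)) => // k kb.
move=> /not_orP[/contrapT nk /contrapT ak]; have /andP[k0 kb'] := kb.
have kin : k \in `[0, b]%classic by apply/mem_set; rewrite /= in_itv/= !ltW.
have := ak kin; rewrite nk// => /andP[a0 a1].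
by rewrite /rho' patchE kin (min_idPl a1) (max_idPr a0).
Qed.

Lemma kappa_nP N (i : nat) : (i < N)%N ->
  0 <= kappa_n delta u0 xmax N i.+1 <= b /\
  Rf (kappa_n delta u0 xmax N i.+1) = Rf 0 * ((i%:R + 2^-1) / N%:R).
Proof.
move=> iN; have [c0 H] := soliton_profile d0 au su.
have N0 : 0 < N%:R :> R by rewrite ltr0n (leq_ltn_trans _ iN).
have pp := @pi_gt0 R; have L0 := profile0_gt0 H.
have E : pi * (i.+1%:R - 2^-1) * epsN delta u0 xmax N = Rf 0 * ((i%:R + 2^-1) / N%:R).
  rewrite /epsN -natr1; move: (N%:R : R) (i%:R : R) N0 => n m N0.
  move: pi pp => y pp; field.
  by rewrite (gt_eqF N0) (gt_eqF pp).
rewrite /kappa_n E.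
apply: (@xgetPex _ (0 : R) [set k | 0 <= k <= b /\ Rf k = Rf 0 * ((i%:R + 2^-1) / N%:R)]).
have [|k kb kE] := profile_surj H (y := Rf 0 * ((i%:R + 2^-1) / N%:R)); last by exists k.
rewrite mulr_ge0 ?(ltW L0) ?divr_ge0 ?addr_ge0 ?invr_ge0 ?(ltW N0)//=.
rewrite -[leRHS]mulr1 ler_pM2l// ler_pdivrMr// mul1r.
have : (i.+1%:R : R) <= N%:R by rewrite ler_nat.
by rewrite -natr1; lra.
Qed.

Definition nodes (N i : nat) : R := kappa_n delta u0 xmax N i.+1.

Lemma nodes_cell N : (0 < N)%N -> cell_nodes b Rf N (nodes N).
Proof. by move=> _ i /kappa_nP. Qed.

(** The level of a node is a fraction [(i + 1/2) / N < 1] of the level of 0. Positivity is what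
    [Vfun_potential] requires. *)
Lemma nodes_gt0 N i : (i < N)%N -> 0 < nodes N i.
Proof.
move=> iN; have [/andP[k0 kb] kE] := kappa_nP iN.
have [c0 H] := soliton_profile d0 au su; have L0 := profile0_gt0 H.
rewrite /nodes lt_neqAle k0 andbT; apply/eqP => e; move: kE; rewrite -e.
rewrite -{1}[Rf 0]mulr1 => /(mulfI (lt0r_neq0 L0)) E.
have N0 : 0 < N%:R :> R by rewrite ltr0n (leq_ltn_trans _ iN).
have : (i.+1%:R : R) <= N%:R by rewrite ler_nat.
have := congr1 ( *%R^~ N%:R) E; rewrite mul1r divfK ?gt_eqF//.
by move=> -> ; rewrite -[i.+1%:R]natr1; lra.
Qed.

Lemma nodes_inj N i j : (i < N)%N -> (j < N)%N -> nodes N i = nodes N j -> i = j.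
Proof.
move=> iN jN e; have [_ iE] := kappa_nP iN; have [_ jE] := kappa_nP jN.
have [c0 H] := soliton_profile d0 au su; have L0 := profile0_gt0 H.
have N0 : 0 < N%:R :> R by rewrite ltr0n (leq_ltn_trans _ iN).
move: iE; rewrite -/(nodes N i) e jE => /(mulfI (lt0r_neq0 L0)).
move=> /(mulIf (invr_neq0 (lt0r_neq0 N0)))/addIr E.
by apply/eqP; rewrite -(eqr_nat R) E.
Qed.

(** As [pi * epsN N = Rf 0 / N], the factor [pi * epsN N ^+ 2 / 2] is
    [(2 * pi)^-1 * (Rf 0 / N) ^+ 2]. The case distinction in [gfun] is on points of the curve and
    that in [node_kernel] on indices; injectivity of the nodes reconciles them. For [N = 0] all sums
    are empty. *)
Lemma ENS_node_energy N (S : {set 'I_N}) x t :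
  ENS delta u0 xmax S x t = node_energy Rf xi q th (nodes N) S x t.
Proof.
have pp := @pi_gt0 R.
have [N0|N0] := posnP N; last first.
  have N0' : 0 < N%:R :> R by rewrite ltr0n.
  rewrite /ENS /node_energy; congr (_ * _ + _ * _).
  - rewrite /epsN; move: pi (N%:R) pp N0' => y n pp n0; field.
    by rewrite (gt_eqF n0) (gt_eqF pp).
  - apply: eq_bigr => i _; apply: Vfun_potential.
    by rewrite nodes_gt0//=; have [/andP[]] := kappa_nP (ltn_ord i).
  - rewrite /epsN; move: pi (N%:R) pp N0' => y n pp n0; field.
    by rewrite (gt_eqF n0) (gt_eqF pp).
  - apply: eq_bigr => i _; apply: eq_bigr => j _.
    rewrite /gfun /node_kernel /zeta_n -/(nodes N i) -/(nodes N j).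
    have [ij|ij] := eqVneq (i : nat) j.
      by rewrite ij eqxx ln_cabs_diag// ltW// nodes_gt0.
    case: eqVneq => [E|_]; last exact: ln_cabs_ratio.
    move: E; rewrite !zetaE => -[_ /(nodes_inj (ltn_ord i) (ltn_ord j)) ijE].
    by rewrite ijE eqxx in ij.
by rewrite /ENS /node_energy !big1 ?mulr0// => i _; have := leq_trans (ltn_ord i) (eq_leq N0).
Qed.

End Identification.

(** * Convergence of the minimal energies *)

Theorem mainTheorem6 (R : realType) (delta : R) (u0 : R -> R) (xmax : R) :
  0 < delta ->
  admissible_u0 u0 xmax ->
  (@lebesgue_measure R).-integrable setT (fun x => (Num.sqrt (u0 x))%:E) ->
  exists Emin_inf : R -> R -> R,
    (forall x t : R,
        (exists2 rho0 : R -> R, admissible delta u0 xmax rho0 &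
           Emin_inf x t = Efunc delta u0 xmax rho0 x t) /\
        (forall rho : R -> R, admissible delta u0 xmax rho ->
           Emin_inf x t <= Efunc delta u0 xmax rho x t)) /\
    (forall K : set (R * R), compact K ->
       forall e : R, 0 < e ->
       exists N0 : nat, forall N : nat, (N0 <= N)%N ->
         forall p, K p ->
           `| EminN delta u0 xmax N p.1 p.2 - Emin_inf p.1 p.2 | < e).
Proof.
move=> d0 au su; have [c0 H] := soliton_profile d0 au su.
have [Emin [minE limE]] := gas_limit H (curve_re_ucont d0 au) (curve_im_sqr_ucont d0 au)
  (theta_shift_ucont d0 au su) (nodes_cell d0 au su).
exists Emin; split=> [x t|K cK e e0].
  have [[rho0 r0 E0] ler] := minE x t; split.
    exists rho0; first exact: subdensity_admissible d0 au su _ r0.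
    rewrite E0; apply/esym; have [mr _] := r0.
    apply: (density_energyE d0 au su (A := set0)) => //; first exact: negligible_set0.
    exact: measurable_funTS.
  by move=> rho /(admissible_subdensity d0 au su x t)[rho' sr ->]; exact: ler.
have [M [_ MP]] := compact_bounded cK.
pose B := `|M| + 1; have B0 : 0 < B by have := normr_ge0 M; rewrite /B; lra.
have KB p : K p -> `|p.1| <= B /\ `|p.2| <= B.
  move=> Kp; have : M < B by rewrite /B; have := ler_norm M; lra.
  by move=> /MP/(_ _ Kp); rewrite /= prod_normE ge_max => /andP[].
have e20 : 0 < e / 2 by rewrite divr_gt0.
have [N0 N0P] := limE B (e / 2) B0 e20; exists N0.+1 => N NN p /KB[p1 p2].
have [lo [S hi]] := N0P N NN p.1 p.2 p1 p2.
(* The default of the iterated minimum is the energy of the empty set, so the same lower bound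
   covers it. *)
have lo' : Emin p.1 p.2 - e / 2 <= EminN delta u0 xmax N p.1 p.2.
  by apply: le_bigmin => [|S' _]; rewrite (ENS_node_energy d0 au su).
have hi' : EminN delta u0 xmax N p.1 p.2 <= Emin p.1 p.2 + e / 2.
  apply: (le_trans (bigmin_le _ S _)); by rewrite (ENS_node_energy d0 au su).
by rewrite ltr_norml; apply/andP; split; lra.
Qed.
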